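(* Let $R>0$ and $\mathbb{B}_R=\{(x,y)\in\mathbb{R}^2: x^2+y^2<R^2\}$. For a real-valued Dirichlet eigenfunction $u$ of the Laplacian on $\mathbb{B}_R$ with eigenvalue $\lambda$, let $\mathcal{N}(u)=\{x\in\mathbb{B}_R: u(x)=0\}$ be its nodal set in the interior and $\mathcal{H}^1$ the $1$-dimensional Hausdorff measure, and put $$H_2(\mathbb{B}_R)=\limsup_{\lambda\to\infty}\frac{\mathcal{H}^1(\mathcal{N}(u))}{\sqrt\lambda},$$ the limsup being taken over all such eigenfunctions. Then $H_2(\mathbb{B}_R)$ is saturated by a sequence of eigenfunctions whose nodal curves in the interior are geodesics: there is a sequence $(u_k)_{k\ge1}$ of real-valued Dirichlet eigenfunctions on $\mathbb{B}_R$ with eigenvalues $\lambda_k\to\infty$ such that each $\mathcal{N}(u_k)$ is a finite union of straight line segments and $$\lim_{k\to\infty}\frac{\mathcal{H}^1(\mathcal{N}(u_k))}{\sqrt{\lambda_k}}=H_2(\mathbb{B}_R).$$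
   Context: A Dirichlet eigenfunction with eigenvalue $\lambda$ is a function $u\not\equiv 0$ with $-\Delta u=\lambda u$ in the disc and $u=0$ on the boundary circle. The limsup over all eigenfunctions means $\lim_{\Lambda\to\infty}\sup\{\mathcal{H}^1(\mathcal{N}(u))/\sqrt\lambda\}$, the supremum being over all real-valued Dirichlet eigenfunctions $u$ with eigenvalue $\lambda\ge\Lambda$. Line segments here are segments contained in the open disc (their endpoints may lie on the boundary circle and so be excluded). *)

(* Defs.v *)
From HB Require Import structures.
From mathcomp Require Import all_boot all_order all_algebra.
From mathcomp Require Import all_classical all_reals all_analysis.

Set Implicit Arguments.
Unset Strict Implicit.
Unset Printing Implicit Defensive.

Import Order.TTheory GRing.Theory Num.Theory.
Import numFieldNormedType.Exports.

Local Open Scope classical_set_scope.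
Local Open Scope ring_scope.

(* The plane is [R * R]. Its canonical norm is the sup norm, which gives the
   usual topology but not the usual distances: metric notions below go through
   the Euclidean distance [edist]. *)
Definition edist {R : realType} (x y : R * R) : R :=
  Num.sqrt ((x.1 - y.1) ^+ 2 + (x.2 - y.2) ^+ 2).

Definition disc {R : realType} (rho : R) : set (R * R) :=
  [set x | x.1 ^+ 2 + x.2 ^+ 2 < rho ^+ 2].

Definition closed_disc {R : realType} (rho : R) : set (R * R) :=
  [set x | x.1 ^+ 2 + x.2 ^+ 2 <= rho ^+ 2].

Definition circle {R : realType} (rho : R) : set (R * R) :=
  [set x | x.1 ^+ 2 + x.2 ^+ 2 = rho ^+ 2].

(* The element 0 is adjoined so that the empty set has diameter 0. *)
Definition ediam {R : realType} (A : set (R * R)) : \bar R :=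
  ereal_sup (0%E |` [set (edist z.1 z.2)%:E | z in A `*` A]).

Definition hausdorff1_delta {R : realType} (delta : R) (A : set (R * R)) :
    \bar R :=
  ereal_inf [set (\sum_(0 <= i <oo) ediam (U i))%E |
    U in [set U : nat -> set (R * R) |
      A `<=` \bigcup_i U i /\ forall i, (ediam (U i) <= delta%:E)%E]].

(* With this normalization the measure of a segment is its length. *)
Definition hausdorff1 {R : realType} (A : set (R * R)) : \bar R :=
  ereal_sup [set hausdorff1_delta delta A | delta in [set d : R | 0 < d]].

Definition dir_x {R : realType} : R * R := (1, 0).
Definition dir_y {R : realType} : R * R := (0, 1).

Definition C1_on {R : realType} (A : set (R * R)) (f : R * R -> R) : Prop :=
  forall v, v \in [:: dir_x; dir_y] -> forall x, A x ->
    derivable f x v /\ {for x, continuous ('D_v f)}.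

Definition C2_on {R : realType} (A : set (R * R)) (f : R * R -> R) : Prop :=
  [/\ C1_on A f, C1_on A ('D_dir_x f) & C1_on A ('D_dir_y f)].

Definition laplacian {R : realType} (f : R * R -> R) (x : R * R) : R :=
  'D_dir_x ('D_dir_x f) x + 'D_dir_y ('D_dir_y f) x.

(* Classical solutions. A function on the closed disc is represented by a total
   function on the plane, whose values outside the closed disc are irrelevant. *)
Definition dirichlet_eigenfunction {R : realType} (rho lambda : R)
    (u : R * R -> R) : Prop :=
  [/\ C2_on (disc rho) u,
      {within closed_disc rho, continuous u},
      forall x, disc rho x -> - laplacian u x = lambda * u x,
      forall x, circle rho x -> u x = 0 &
      exists2 x, disc rho x & u x != 0].

Definition nodal_set {R : realType} (rho : R) (u : R * R -> R) : set (R * R) :=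
  disc rho `&` [set x | u x = 0].

Definition nodal_ratio {R : realType} (rho lambda : R) (u : R * R -> R) :
    \bar R :=
  (hausdorff1 (nodal_set rho u) * ((Num.sqrt lambda)^-1)%:E)%E.

Definition sup_nodal_ratio {R : realType} (rho Lambda : R) : \bar R :=
  ereal_sup [set nodal_ratio rho z.1 z.2 |
    z in [set z : R * (R * R -> R) |
      Lambda <= z.1 /\ dirichlet_eigenfunction rho z.1 z.2]].

Definition H2 {R : realType} (rho : R) : \bar R :=
  lim (sup_nodal_ratio rho Lambda @[Lambda --> +oo]).

(* [lim] is a total operator; the limit defining [H2] does exist. *)
Lemma cvg_sup_nodal_ratio {R : realType} (rho : R) :
  sup_nodal_ratio rho Lambda @[Lambda --> +oo] --> H2 rho.
Proof.
suff cv : cvg (sup_nodal_ratio rho Lambda @[Lambda --> +oo]) by [].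
apply/cvg_ex; eexists; apply: nonincreasing_cvge => a b ab.
by apply: ereal_sup_le => _ [z [bz zu] <-]; exists z => //; split => //;
  exact: le_trans bz.
Qed.

Definition straight_segment {R : realType} (p q : R * R) : set (R * R) :=
  [set (1 - t) *: p + t *: q | t in [set t : R | 0 <= t <= 1]].

(* A nondegenerate line segment with endpoints in the closed disc, from which
   the endpoints lying on the boundary circle are removed. *)
Definition segment_in_disc {R : realType} (rho : R) (S : set (R * R)) : Prop :=
  exists p q : R * R, [/\ closed_disc rho p, closed_disc rho q, p != q &
    S = straight_segment p q `&` disc rho].

Definition finite_union_of_segments {R : realType} (rho : R)
    (A : set (R * R)) : Prop :=
  exists (n : nat) (S : 'I_n -> set (R * R)),
    (forall i, segment_in_disc rho (S i)) /\ A = \bigcup_i S i.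

(* Main.v *)
(* Both sides equal [2 rho^2].

   Separation of variables shows that every eigenfunction of the disc is
   [(a cos (m t) + b sin (m t)) J_m (mu r)], with [mu = sqrt lambda]: its Fourier
   coefficients in the angle solve Bessel's equation, so they vanish except at
   the orders [m] such that [J_m (mu rho) = 0], and Bourget's hypothesis says
   that [m] is unique.  The nodal set is then contained in [2 m] radii and in
   circles of radii [z / mu], where [z] runs over the zeros of [J_m] in
   [(0, x)], [x = mu rho].  By Sturm comparison these zeros are spaced so that
   [m x + pi * sum z <= x^2], whence a ratio at most [2 rho^2].

   If [j_m] is the first positive zero of [J_m] and [mu = j_m / rho], the
   nodal set of [cos (m t) J_m (mu r)] consists of [m] diameters, its ratio is
   [2 rho^2 m / j_m], and [j_m / m --> 1].

   Bourget's hypothesis follows from Siegel's theorem.  A common positive zero of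
   two [J_m] would, by the recurrence relations, be at an [x] with [x^2]
   algebraic where [J_0] and [J_0'] have an algebraic ratio; with Siegel's lemma
   one builds a form in [J_0] and [J_0'] vanishing to high order at the origin,
   whose values at [x] contradict Liouville's inequality. *)

Require Import Defs.
From mathcomp Require Import all_boot all_order all_algebra perm.
From mathcomp Require Import zify ring lra.
From mathcomp Require Import all_classical all_reals all_analysis.
(* Takes precedence over the [edist] of MathComp-Analysis. *)
Import Defs.

Set Implicit Arguments.
Unset Strict Implicit.
Unset Printing Implicit Defensive.

Import Order.TTheory GRing.Theory Num.Theory.
Import numFieldNormedType.Exports.

Local Open Scope classical_set_scope.
Local Open Scope ring_scope.

(** * Liouville's inequality and Siegel's lemma *)

(** The obstacle is arithmetic: if two orders could share a zero, one eigenvalue would carry sums of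
    modes, whose nodal sets escape the count of radii and circles. All the arithmetic takes place in
    the variable z = r^2/4, in which J_m becomes, up to a power of r, an entire function whose
    recurrences have integer polynomial coefficients and, for J_0, whose coefficients are integers
    over [k!^2]. The forms are homogeneous in J_0 and its Euler derivative, so only the ratio of the
    two values at the algebraic point has to be algebraic. The nonvanishing of a derivative of the
    form is obtained by interpolation in the index of the coefficients: if [T] is the order of
    vanishing and [D^k] bounds the numerators, about T log D / log T derivatives are enough, so few
    that factors of size [T^S] stay below [D^T]. The degree of the forms is tuned to the exponent in
    Liouville's inequality so that one factor [T!] survives against all geometric factors. *)

Lemma det_norm_le (n : nat) (A : 'M[int]_n) (M : int) :
  (forall i j, `|A i j| <= M) -> `|\det A| <= n`!%:R * M ^+ n.
Proof.
move=> AM; apply: (le_trans (ler_norm_sum _ _ _)).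
apply: (@le_trans _ _ (\sum_(s : 'S_n) M ^+ n)).
  apply: ler_sum => s _; rewrite normrM normrX normrN1 expr1n mul1r normr_prod.
  rewrite -[leRHS]mul1r -[X in _ ^+ X](card_ord n) -prodr_const.
  by rewrite mul1r; apply: ler_prod => i _; rewrite normr_ge0 AM.
by rewrite sumr_const card_Sn mulr_natl.
Qed.

Lemma mulmx_entry_le (n : nat) (A B : 'M[int]_n) (a b : int) :
  (forall i j, `|A i j| <= a) -> (forall i j, `|B i j| <= b) ->
  forall i j, `|(A *m B) i j| <= n%:R * a * b.
Proof.
move=> Aa Bb i j; rewrite mxE; apply: (le_trans (ler_norm_sum _ _ _)).
apply: (@le_trans _ _ (\sum_(k < n) a * b)).
  by apply: ler_sum => k _; rewrite normrM ler_pM.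
by rewrite sumr_const card_ord -mulrA mulr_natl.
Qed.

(** The sum norm is submultiplicative ([pnormM]), unlike the largest coefficient, so powers of
    polynomials cost only powers. *)
Definition pnorm (p : {poly int}) : int := \sum_(i < size p) `|p`_i|.

Lemma pnormE (p : {poly int}) (n : nat) : (size p <= n)%N ->
  pnorm p = \sum_(i < n) `|p`_i|.
Proof.
move=> pn; rewrite /pnorm (big_ord_widen n (fun i => `|p`_i|)) //.
rewrite big_mkcond /=; apply: eq_bigr => i _.
by case: ltnP => // ip; rewrite nth_default // normr0.
Qed.

Lemma pnorm_ge0 p : 0 <= pnorm p.
Proof. by apply: sumr_ge0 => i _. Qed.

Lemma pnormD p q : pnorm (p + q) <= pnorm p + pnorm q.
Proof.
set n := maxn (size p) (size q).
rewrite !(@pnormE _ n) ?size_polyD ?leq_maxl ?leq_maxr //.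
rewrite -big_split /=; apply: ler_sum => i _.
by rewrite coefD ler_normD.
Qed.

Lemma pnormZ a p : pnorm (a *: p) <= `|a| * pnorm p.
Proof.
rewrite (@pnormE (a *: p) (size p)) ?size_scale_leq // /pnorm mulr_sumr.
by apply: ler_sum => i _; rewrite coefZ normrM.
Qed.

Lemma pnorm_sum (I : Type) (r : seq I) (P : pred I) (F : I -> {poly int}) :
  pnorm (\sum_(i <- r | P i) F i) <= \sum_(i <- r | P i) pnorm (F i).
Proof.
apply: (big_ind2 (fun p (x : int) => pnorm p <= x)) => //.
  by rewrite /pnorm size_poly0 big_ord0.
by move=> p x q y px qy; rewrite (le_trans (pnormD _ _)) // lerD.
Qed.

Lemma pnormXn n : pnorm 'X^n = 1.
Proof.
rewrite /pnorm size_polyXn big_ord_recr /= coefXn eqxx normr1 big1 ?add0r //.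
by move=> i _; rewrite coefXn ltn_eqF // normr0.
Qed.

Lemma pnormMXn p n : pnorm (p * 'X^n) = pnorm p.
Proof.
have [->|p0] := eqVneq p 0; first by rewrite mul0r.
rewrite /pnorm size_mulXn // big_split_ord /= big1 ?add0r; last first.
  by move=> i _; rewrite coefMXn ltn_ord normr0.
by apply: eq_bigr => i _; rewrite coefMXn ltnNge leq_addr addKn.
Qed.

Lemma pnormM p q : pnorm (p * q) <= pnorm p * pnorm q.
Proof.
rewrite -[p in pnorm (p * q)]coefK poly_def mulr_suml (le_trans (pnorm_sum _ _ _)) //.
rewrite /pnorm mulr_suml; apply: ler_sum => i _.
rewrite -scalerAl; apply: (le_trans (pnormZ _ _)).
by rewrite [_ * q]mulrC pnormMXn.
Qed.

Lemma pnormX p n : pnorm (p ^+ n) <= pnorm p ^+ n.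
Proof.
elim: n => [|n IH]; first by rewrite !expr0 -(expr0 'X) pnormXn.
by rewrite !exprS (le_trans (pnormM _ _)) // ler_wpM2l ?pnorm_ge0.
Qed.

Section Liouville.
Variables (R : realType) (x : R).

Let ev (p : {poly int}) : R := (map_poly intr p).[x].

(** A stand-in for the minimal polynomial: minimality of the size already makes the powers of [x]
    below the degree of [p] independent over the integers, which is what [liouville] uses. *)
Lemma min_int_poly (B : {poly int}) : B != 0 -> ev B = 0 ->
  exists p : {poly int}, [/\ p != 0, ev p = 0 &
    forall q : {poly int}, (size q < size p)%N -> ev q = 0 -> q = 0].
Proof.
elim: {B}(size B).+1 {-2}B (ltnSn (size B)) => // n IH B Bn B0 evB.
have [[q [qB q0 evq]]|nq] :=
  pselect (exists q : {poly int}, [/\ (size q < size B)%N, q != 0 & ev q = 0]).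
  by apply: (IH q) => //; rewrite (leq_trans qB).
exists B; split => // q qB evq; apply/eqP; apply: contra_notT nq => q0.
by exists q.
Qed.

(** The norm of [Q(x)] is realised as the determinant of an integer matrix, so no conjugates of [x]
    appear. A nonzero integer is at least 1 in absolute value, and this one is [Q(x)] times a factor
    bounded through the adjugate. *)
Lemma liouville (B : {poly int}) : B != 0 -> ev B = 0 ->
  exists (d : nat) (C : R), 0 < C /\
    forall (Q : {poly int}) (s : nat) (L : int),
      (size Q <= s)%N -> pnorm Q <= L -> ev Q != 0 ->
      1 <= C ^+ s * L%:~R ^+ d * `|ev Q|.
Proof.
move=> B0 evB; have [p [p0 evp pmin]] := min_int_poly B0 evB.
have : (1 < size p)%N.
  rewrite -(size_map_inj_poly (f := intr : int -> R)) //; last exact: intr_inj.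
  apply: (@root_size_gt1 _ x); last by apply/eqP.
  by rewrite map_poly_eq0_id0 ?intr_eq0 ?lead_coef_eq0.
case E : (size p) => [|[|e]] // _.
set l := lead_coef p.
(* Multiplication by [l x] on 1, x, ..., x^e, where [e + 1] is the degree of [p]: a companion matrix
   scaled by the leading coefficient to stay integral, with [v] as eigenvector. *)
pose A : 'M[int]_e.+1 := \matrix_(i, j)
  if (i < e)%N then l *+ (j == i.+1 :> nat) else - p`_j.
pose v : 'cV[R]_e.+1 := \col_i x ^+ i.
have Av : map_mx intr A *m v = (l%:~R * x) *: v.
  apply/colP => i; rewrite !mxE.
  have [ie|ie] := ltnP i e.
    rewrite (bigD1 (Ordinal (ie : (i.+1 < e.+1)%N))) //= big1 ?addr0.
      by rewrite !mxE ie eqxx mulr1n /= exprS; ring.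
    move=> k ki; rewrite !mxE ie; case: eqP => [ki'|_]; last by rewrite mul0r.
    by case/eqP: ki; apply: val_inj.
  have {}ie : i = e :> nat by apply/eqP; rewrite eqn_leq ie -ltnS ltn_ord.
  have : ev p = 0 by [].
  rewrite /ev horner_coef size_map_inj_poly //; last exact: intr_inj.
  rewrite E big_ord_recr /= coef_map /= => /eqP; rewrite addrC addr_eq0 => /eqP H.
  rewrite ie -mulrA -exprS; have -> : l = p`_e.+1 by rewrite /l lead_coefE E.
  rewrite H -sumrN; apply: eq_bigr => k _.
  by rewrite !mxE ie ltnn coef_map /= rmorphN mulNr.
pose al : int := 1 + `|l| + \sum_(i < size p) `|p`_i|.
have al1 : 1 <= al by rewrite /al -addrA lerDl addr_ge0 // sumr_ge0.
have all_ : `|l| <= al.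
  by rewrite /al addrAC lerDr addr_ge0 // sumr_ge0.
have A_al i j : `|A i j| <= al.
  rewrite mxE; case: ifP => _.
    by case: eqP => _; rewrite ?mulr1n ?mulr0n ?normr0 // (le_trans _ al1).
  rewrite normrN; have [jp|jp] := ltnP j (size p).
    rewrite /al (bigD1 (Ordinal jp)) //= addrCA lerDl !addr_ge0 // sumr_ge0 //.
  by rewrite nth_default // normr0 (le_trans _ al1).
pose be : int := e.+1%:R * al.
have be1 : 1 <= be.
  by rewrite /be -[leLHS]mulr1 ler_pM // ?ler1n.
have be_al : al <= be.
  by rewrite /be -[leLHS]mul1r ler_pM // ?ler1n ?(le_trans _ al1).
have Ak k : forall i j, `|(A ^+ k) i j| <= be ^+ k.
  elim: k => [|k IH] i j.
    rewrite !expr0 mxE; by case: eqP.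
  by rewrite exprS [X in _ <= X]exprS; apply: mulmx_entry_le.
(* This is l^s Q(A / l); on [v] its eigenvalue is l^s Q(x). *)
pose NQ (Q : {poly int}) s : 'M[int]_e.+1 :=
  \sum_(k < s) (Q`_k * l ^+ (s - k)) *: A ^+ k.
have NQ_le (Q : {poly int}) s : (size Q <= s)%N ->
    forall i j, `|NQ Q s i j| <= pnorm Q * be ^+ s.
  move=> Qs i j; rewrite /NQ summxE (le_trans (ler_norm_sum _ _ _)) //.
  rewrite (pnormE Qs) mulr_suml; apply: ler_sum => k _.
  rewrite mxE !normrM -mulrA ler_wpM2l //.
  have -> : be ^+ s = be ^+ (s - k) * be ^+ k by rewrite -exprD subnK // ltnW.
  apply: ler_pM => //; rewrite normrX; apply: lerXn2r;
    by rewrite ?nnegrE ?(le_trans all_) // (le_trans _ be1).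
have NQv (Q : {poly int}) s : (size Q <= s)%N ->
    map_mx intr (NQ Q s) *m v = (l%:~R ^+ s * ev Q) *: v.
  move=> Qs; rewrite /NQ raddf_sum mulmx_suml /=.
  have Akv k : map_mx intr (A ^+ k) *m v = (l%:~R * x) ^+ k *: v.
    elim: k => [|k IH]; first by rewrite !expr0 map_mx1 mul1mx scale1r.
    by rewrite exprS map_mxM -mulmxA IH -scalemxAr Av scalerA exprSr.
  under eq_bigr => k _ do rewrite map_mxZ -scalemxAl Akv scalerA.
  rewrite -scaler_suml; congr (_ *: _).
  rewrite /ev (@horner_coef_wide _ s); last by rewrite size_map_inj_poly //; exact: intr_inj.
  rewrite mulr_sumr; apply: eq_bigr => k _; rewrite coef_map /= rmorphM rmorphXn /=.
  have -> : l%:~R ^+ s = l%:~R ^+ (s - k) * l%:~R ^+ k :> R.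
    by rewrite -exprD subnK // ltnW.
  rewrite exprMn; ring.
have v0 : v ord0 ord0 = 1 by rewrite mxE expr0.
(* A singular matrix is killed by an integer row [w]; applied to [v], the polynomial with
   coefficients [w] vanishes at [x], against minimality. *)
have detN (Q : {poly int}) s : (size Q <= s)%N -> ev Q != 0 -> \det (NQ Q s) != 0.
  move=> Qs Q0; apply/negP => /det0P [w w0 wN].
  have : map_mx intr w *m (map_mx intr (NQ Q s) *m v) = 0.
    by rewrite mulmxA -map_mxM wN map_mx0 mul0mx.
  rewrite NQv // -scalemxAr => /eqP; rewrite scaler_eq0 mulf_eq0 expf_eq0.
  rewrite intr_eq0 lead_coef_eq0 (negbTE p0) andbF (negbTE Q0) /= => /eqP wv.
  pose q := \poly_(i < e.+1) w ord0 (inord i).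
  have : q = 0.
    apply: pmin; first by rewrite E ltnS size_poly.
    have /matrixP /(_ ord0 ord0) := wv; rewrite !mxE => wv0.
    rewrite /ev (@horner_coef_wide _ e.+1); last first.
      by rewrite size_map_inj_poly ?size_poly //; exact: intr_inj.
    rewrite -[RHS]wv0; apply: eq_bigr => i _.
    by rewrite coef_map /= coef_poly ltn_ord !mxE inord_val.
  move=> /polyP q0; case/eqP: w0; apply/matrixP => i j; rewrite (ord1 i) !mxE.
  by have := q0 j; rewrite coef_poly ltn_ord coef0 inord_val.
pose K : R := e`!%:R * \sum_(j < e.+1) `|x| ^+ j.
have K1 : 1 <= K.
  rewrite /K big_ord_recl expr0 -[leLHS]mulr1 ler_pM ?ler1n ?fact_gt0 //.
  by rewrite lerDl sumr_ge0 // => i _; rewrite exprn_ge0.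
pose C : R := al%:~R * be%:~R ^+ e * K.
have al1R : 1 <= al%:~R :> R by rewrite ler1z.
have be1R : 1 <= be%:~R :> R by rewrite ler1z.
have C1 : 1 <= C.
  rewrite /C -[leLHS]mulr1 ler_pM // -[leLHS]mulr1 ler_pM // exprn_ege1 //.
exists e, C; split; first by rewrite (lt_le_trans _ C1).
move=> Q s L Qs QL Q0.
have s0 : (0 < s)%N.
  apply: leq_trans Qs; rewrite lt0n size_poly_eq0; apply: contra Q0 => /eqP ->.
  by rewrite /ev rmorph0 horner0.
have L0 : 0 <= L by rewrite (le_trans (pnorm_ge0 Q)).
have M0 : 0 <= L * be ^+ s by rewrite mulr_ge0 // exprn_ge0 // (le_trans _ be1).
have adj_le i j : `|(\adj (NQ Q s)) i j| <= e`!%:R * (L * be ^+ s) ^+ e.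
  rewrite mxE /cofactor normrM normrX normrN1 expr1n mul1r.
  apply: det_norm_le => i' j'; rewrite !mxE (le_trans (NQ_le _ _ Qs _ _)) //.
  by rewrite ler_wpM2r // exprn_ge0 // (le_trans _ be1).
(* Entry 0 of [adj N N v = det N v], where [v] has entry 1. *)
have : ((\det (NQ Q s))%:~R *: v) ord0 ord0 =
    (l%:~R ^+ s * ev Q) * \sum_j ((\adj (NQ Q s)) ord0 j)%:~R * x ^+ j.
  have -> : (\det (NQ Q s))%:~R *: v = map_mx intr (\adj (NQ Q s)) *m (map_mx intr (NQ Q s) *m v).
    by rewrite mulmxA -map_mxM mul_adj_mx map_scalar_mx mul_scalar_mx.
  rewrite NQv // -scalemxAr !mxE; congr (_ * _).
  by apply: eq_bigr => j _; rewrite !mxE.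
rewrite mxE v0 mulr1 => detE.
have : 1 <= `|(\det (NQ Q s))%:~R : R|.
  by rewrite -intr_norm ler1z -gtz0_ge1 normr_gt0 detN.
rewrite detE !normrM => H; apply: (le_trans H).
have S_le : `|\sum_j ((\adj (NQ Q s)) ord0 j)%:~R * x ^+ j| <=
    (L%:~R * be%:~R ^+ s) ^+ e * K.
  apply: (le_trans (ler_norm_sum _ _ _)).
  rewrite /K mulrA mulr_sumr; apply: ler_sum => j _.
  rewrite normrM normrX ler_wpM2r ?exprn_ge0 // -intr_norm.
  move: (adj_le ord0 j); rewrite -(ler_int R) => /le_trans -> //.
  by rewrite rmorphM rmorph_nat rmorphXn rmorphM rmorphXn mulrC.
have L0R : 0 <= L%:~R :> R by rewrite ler0z.
apply: (@le_trans _ _ (al%:~R ^+ s * `|ev Q| * ((L%:~R * be%:~R ^+ s) ^+ e * K))).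
  apply: ler_pM => //; rewrite ?mulr_ge0 ?exprn_ge0 //.
  rewrite ler_wpM2r // normrX; apply: lerXn2r; rewrite ?nnegrE //.
    by rewrite (le_trans _ al1R).
  by rewrite -intr_norm ler_int.
rewrite /C 2!(exprMn s) (exprMn e) -!exprM [(e * s)%N]mulnC.
have -> : al%:~R ^+ s * `|ev Q| * (L%:~R ^+ e * be%:~R ^+ (s * e) * K) =
  (al%:~R ^+ s * be%:~R ^+ (s * e) * L%:~R ^+ e * `|ev Q|) * K by ring.
have -> : al%:~R ^+ s * be%:~R ^+ (s * e) * K ^+ s * L%:~R ^+ e * `|ev Q| =
  (al%:~R ^+ s * be%:~R ^+ (s * e) * L%:~R ^+ e * `|ev Q|) * K ^+ s by ring.
rewrite ler_wpM2l ?ler_eXnr //; do 3?[apply: mulr_ge0 => //]; rewrite ?exprn_ge0 //;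
  by rewrite (le_trans _ al1R) || rewrite (le_trans _ be1R).
Qed.
End Liouville.

(** Pigeonhole with exponent 2: [(B+1)^(2M)] vectors with entries in [0, B] against [(B^2+1)^M]
    possible values, since [B = #|I| A] confines each shifted value to [0, B^2]. *)
Lemma siegel_lemma (I : finType) (M : nat) (a : 'I_M -> I -> int) (A : nat) :
  (0 < M)%N -> (#|I| = 2 * M)%N -> (0 < A)%N -> (forall k i, `|a k i| <= A%:Z) ->
  exists q : I -> int, [/\ exists i, q i != 0,
    forall k, \sum_i a k i * q i = 0 & forall i, `|q i| <= (#|I| * A)%:Z].
Proof.
move=> M0 cI A0 aA; pose B := (#|I| * A)%N.
(* Minus the least value of the form on the box, so that shifted values are natural numbers. *)
pose sh k : int := - \sum_i Num.min 0 (a k i) * B%:Z.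
pose V (f : {ffun I -> 'I_B.+1}) k : int := \sum_i a k i * (f i)%:Z + sh k.
have V_ge0 f k : 0 <= V f k.
  rewrite /V /sh -sumrB; apply: sumr_ge0 => i _.
  have : ((f i)%:Z <= B%:Z) by rewrite lez_nat -ltnS ltn_ord.
  rewrite /Num.min; case: ifP => ak; last by nia.
  by move=> _; rewrite mul0r subr0 mulr_ge0 // ltW.
have V_le f k : V f k <= (B * B)%:Z.
  rewrite /V /sh -sumrB; apply: (@le_trans _ _ (\sum_(i : I) A%:Z * B%:Z)).
    apply: ler_sum => i _.
    have : ((f i)%:Z <= B%:Z) by rewrite lez_nat -ltnS ltn_ord.
    move: (aA k i); rewrite /Num.min; case: ifP => ak; nia.
  by rewrite sumr_const -mulr_natl natz -!PoszM lez_nat mulnA.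
pose W (f : {ffun I -> 'I_B.+1}) : {ffun 'I_M -> 'I_(B * B).+1} :=
  [ffun k => inord `|V f k|%N].
have : ~ injective W.
  move/leq_card; rewrite !card_ffun !card_ord cI expnM leq_exp2r // leqNgt.
  by rewrite expnS expn1; case/negP; nia.
move=> ninj.
have [f [g [fg Wfg]]] : exists f g, f != g /\ W f = W g.
  apply: contra_notP ninj => H f g Wfg; apply/eqP; apply: contra_notT H => fg.
  by exists f, g.
have Vfg k : V f k = V g k.
  have /ffunP/(_ k) := Wfg; rewrite !ffunE => /(congr1 val).
  have Vo h : (`|V h k| < (B * B).+1)%N.
    by rewrite ltnS; have := V_le h k; have := V_ge0 h k; lia.
  rewrite /= !inordK ?Vo //; have := V_ge0 f k; have := V_ge0 g k; lia.
exists (fun i => (f i)%:Z - (g i)%:Z); split.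
- apply: contrapT => H; case/eqP: fg; apply/ffunP => i; apply/val_inj/eqP.
  rewrite -eqz_nat -subr_eq0; apply/negPn/negP => ?; apply: H; by exists i.
- move=> k; have := Vfg k; rewrite /V => /addIr /eqP; rewrite -subr_eq0 -sumrB => /eqP {2}<-.
  by apply: eq_bigr => i _; rewrite mulrBr.
- by move=> i; have := ltn_ord (f i); have := ltn_ord (g i); rewrite -/B; lia.
Qed.

(** * Entire series *)

Section CauchyProduct.
Variable R : realType.
Implicit Types u v : nat -> R.

Definition conv u v (n : nat) : R := \sum_(i < n.+1) u i * v (n - i)%N.

Lemma series_conv u v n :
  series (conv u v) n = \sum_(0 <= i < n) u i * series v (n - i)%N.
Proof.
elim: n => [|n IH]; first by rewrite /series /= !big_nil.
rewrite seriesSr IH /conv big_nat_recr //= subSnn.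
have -> : series v 1%N = v 0%N by rewrite /series /= big_nat1.
rewrite big_ord_recr /= subnn addrA; congr (_ + _).
rewrite big_mkord -big_split /= [RHS]big_mkord; apply: eq_bigr => i _.
by rewrite subSn ?(ltnW (ltn_ord i)) // seriesSr mulrDr.
Qed.

(** Mertens' theorem. By [series_conv] the error is the convolution of [u] with the remainders of
    [v]: these are small for the early terms of [u], and the late terms are controlled by the tail
    of the absolute series. *)
Lemma cvg_cauchy_product u v :
  cvgn [normed series u] -> cvgn (series v) ->
  series (conv u v) @ \oo --> limn (series u) * limn (series v).
Proof.
move=> cu cv; set V := limn (series v); set U := limn (series u).
have cuU : series u @ \oo --> U by exact: normed_cvg.
pose r n := series v n - V.
have r0 : r @ \oo --> (0 : R) by apply/subr_cvg0.
have [K [K0 rK]] : exists K, 0 < K /\ forall n, `|r n| <= K.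
  have [M [Mr Mb]] : bounded_fun r by apply: cvg_seq_bounded; apply/cvg_ex; exists 0.
  exists (`|M| + 1); split; first by rewrite ltr_wpDl.
  by move=> n; apply: Mb => //; rewrite (le_lt_trans (ler_norm _)) // ltrDl.
set A := limn [normed series u].
have uA n : [normed series u] n <= A.
  by apply: nondecreasing_cvgn_le => //; apply: nondecreasing_series => *; exact: normr_ge0.
have A0 : 0 <= A by have := uA 0%N; rewrite /= /series /= big_geq.
suff : (fun n => series (conv u v) n - V * series u n) @ \oo --> (0 : R).
  move=> /(fun h => cvgD h (cvgM (cvg_cst V) cuU)); rewrite add0r mulrC.
  apply: cvg_trans; apply: near_eq_cvg; apply: nearW => n.
  by rewrite /= fctE /= subrK.
have E n : series (conv u v) n - V * series u n = \sum_(0 <= i < n) u i * r (n - i)%N.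
  rewrite series_conv {2}/series /= mulr_sumr -sumrB; apply: eq_bigr => i _.
  by rewrite /r; ring.
rewrite (_ : (fun _ => _) = fun n => \sum_(0 <= i < n) u i * r (n - i)%N); last exact/funext.
apply/cvgr0Pnorm_le => e e0.
pose d := e / (A + K + 1).
have AK : 0 < A + K + 1 by rewrite ltr_wpDl // addr_ge0 // ltW.
have d0 : 0 < d by rewrite divr_gt0.
have [N _ rN] : \forall n \near \oo, `|r n| <= d by move/cvgr0Pnorm_le : r0; apply.
have [M _ uM] : \forall n \near \oo, `|A - [normed series u] n| <= d.
  by move/cvgrPdist_le : cu; apply.
exists (N + M)%N => // n /= NMn.
have Mn : (M <= n)%N by lia.
rewrite (big_cat_nat (leq0n M) Mn) //=; apply: (le_trans (ler_normD _ _)).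
have -> : e = A * d + K * d + d by rewrite /d; field; exact: lt0r_neq0.
apply: (@le_trans _ _ (A * d + d * K)); last by rewrite [d * K]mulrC lerDl ltW.
apply: lerD.
  apply: (le_trans (ler_norm_sum _ _ _)).
  apply: (@le_trans _ _ (\sum_(0 <= i < M) `|u i| * d)).
    rewrite big_nat [leRHS]big_nat; apply: ler_sum => i /andP[_ iM].
    by rewrite normrM ler_wpM2l // rN //=; lia.
  by rewrite -mulr_suml ler_wpM2r ?(ltW d0) // uA.
apply: (le_trans (ler_norm_sum _ _ _)).
apply: (@le_trans _ _ (\sum_(M <= i < n) `|u i| * K)).
  by apply: ler_sum => i _; rewrite normrM ler_wpM2l.
rewrite -mulr_suml ler_wpM2r ?(ltW K0) //.
apply: le_trans (uM M _) => //=; rewrite (le_trans _ (ler_norm _)) //.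
rewrite lerBrDl; apply: le_trans (uA n).
by rewrite /= /series /= (big_cat_nat (leq0n M) Mn).
Qed.

End CauchyProduct.

Section EntireSeries.
Variable R : realType.
Implicit Types u v e : nat -> R.

Definition ev e (x : R) := limn (series (fun k => e k * x ^+ k)).
Definition entire e := forall x, cvgn [normed series (fun k => e k * x ^+ k)].

Lemma entire_cvg e x : entire e -> cvgn (series (fun k => e k * x ^+ k)).
Proof. by move=> h; apply: normed_cvg. Qed.

Lemma entire_le e g : (forall k, `|e k| <= g k) -> entire g -> entire e.
Proof.
move=> eg eG x; apply: (@series_le_cvg _ _ (fun k => `|g k * x ^+ k|)) => //=.
  by move=> k; rewrite !normrM ler_wpM2r // (le_trans (eg k)) // ler_norm.
exact: (eG x).
Qed.

Lemma entire_exp (A : R) : entire (fun k => A ^+ k / k`!%:R).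
Proof.
move=> x; rewrite (_ : [normed series _] = series (exp_coeff `|A * x|)).
  exact: is_cvg_series_exp_coeff.
apply/funext => n; rewrite /= /series /=; apply: eq_bigr => k _.
rewrite /exp_coeff /= !normrM normfV !normrX [`|_%:R|]ger0_norm // exprMn; ring.
Qed.

Lemma entireZ (a : R) e : entire e -> entire (fun k => a * e k).
Proof.
move=> he x.
rewrite (_ : [normed series _] = series (`|a| *: (fun k => `|e k * x ^+ k|))).
  exact: is_cvg_seriesZ (he x).
by apply/funext => n; rewrite /= /series /=; apply: eq_bigr => k _; rewrite -mulrA normrM.
Qed.

Lemma entireD e g : entire e -> entire g -> entire (fun k => e k + g k).
Proof.
move=> he hg x; apply: (@series_le_cvg _ _
  ((fun k => `|e k * x ^+ k|) + (fun k => `|g k * x ^+ k|))) => //=.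
- by move=> k; rewrite addr_ge0.
- by move=> k; rewrite mulrDl ler_normD.
- exact: is_cvg_seriesD (he x) (hg x).
Qed.

Lemma entire0 : entire (fun=> 0).
Proof.
move=> x; rewrite (_ : [normed series _] = fun=> 0); first exact: is_cvg_cst.
by apply/funext => n; rewrite /= /series /= big1 // => k _; rewrite mul0r normr0.
Qed.

Lemma entire_sum (I : Type) (r : seq I) (F : I -> nat -> R) :
  (forall i, entire (F i)) -> entire (fun k => \sum_(i <- r) F i k).
Proof.
move=> h; elim: r => [|i r IH].
  by under eq_fun do rewrite big_nil; exact: entire0.
by under eq_fun do rewrite big_cons; exact: entireD.
Qed.

(** [theta] is the Euler operator x d/dx and [sshift] is multiplication by x. The Euler operator
    fixes the index, so its iterates multiply the coefficients by [k^i]. *)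
Definition theta e (k : nat) := k%:R * e k.
Definition sshift e (k : nat) := if k is k'.+1 then e k' else 0.

Lemma entire_theta e : entire e -> entire (theta e).
Proof.
move=> he x; apply: (@series_le_cvg _ _ (fun k => `|e k * (2 * x) ^+ k|)) => //=.
  move=> k; rewrite /theta exprMn -mulrA [in leRHS]mulrCA [leLHS]normrM [leRHS]normrM.
  rewrite ler_wpM2r // !ger0_norm ?exprn_ge0 //.
  by rewrite -natrX ler_nat ltnW // ltn_expl.
exact: (he (2 * x)).
Qed.

Lemma evD e g x : entire e -> entire g ->
  ev (fun k => e k + g k) x = ev e x + ev g x.
Proof.
move=> he hg; rewrite /ev -lim_seriesD; try exact: entire_cvg.
by congr (limn (series _)); apply/funext => k; rewrite /= mulrDl.
Qed.

Lemma evZ a e x : entire e -> ev (fun k => a * e k) x = a * ev e x.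
Proof.
move=> he; rewrite /ev -[RHS]/(a *: _) -lim_seriesZ; last exact: entire_cvg.
by congr (limn (series _)); apply/funext => k; rewrite /= -mulrA.
Qed.

Lemma ev0 x : ev (fun=> 0) x = 0.
Proof.
rewrite /ev (_ : series _ = fun=> 0); first exact: lim_cst.
by apply/funext => n; rewrite /series /= big1 // => k _; rewrite mul0r.
Qed.

Lemma ev_sum (I : Type) (r : seq I) (F : I -> nat -> R) x :
  (forall i, entire (F i)) -> ev (fun k => \sum_(i <- r) F i k) x = \sum_(i <- r) ev (F i) x.
Proof.
move=> h; elim: r => [|i r IH].
  by under eq_fun do rewrite big_nil; rewrite big_nil ev0.
under eq_fun do rewrite big_cons; rewrite big_cons evD // ?IH //.
exact: entire_sum.
Qed.

Lemma series_shift e x n :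
  series (fun k => sshift e k * x ^+ k) n.+1 = x * series (fun k => e k * x ^+ k) n.
Proof.
rewrite /series /= big_nat_recl //= mul0r add0r mulr_sumr.
by apply: eq_bigr => k _; rewrite exprS; ring.
Qed.

Lemma normed_series_shift e x n :
  [normed series (fun k => sshift e k * x ^+ k)] n.+1 =
  `|x| * [normed series (fun k => e k * x ^+ k)] n.
Proof.
rewrite /= /series /= big_nat_recl //= mul0r normr0 add0r mulr_sumr.
by apply: eq_bigr => k _; rewrite exprS -normrM; congr (`|_|); ring.
Qed.

Lemma entire_shift e : entire e -> entire (sshift e).
Proof.
move=> he x; apply/cvg_ex; exists (`|x| * limn [normed series (fun k => e k * x ^+ k)]).
rewrite -cvg_shiftS; under eq_fun do rewrite normed_series_shift.
by apply: cvgM; [exact: cvg_cst|exact: he].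
Qed.

Lemma ev_shift e x : entire e -> ev (sshift e) x = x * ev e x.
Proof.
move=> he; apply/cvg_lim => //; rewrite -cvg_shiftS.
under eq_fun do rewrite series_shift.
by apply: cvgM; [exact: cvg_cst|exact: entire_cvg].
Qed.

Lemma ev_conv e g x : entire e -> entire g -> ev (conv e g) x = ev e x * ev g x.
Proof.
move=> he hg; apply/cvg_lim => //.
rewrite (_ : (fun k => conv e g k * x ^+ k) = conv (fun k => e k * x ^+ k) (fun k => g k * x ^+ k)).
  by apply: cvg_cauchy_product; [exact: he|exact: entire_cvg].
apply/funext => k; rewrite /conv mulr_suml; apply: eq_bigr => i _.
have -> : x ^+ k = x ^+ i * x ^+ (k - i) by rewrite -exprD subnKC // -ltnS.
by ring.
Qed.

Lemma convC : commutative (@conv R).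
Proof.
move=> u v; apply/funext => n; rewrite /conv (reindex_inj rev_ord_inj) /=.
apply: eq_bigr => i _ /=; rewrite subSS subKn; last by rewrite -ltnS.
exact: mulrC.
Qed.

Let tr n u := \poly_(i < n.+1) u i.

(** Up to a given index, convolution is the product of truncated polynomials; associativity is
    inherited from there. *)
Lemma conv_coef n m u v : (n <= m)%N -> conv u v n = (tr m u * tr m v)`_n.
Proof.
move=> nm; rewrite coefM; apply: eq_bigr => i _.
by rewrite !coef_poly !ifT // ltnS ?(leq_trans (leq_subr _ _)) // (leq_trans _ nm) // -ltnS.
Qed.

Lemma convA : associative (@conv R).
Proof.
move=> u v w; apply/funext => n.
transitivity ((tr n u * (tr n v * tr n w))`_n).
  rewrite coefM; apply: eq_bigr => i _.
  rewrite coef_poly ltn_ord (@conv_coef _ n) ?leq_subr //.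
rewrite mulrA coefM; apply: eq_bigr => i _.
rewrite [X in _ = _ * X]/= coef_poly ltnS leq_subr (@conv_coef _ n) // -ltnS //.
Qed.

Lemma convCA : left_commutative (@conv R).
Proof. by move=> u v w; rewrite !convA [conv u v]convC. Qed.

Lemma convDr u v w : conv u (fun k => v k + w k) = (fun k => conv u v k + conv u w k).
Proof.
by apply/funext => n; rewrite /conv -big_split /=; apply: eq_bigr => i _; rewrite mulrDr.
Qed.

Lemma convZr u a v : conv u (fun k => a * v k) = (fun k => a * conv u v k).
Proof.
by apply/funext => n; rewrite /conv mulr_sumr; apply: eq_bigr => i _; rewrite mulrCA.
Qed.

Lemma conv_shiftr u v : conv u (sshift v) = sshift (conv u v).
Proof.
apply/funext => -[|n]; rewrite /conv /=; first by rewrite big_ord1 /= mulr0.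
rewrite big_ord_recr /= subnn /= mulr0 addr0; apply: eq_bigr => i _.
by rewrite subSn // -ltnS.
Qed.

Lemma theta_conv u v : theta (conv u v) = (fun k => conv (theta u) v k + conv u (theta v) k).
Proof.
apply/funext => n; rewrite /theta /conv mulr_sumr -big_split /=; apply: eq_bigr => i _.
by rewrite natrB ?(ltnSE (ltn_ord i)) //; ring.
Qed.

Lemma theta_shift u : theta (sshift u) = sshift (fun k => u k + theta u k).
Proof.
by apply/funext => -[|n]; rewrite /theta /= ?mul0r // -natr1; ring.
Qed.

(** The arithmetic class of J_0 in the variable r^2/4. The bound is written as the square of [A^k]
    so that the constants add under products. *)
Definition factint (A : nat) e := forall k, exists c : int,
  e k = c%:~R / k`!%:R ^+ 2 /\ `|c| <= ((A ^ k) ^ 2)%:Z.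

Lemma sumn_sqr_le n (F : 'I_n -> nat) : (\sum_i F i ^ 2 <= (\sum_i F i) ^ 2)%N.
Proof.
elim: n F => [|n IH] F; first by rewrite !big_ord0.
rewrite !big_ord_recr /= sqrnD (leq_trans _ (leq_addr _ _)) // leq_add2r.
exact: (IH (fun i => F (widen_ord (leqnSn n) i))).
Qed.

(** [k!^2 / (i!^2 (k-i)!^2)] is a squared binomial coefficient, and the squares of the terms in the
    expansion of [(A+B)^k] sum to at most the square of their sum. *)
Lemma factint_conv A B e g : factint A e -> factint B g -> factint (A + B) (conv e g).
Proof.
move=> /choice [c hc] /choice [d hd] k.
exists (\sum_(i < k.+1) ('C(k, i) ^ 2)%:Z * c i * d (k - i)%N); split.
  rewrite rmorph_sum /= mulr_suml; apply: eq_bigr => i _.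
  rewrite (hc i).1 (hd (k - i)%N).1 !rmorphM /=.
  have ik : (i <= k)%N by rewrite -ltnS.
  have := bin_fact ik => /(congr1 (fun n => n%:R : R)); rewrite !natrM => E.
  rewrite -E -pmulrn.
  have [n1 n2] : (i`!%:R != 0 :> R) /\ ((k - i)`!%:R != 0 :> R).
    by split; rewrite pnatr_eq0 -lt0n fact_gt0.
  have n3 : 'C(k, i)%:R != 0 :> R by rewrite pnatr_eq0 -lt0n bin_gt0.
  by field; rewrite n1 n2 n3.
apply: (le_trans (ler_norm_sum _ _ _)).
apply: (@le_trans _ _ (\sum_(i < k.+1) (('C(k, i) * A ^ i * B ^ (k - i)) ^ 2)%:Z)).
  apply: ler_sum => i _; rewrite !normrM.
  rewrite !expnMn !PoszM; apply: ler_pM => //; rewrite ?mulr_ge0 //.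
    by apply: ler_pM; [| |rewrite ger0_norm ?mulr_ge0|have := (hc i).2; rewrite -mulnn PoszM].
  by have := (hd (k - i)%N).2; rewrite -mulnn PoszM.
rewrite -(big_morph Posz PoszD (erefl _)) lez_nat (leq_trans (sumn_sqr_le _)) //.
rewrite addnC expnDn leq_exp2r //; apply: leq_sum => i _.
by rewrite [(B ^ _ * _)%N]mulnC mulnA.
Qed.

Lemma factint_entire A e : factint A e -> entire e.
Proof.
move=> h; apply: (entire_le (g := fun k => ((A ^ 2)%N%:R) ^+ k / k`!%:R)); last exact: entire_exp.
move=> k; have [c [-> cA]] := h k.
have f0 : 1 <= k`!%:R :> R by rewrite ler1n fact_gt0.
rewrite normrM normfV [`|k`!%:R ^+ 2|]ger0_norm ?exprn_ge0 // -intr_norm.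
apply: ler_pM; rewrite ?invr_ge0 ?exprn_ge0 ?ler0z //.
  rewrite -natrX -expnM mulnC expnM; apply: (@le_trans _ _ (((A ^ k) ^ 2)%N%:Z%:~R)); first by rewrite ler_int.
  by [].
by rewrite lef_pV2 ?posrE ?exprn_gt0 ?(lt_le_trans _ f0) // ler_eXnr.
Qed.

End EntireSeries.

(** * Nonvanishing of a low Euler derivative at a point *)

Lemma bin_le_exp2 n k : ('C(n, k) <= 2 ^ n)%N.
Proof.
elim: n k => [|n IH] [|k] //; first by rewrite bin0 expn_gt0.
by rewrite binS expnS mul2n -addnn leq_add.
Qed.

Section ZeroEstimate.
Variable R : realType.

Lemma series_norm_le (u : nat -> R) N M : 0 <= M ->
  (forall k, (k < N)%N -> u k = 0) ->
  (forall j, `|u (N + j)%N| <= M * 2^-1 ^+ j) ->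
  `|limn (series u)| <= 2 * M.
Proof.
move=> M0 u0 uM.
pose v k := if (k < N)%N then 0 else M * 2^-1 ^+ (k - N).
have uv k : `|u k| <= v k.
  rewrite /v; case: ltnP => kN; first by rewrite u0 // normr0.
  by rewrite -{1}(subnKC kN).
have sv n : series v n <= 2 * M.
  apply: (@le_trans _ _ (2 * M - (if (n < N)%N then 2 * M else 2 * M * 2^-1 ^+ (n - N)))); last first.
    by rewrite lerBlDr lerDl; case: ifP => _; rewrite !mulr_ge0 // exprn_ge0 // invr_ge0.
  elim: n => [|n IH].
    rewrite /series /= big_geq //; case: ltnP; rewrite ?subrr //.
    by rewrite leqn0 => /eqP ->; rewrite subnn expr0 mulr1 subrr.
  rewrite seriesSr; apply: (le_trans (lerD IH (lexx _))); rewrite /v.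
  case: (ltngtP n.+1 N) => nN.
  - by rewrite addr0.
  - rewrite subSn //.
    by rewrite exprS le_eqVlt; apply/orP; left; apply/eqP; field.
  - rewrite -nN ?subnn ?expr0; lra.
have cu : cvgn [normed series u].
  apply: nondecreasing_is_cvgn.
    by apply: nondecreasing_series => *; exact: normr_ge0.
  exists (2 * M) => _ [n _ <-]; apply: le_trans (sv n).
  by rewrite /= /series /=; apply: ler_sum => i _.
apply: (le_trans (lim_series_norm cu)).
apply: limr_le => //; apply: nearW => n; apply: le_trans (sv n).
by rewrite /= /series /=; apply: ler_sum => i _.
Qed.

Variables (x : R) (phi : nat -> int) (T D : nat).
Hypotheses (x0 : 0 < x) (phi_lt : forall k, (k < T)%N -> phi k = 0)
  (phiT : phi T != 0) (phiD : forall k, (T <= k)%N -> `|phi k| <= (D ^ k)%:Z).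
Hypotheses (T2 : (2 <= T)%N) (DT : (D <= T)%N) (DxT : 4 * D%:R * x <= T%:R).
Let e k : R := (phi k)%:~R / k`!%:R ^+ 2.
(** The largest [S] with [T^S <= D^T]. Then [D^T < T^(S+1)], so killing [S] coefficients beats the
    numerators, while factors of size [T^S] remain geometric in [T]. *)
Let S := trunc_log T (D ^ T).

Lemma D_gt0 : (0 < D)%N.
Proof.
have := phiD (leqnn T); case: (posnP D) => // ->.
rewrite exp0n ?(leq_trans _ T2) // normr_le0 => /eqP H.
by move: phiT; rewrite H eqxx.
Qed.

Lemma T_gt0 : 0 < T%:R :> R. Proof. by rewrite ltr0n (leq_trans _ T2). Qed.

Lemma expTS : (T ^ S <= D ^ T)%N.
Proof. by rewrite /S trunc_logP // expn_gt0 D_gt0. Qed.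

Lemma leST : (S <= T)%N.
Proof.
rewrite -(leq_exp2l S T (m := T)) // (leq_trans expTS) //.
by rewrite leq_exp2r // (leq_trans _ T2).
Qed.

Lemma entire_e : entire e.
Proof.
apply: (entire_le (g := fun k => (D%:R) ^+ k / k`!%:R)); last exact: entire_exp.
move=> k; rewrite /e.
have f0 : 1 <= k`!%:R :> R by rewrite ler1n fact_gt0.
case: (ltnP k T) => kT.
  by rewrite phi_lt // mul0r normr0 divr_ge0 ?exprn_ge0 // (le_trans _ f0).
rewrite normrM normfV [`|k`!%:R ^+ 2|]ger0_norm ?exprn_ge0 // -intr_norm.
apply: ler_pM; rewrite ?invr_ge0 ?exprn_ge0 ?ler0z //.
  rewrite -natrX; apply: (@le_trans _ _ (((D ^ k)%N%:Z)%:~R)) => //.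
  by rewrite ler_int phiD.
by rewrite lef_pV2 ?posrE ?exprn_gt0 ?(lt_le_trans _ f0) // ler_eXnr.
Qed.

Lemma fact_ratio j : (T`! * T ^ j <= (T + j)`!)%N.
Proof.
elim: j => [|j IH]; first by rewrite expn0 muln1 addn0.
by rewrite addnS factS expnS mulnCA leq_mul // -addnS leq_addr.
Qed.

Let W : R := (D%:R * x) ^+ T / T`!%:R ^+ 2.

Lemma W_ge0 : 0 <= W.
Proof. by rewrite divr_ge0 ?exprn_ge0 ?mulr_ge0 // ltW. Qed.

Lemma e_le j : `|e (T + j)%N * x ^+ (T + j)| <= W * (D%:R * x / T%:R ^+ 2) ^+ j.
Proof.
have F0 k : 0 < k`!%:R :> R by rewrite ltr0n fact_gt0.
rewrite normrM [`|x ^+ _|]ger0_norm ?exprn_ge0 ?(ltW x0) // /e normrM normfV.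
rewrite [`|_`!%:R ^+ 2|]ger0_norm ?exprn_ge0 // -intr_norm mulrAC.
apply: (@le_trans _ _ (((D%:R * x) ^+ (T + j)) / (T + j)`!%:R ^+ 2)).
  rewrite ler_wpM2r ?invr_ge0 ?exprn_ge0 // exprMn ler_wpM2r ?exprn_ge0 ?(ltW x0) //.
  rewrite -natrX; apply: (@le_trans _ _ (((D ^ (T + j))%N%:Z)%:~R)) => //.
  by rewrite ler_int phiD ?leq_addr.
rewrite exprD /W expr_div_n mulrACA -invfM.
rewrite ler_wpM2l ?mulr_ge0 ?exprn_ge0 ?mulr_ge0 // ?(ltW x0) //.
rewrite lef_pV2 ?posrE ?mulr_gt0 ?exprn_gt0 ?T_gt0 //.
rewrite exprAC -exprMn; apply: lerXn2r; rewrite ?nnegrE ?mulr_ge0 ?exprn_ge0 //.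
by rewrite -natrX -natrM ler_nat fact_ratio.
Qed.

(** The factor 2 on the left absorbs the growth [2^j] of the interpolation polynomial and of [k^i];
    the factor [1/T] becomes the gain [T^(S+1)] of [zero_estimate]. *)
Lemma ratio_le : 2 * (D%:R * x / T%:R ^+ 2) <= 2^-1 / T%:R.
Proof.
have T0 := T_gt0.
have -> : 2^-1 / T%:R = (2^-1 * T%:R) / T%:R ^+ 2 :> R by field; exact: lt0r_neq0.
rewrite mulrA ler_wpM2r ?invr_ge0 ?exprn_ge0 //; move: DxT; lra.
Qed.

Lemma ratio_ge0 : 0 <= D%:R * x / T%:R ^+ 2.
Proof. by rewrite divr_ge0 ?mulr_ge0 ?exprn_ge0 // ltW. Qed.

(* The polynomial [\prod_(l <= S) (1 - (k - T) / l)] in [k] is [1] at [T] and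
   kills the next [S] coefficients, so that the vanishing of the first [S]
   derivatives would isolate the coefficient of index [T]. *)
Lemma zero_estimate : exists2 i, (i <= S)%N & ev (fun k => k%:R ^+ i * e k) x != 0.
Proof.
apply: contrapT => H.
have {}H i : (i <= S)%N -> ev (fun k => k%:R ^+ i * e k) x = 0.
  by move=> iS; apply/eqP; apply: contra_notT H => ?; exists i.
have ent i : entire (fun k => k%:R ^+ i * e k).
  elim: i => [|i IH]; first by under eq_fun do rewrite expr0 mul1r; exact: entire_e.
  have -> : (fun k => k%:R ^+ i.+1 * e k) = theta (fun k => k%:R ^+ i * e k).
    by apply/funext => k; rewrite /theta exprS mulrA.
  exact: entire_theta.
pose P : {poly R} := \prod_(l < S) (1 - l.+1%:R^-1 *: ('X - T%:R%:P)).
have sP : (size P <= S.+1)%N.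
  apply: (leq_trans (size_poly_prod_leq _ _)).
  have : (\sum_(i < S) size (1 - i.+1%:R^-1 *: ('X - T%:R%:P) : {poly R})%R <= \sum_(i < S) 2)%N.
    apply: leq_sum => i _; rewrite (leq_trans (size_polyD _ _)) // size_poly1 geq_max /= size_polyN.
    by rewrite (leq_trans (size_scale_leq _ _)) // size_XsubC.
  rewrite sum_nat_const card_ord => h.
  by move: h; set w := (\sum_(i < S) _)%N; lia.
have PT j : P.[(T + j)%N%:R] = \prod_(l < S) (1 - j%:R / l.+1%:R).
  rewrite /P horner_prod; apply: eq_bigr => l _.
  by rewrite !hornerE natrD [T%:R + _]addrC addrK mulrC.
have P0 : P.[T%:R] = 1.
  by have := PT 0%N; rewrite addn0 => ->; rewrite big1 // => l _; rewrite mul0r subr0.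
have Pj j : (0 < j <= S)%N -> P.[(T + j)%N%:R] = 0.
  case: j => // j /= jS; rewrite PT (bigD1 (Ordinal jS)) //=.
  by rewrite divff ?pnatr_eq0 // subrr mul0r.
(* Beyond the killed range the value is, up to sign, the binomial coefficient of [j - 1] over
   [S]. *)
have Pb j : (S < j)%N -> `|P.[(T + j)%N%:R]| <= 2 ^+ j.
  case: j => // j Sj; rewrite PT.
  have -> : \prod_(l < S) (1 - j.+1%:R / l.+1%:R) = (-1) ^+ S * 'C(j, S)%:R :> R.
    have -> : 'C(j, S)%:R = \prod_(l < S) ((j - l)%N%:R / l.+1%:R) :> R.
      rewrite prodf_div -!natr_prod; apply/(canRL (mulfK _)).
        by rewrite pnatr_eq0 -lt0n prodn_gt0.
      rewrite -natrM -ffact_prod -bin_ffact; congr (_ * _)%:R.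
      by rewrite fact_prod big_add1 big_mkord.
    rewrite -[in (-1) ^+ S](card_ord S) -prodr_const -big_split /=; apply: eq_bigr => l _.
    rewrite natrB; last by rewrite ltnW // (leq_trans (ltn_ord l)).
    have : l.+1%:R != 0 :> R by rewrite pnatr_eq0.
    by rewrite -!natr1 => ?; field.
  rewrite normrM normrX normrN1 expr1n mul1r normr_nat.
  by rewrite -natrX ler_nat (leq_trans (bin_le_exp2 _ _)) // leq_exp2l.
have evP : ev (fun k => P.[k%:R] * e k) x = 0.
  have -> : (fun k => P.[k%:R] * e k) =
      (fun k => \sum_(i < S.+1) P`_i * (k%:R ^+ i * e k)).
    apply/funext => k; rewrite (horner_coef_wide _ sP) mulr_suml.
    by apply: eq_bigr => i _; rewrite -mulrA.
  rewrite ev_sum; last by move=> i; exact: entireZ.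
  by rewrite big1 // => i _; rewrite evZ // H ?mulr0 // -ltnS.
have entP : entire (fun k => P.[k%:R] * e k).
  have -> : (fun k => P.[k%:R] * e k) =
      (fun k => \sum_(i < S.+1) P`_i * (k%:R ^+ i * e k)).
    apply/funext => k; rewrite (horner_coef_wide _ sP) mulr_suml.
    by apply: eq_bigr => i _; rewrite -mulrA.
  by apply: entire_sum => i; exact: entireZ.
(* The whole series sums to 0. Without its term of index [T] it becomes [u2], which starts at
   [T + S + 1] and must sum to the opposite of that term. *)
pose u k := P.[k%:R] * e k * x ^+ k.
pose u1 k := if (k == T)%N then e T * x ^+ T else 0.
pose u2 k := if (k == T)%N then 0 else u k.
have cu1 : series u1 @ \oo --> e T * x ^+ T.
  apply: cvg_near_cst; exists T.+1 => //= n Tn.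
  rewrite /series /= (bigD1_seq T) ?mem_index_iota ?iota_uniq //= /u1 eqxx big1 ?addr0 //.
  by move=> i /negbTE ->.
have cu : cvgn (series u) by apply: entire_cvg.
have lu2 : limn (series u2) = - (e T * x ^+ T).
  have -> : u2 = u - u1.
    apply/funext => k; rewrite /u2 /u1 !fctE; case: eqP => [->|_]; last by rewrite subr0.
    by rewrite /u P0 mul1r subrr.
  have := lim_seriesB cu (cvgP _ cu1); rewrite (cvg_lim _ cu1) // => ->.
  by have := evP; rewrite /ev -/u => ->; rewrite sub0r.
have : `|limn (series u2)| <= 2 * (W * (2^-1 / T%:R) ^+ S.+1).
  apply: (@series_norm_le _ (T + S.+1)).
  - by rewrite mulr_ge0 ?W_ge0 // exprn_ge0 // divr_ge0.
  - move=> k kT; rewrite /u2; case: eqP => // /eqP kneT; rewrite /u.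
    case: (ltnP k T) => kT'; first by rewrite /e phi_lt // mul0r mulr0 mul0r.
    have -> : k = (T + (k - T))%N by rewrite subnKC.
    by rewrite Pj ?mul0r //; lia.
  - move=> j; rewrite /u2; case: eqP => [|_]; first by lia.
    rewrite /u -addnA -mulrA normrM.
    apply: (@le_trans _ _ (2 ^+ (S.+1 + j) * (W * (D%:R * x / T%:R ^+ 2) ^+ (S.+1 + j)))).
      by apply: ler_pM => //; [apply: Pb; lia|exact: e_le].
    rewrite mulrCA -exprMn -[leRHS]mulrA ler_wpM2l ?W_ge0 // exprD.
    have r0 : 0 <= 2 * (D%:R * x / T%:R ^+ 2) by rewrite mulr_ge0 ?ratio_ge0.
    apply: ler_pM; [by rewrite exprn_ge0|by rewrite exprn_ge0| |].
      by apply: lerXn2r; rewrite ?nnegrE ?divr_ge0 // ratio_le.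
    apply: lerXn2r; rewrite ?nnegrE ?invr_ge0 //.
    apply: (le_trans ratio_le); rewrite ler_pdivrMr ?T_gt0 //.
    by rewrite ler_peMr ?invr_ge0 // ler1n (leq_trans _ T2).
rewrite lu2 normrN; apply/negP; rewrite -ltNge.
(* As [phi T] is a nonzero integer, the isolated term is at least [x^T / T!^2]; the bound on [u2] is
   smaller because [D^T < T^(S+1)]. *)
have F0 : 0 < T`!%:R ^+ 2 :> R by rewrite exprn_gt0 // ltr0n fact_gt0.
apply: (@lt_le_trans _ _ (x ^+ T / T`!%:R ^+ 2)); last first.
  rewrite normrM [`|x ^+ _|]ger0_norm ?exprn_ge0 ?(ltW x0) // /e normrM normfV.
  rewrite [`|T`!%:R ^+ 2|]ger0_norm ?(ltW F0) // -intr_norm mulrAC ler_wpM2r ?invr_ge0 ?(ltW F0) //.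
  rewrite ler_peMl ?exprn_ge0 ?(ltW x0) // ler1z -gtz0_ge1 normr_gt0 //.
set q := (_ / _) ^+ _.
have -> : 2 * (W * q) = x ^+ T * (D%:R ^+ T * (2 * q)) / T`!%:R ^+ 2.
  by rewrite /W exprMn; ring.
rewrite ltr_pM2r ?invr_gt0 // gtr_pMr ?exprn_gt0 // /q expr_div_n.
rewrite !mulrA ltr_pdivrMr ?exprn_gt0 ?T_gt0 // mul1r.
apply: (@le_lt_trans _ _ (D%:R ^+ T)).
  rewrite -mulrA ler_piMr ?exprn_ge0 // exprS mulrA divff // mul1r.
  by rewrite exprn_ile1 // ?invr_ge0 // invf_le1 // ler1n.
by rewrite -!natrX ltr_nat trunc_log_ltn.
Qed.

(** [k^i <= k^S <= S! C(k+S, S) <= D^T 2^(k+S)], using [S! <= T^S <= D^T]: the derivatives of order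
    at most [S] lose only a factor geometric in [T]. *)
Lemma ev_e_le i : (i <= S)%N ->
  `|ev (fun k => k%:R ^+ i * e k) x| <= 2 * ((4 * D%:R ^+ 2 * x) ^+ T / T`!%:R ^+ 2).
Proof.
move=> iS.
have -> : (4 * D%:R ^+ 2 * x) ^+ T / T`!%:R ^+ 2 = (4 * D%:R) ^+ T * W.
  by rewrite /W mulrA -exprMn; congr (_ ^+ T / _); ring.
apply: (@series_norm_le _ T).
- by rewrite mulr_ge0 ?W_ge0 // exprn_ge0 // mulr_ge0.
- by move=> k kT; rewrite /e phi_lt // !(mul0r, mulr0).
move=> j; rewrite -mulrA normrM.
have Hk : ((T + j) ^ i <= (4 * D) ^ T * 2 ^ j)%N.
  apply: (@leq_trans ((T + j) ^ S)).
    by rewrite leq_pexp2l // addn_gt0 (leq_trans _ T2).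
  have H1 : ((T + j) ^ S <= S`! * 2 ^ (T + j + S))%N.
    apply: (@leq_trans (S`! * 'C(T + j + S, S))); last by rewrite leq_mul2l bin_le_exp2 orbT.
    rewrite mulnC bin_ffact ffact_prod -[X in (_ ^ X <= _)%N]card_ord -prod_nat_const.
    by apply: leq_prod => l _; have := ltn_ord l; lia.
  apply: (leq_trans H1).
  have H2 : (S`! <= D ^ T)%N.
    apply: leq_trans expTS; rewrite fact_prod -[X in (_ <= _ ^ X)%N]card_ord -prod_nat_const.
    rewrite big_add1 big_mkord; apply: leq_prod => l _.
    exact: (leq_trans (ltn_ord l) leST).
  apply: (leq_trans (leq_mul H2 (leqnn _))).
  rewrite expnMn [(4 ^ T * _)%N]mulnC -mulnA leq_mul2l; apply/orP; right.
  rewrite (_ : 4 = 2 ^ 2)%N // -expnM -expnD leq_exp2l //.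
  by have := leST; lia.
apply: (@le_trans _ _ (((4 * D%:R) ^+ T * 2 ^+ j) * (W * (D%:R * x / T%:R ^+ 2) ^+ j))).
  apply: ler_pM => //; last exact: e_le.
  by rewrite normrX normr_nat -!natrX -natrM -natrX -natrM ler_nat.
have -> : (4 * D%:R) ^+ T * 2 ^+ j * (W * (D%:R * x / T%:R ^+ 2) ^+ j) =
    (4 * D%:R) ^+ T * W * (2 * (D%:R * x / T%:R ^+ 2)) ^+ j.
  by rewrite [(2 * _) ^+ j]exprMn; ring.
have r0 : 0 <= 2 * (D%:R * x / T%:R ^+ 2) by rewrite mulr_ge0 ?ratio_ge0.
have G0 : 0 <= (4 * D%:R) ^+ T * W by rewrite mulr_ge0 ?W_ge0 // exprn_ge0 // mulr_ge0.
rewrite ler_wpM2l //; apply: lerXn2r; rewrite ?nnegrE ?invr_ge0 //.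
apply: (le_trans ratio_le); rewrite ler_pdivrMr ?T_gt0 //.
by rewrite ler_peMr ?invr_ge0 // ler1n (leq_trans _ T2).
Qed.

End ZeroEstimate.

(** * Bessel functions and Bourget's hypothesis *)

Section Bessel.
Variable R : realType.

Definition bes_coef (m k : nat) : R := (-1) ^+ k / (k`! * (k + m)`!)%:R.
(* [J_m(x) = (x/2)^m * bes m (x^2/4)] *)
Definition bes m (x : R) : R := ev (bes_coef m) x.

Lemma entire_bes_coef m : entire (bes_coef m).
Proof.
apply: (entire_le (g := fun k => 1 ^+ k / k`!%:R)); last exact: entire_exp.
move=> k; rewrite /bes_coef normrM normrX normrN1 normfV normr_nat !expr1n !mul1r.
rewrite lef_pV2 ?posrE ?ltr0n ?muln_gt0 ?fact_gt0 // ler_nat.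
by rewrite leq_pmulr // fact_gt0.
Qed.

Arguments entire_bes_coef : clear implicits.

Lemma bes_coef_diffs m : pseries_diffs (bes_coef m) = (fun k => - bes_coef m.+1 k).
Proof.
apply/funext => k; rewrite /pseries_diffs /bes_coef addnS addSn exprS factS.
have : k.+1%:R != 0 :> R by rewrite pnatr_eq0.
have := fact_gt0 k; have := fact_gt0 (k + m).+1.
move: (k.+1) (k`!) ((k + m).+1`!) => a b c.
rewrite !lt0n -!(pnatr_eq0 R) => h h1 h2.
by rewrite !natrM; move: h h1 h2; move: (a%:R : R) (b%:R : R) (c%:R : R) => d e f h h1 h2;
  field; rewrite ?h ?h1 ?h2.
Qed.

Lemma is_derive_bes m (x : R) : is_derive x 1 (bes m) (- bes m.+1 x).
Proof.
have cv n y : cvgn (pseries (bes_coef n) y) by have := entire_cvg (x := y) (entire_bes_coef n).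
have cvN n y : cvgn (pseries (fun k => - bes_coef n k) y).
  rewrite (_ : pseries _ y = - pseries (bes_coef n) y); first by apply: is_cvgN; exact: cv.
  by rewrite -pseries_diffsN || apply/funext => k; rewrite /pseries /series /= !fctE -sumrN; apply: eq_bigr => i _; rewrite mulNr.
have -> : - bes m.+1 x = limn (pseries (pseries_diffs (bes_coef m)) x).
  rewrite bes_coef_diffs /bes /ev -limN; last exact: cv.
  congr (limn _); apply/funext => k; rewrite /pseries /series /= !fctE -sumrN.
  by apply: eq_bigr => i _; rewrite mulNr.
apply: (@pseries_snd_diffs _ _ (`|x| + 1)).
- exact: cv.
- by rewrite bes_coef_diffs.
- rewrite bes_coef_diffs (_ : pseries_diffs _ = bes_coef m.+2); first exact: cv.
  have -> : (fun k => - bes_coef m.+1 k) = - bes_coef m.+1 by [].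
  by rewrite pseries_diffsN bes_coef_diffs; apply/funext => k; rewrite !fctE opprK.
- by rewrite [X in _ < X]ger0_norm ?addr_ge0 // ltrDl.
Qed.

(** The recurrence J_m + J_(m+2) = (2(m+1)/r) J_(m+1) at x = r^2/4; this normalization leaves no
    division, so that the coefficients are integer polynomials in [x]. *)
Lemma bes_rec m x : bes m x + x * bes m.+2 x = m.+1%:R * bes m.+1 x.
Proof.
rewrite /bes -ev_shift; last exact: entire_bes_coef.
rewrite -evD; [|exact: entire_bes_coef|exact/entire_shift/entire_bes_coef].
rewrite -evZ; last exact: entire_bes_coef.
congr (ev _ x); apply/funext => -[|k] /=.
  rewrite /bes_coef !add0n factS fact0 !mul1n expr0 addr0.
  have : m`!%:R != 0 :> R by rewrite pnatr_eq0 -lt0n fact_gt0.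
  have : m.+1%:R != 0 :> R by rewrite pnatr_eq0.
  move: (m.+1) (m`!) => a b h h1.
  by rewrite natrM; field; rewrite ?h1 ?h.
rewrite /bes_coef exprS !addnS !addSn !factS.
have h1 : k`!%:R != 0 :> R by rewrite pnatr_eq0 -lt0n fact_gt0.
have h2 : (k + m)`!%:R != 0 :> R by rewrite pnatr_eq0 -lt0n fact_gt0.
have h : k%:R + 1 != 0 :> R by rewrite natr1 pnatr_eq0.
have h3 : k%:R + m%:R + 1 != 0 :> R by rewrite -natrD natr1 pnatr_eq0.
have h4 : k%:R + m%:R + 1 + 1 != 0 :> R by rewrite -natrD !natr1 pnatr_eq0.
move: h1 h2; move: (k`!) ((k + m)`!) => c d h1 h2.
rewrite !natrM -!natr1 natrD; move: h h1 h2 h3 h4.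
move: (k%:R : R) (m%:R : R) (c%:R : R) (d%:R : R) => a b {}c {}d h h1 h2 h3 h4.
by field; rewrite ?h ?h1 ?h2 ?h3 ?h4.
Qed.

Lemma bes0 m : bes m 0 = m`!%:R^-1.
Proof.
apply/cvg_lim => //; apply: cvg_near_cst; exists 1%N => //= n n0.
rewrite /series /= (bigD1_seq 0%N) ?mem_index_iota ?iota_uniq //= big1.
  by rewrite addr0 expr0 mulr1 /bes_coef add0n mul1n expr0 mul1r.
by move=> [|i] // _; rewrite expr0n /= mulr0.
Qed.

(** [j! bes j x = 1 + x g(x)] with [|g(x)| <= exp|x| / (j+1)], so [j + 1 > |x| exp|x|] suffices. *)
Lemma bes_large_neq0 x : exists j0, forall j, (j0 <= j)%N -> bes j x != 0.
Proof.
pose j0 := (Num.truncn (`|x| * expR `|x|)).+1.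
exists j0 => j j0j; apply/eqP => bj.
have h1 : j`!%:R != 0 :> R by rewrite pnatr_eq0 -lt0n fact_gt0.
pose g k : R := (-1) ^+ k.+1 * j`!%:R / (k.+1`! * (k.+1 + j)`!)%:R.
have ge k : `|g k| <= j.+1%:R^-1 * (1 ^+ k / k`!%:R).
  rewrite /g !normrM normrX normrN1 normfV !normr_nat !expr1n !mul1r addSn !factS.
  rewrite -invfM -natrM ler_pdivrMr ?ltr0n ?muln_gt0 ?fact_gt0 // mulrC.
  rewrite ler_pdivlMr ?ltr0n ?muln_gt0 ?fact_gt0 // -natrM ler_nat.
  have : (j`! <= (k + j)`!)%N by apply: leq_fact; exact: leq_addl.
  have := fact_gt0 k; have := fact_gt0 j; set a := j`!; set b := k`!; set c := (k + j)`!.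
  move=> a0 b0 ac.
  have -> : (a * (j.+1 * b) = 1 * b * (j.+1 * a))%N by ring.
  by rewrite leq_mul // leq_mul //; lia.
have eg : entire g.
  apply: (entire_le (g := fun k => j.+1%:R^-1 * (1 ^+ k / k`!%:R))) => //.
  exact/entireZ/entire_exp.
have : j`!%:R * bes j x = 1 + x * ev g x.
  rewrite /bes -evZ; last exact: entire_bes_coef.
  rewrite -ev_shift //; apply/cvg_lim => //.
  have c1 := entire_cvg (x := x) (entire_shift eg).
  have : (fun n : nat => (1 + series (fun k => sshift g k * x ^+ k) n : R)) @ \oo --> 1 + ev (sshift g) x.
    by apply: cvgD; [exact: cvg_cst|exact: c1].
  apply: cvg_trans; apply: near_eq_cvg; exists 1%N => // -[|n] //= _.
  rewrite /series /= !big_nat_recl //= mul0r add0r expr0 !mulr1.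
  have -> : j`!%:R * bes_coef j 0 = 1 :> R by rewrite /bes_coef expr0 add0n mul1n mul1r divff.
  congr (_ + _).
  apply: eq_bigr => k _; congr (_ * _).
  by rewrite /g /bes_coef; ring.
rewrite bj mulr0 => /eqP; rewrite eq_sym addrC addr_eq0 => /eqP xg.
have : `|x * ev g x| < 1.
  rewrite normrM.
  have : `|ev g x| <= j.+1%:R^-1 * expR `|x|.
    rewrite /ev; apply: (le_trans (lim_series_norm (eg x))).
    have -> : j.+1%:R^-1 * expR `|x| = limn (series (j.+1%:R^-1 *: exp_coeff `|x|)).
      by rewrite lim_seriesZ //; exact: is_cvg_series_exp_coeff.
    apply: lim_series_le; first exact: eg.
      by apply: is_cvg_seriesZ; exact: is_cvg_series_exp_coeff.
    move=> k /=; rewrite normrM normrX.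
    apply: (le_trans (ler_wpM2r _ (ge k))); first by rewrite exprn_ge0.
    rewrite expr1n mul1r -[X in _ <= X]/(j.+1%:R^-1 * (`|x| ^+ k / k`!%:R)).
    by rewrite -mulrA [_^-1 * `|x| ^+ k]mulrC.
  move=> H; apply: (@le_lt_trans _ _ (`|x| * (j.+1%:R^-1 * expR `|x|))); first by rewrite ler_wpM2l.
  rewrite mulrCA mulrC ltr_pdivrMr ?ltr0n // mul1r.
  have := truncn_itv (_ : 0 <= `|x| * expR `|x|); rewrite mulr_ge0 ?expR_ge0 // => /(_ isT) /andP[_ h].
  by apply: (lt_trans h); rewrite ltr_nat.
by rewrite xg normrN1 ltxx.
Qed.

(** Two consecutive zeros would spread to all higher orders by [bes_rec], against [bes_large_neq0].
    The simplicity of the zeros rests on this. *)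
Lemma bes_neq0_succ m x : bes m x = 0 -> bes m.+1 x != 0.
Proof.
move=> m0; apply/eqP => m1.
have [x0|x0] := eqVneq x 0.
  by move: m0; rewrite x0 bes0 => /eqP; rewrite invr_eq0 pnatr_eq0 -lt0n fact_gt0 || rewrite invr_eq0 pnatr_eq0 eqn0Ngt fact_gt0.
have H k : bes (m + k) x = 0 /\ bes (m + k).+1 x = 0.
  elim: k => [|k [h1 h2]]; first by rewrite addn0.
  rewrite addnS; split => //; apply: (mulfI x0).
  by have := bes_rec (m + k) x; rewrite h1 h2 add0r !mulr0.
have [j0 /(_ (m + j0)%N (leq_addl _ _))] := bes_large_neq0 x.
by rewrite (H j0).1 eqxx.
Qed.

End Bessel.

(** * Forms in J_0 and its Euler derivative *)

Section Monomials.
Variable R : realType.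

(** In the variable x = r^2/4, [ser1] is J_0 and [ser2] its Euler derivative. Together with x they
    generate a ring stable under [theta], which moreover preserves the degree in the two series. *)
Definition ser1 : nat -> R := bes_coef R 0.
Definition ser2 : nat -> R := theta ser1.
Definition one_ser (k : nat) : R := (k == 0)%:R.
Definition pow_ser a b := iter a (conv ser1) (iter b (conv ser2) one_ser).
Definition mono j a b := iter j (@sshift R) (pow_ser a b).

Lemma ser1E k : ser1 k = (-1) ^+ k / k`!%:R ^+ 2.
Proof. by rewrite /ser1 /bes_coef addn0 natrM expr2. Qed.

Lemma factint_ser1 : factint 1 ser1.
Proof.
move=> k; exists ((-1) ^+ k); rewrite ser1E rmorphXn rmorphN1; split => //.
by rewrite normrX normrN1 expr1n exp1n.
Qed.

Lemma factint_ser2 : factint 2 ser2.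
Proof.
move=> k; exists (k%:Z * (-1) ^+ k); rewrite /ser2 /theta ser1E rmorphM rmorphXn rmorphN1 mulrA.
split; first by rewrite /= -pmulrn.
rewrite normrM normrX normrN1 expr1n mulr1 ger0_norm // lez_nat.
rewrite -mulnn; have := ltn_expl k (ltnSn 1); have : (0 < 2 ^ k)%N by rewrite expn_gt0.
by nia.
Qed.

Lemma factint_one : factint 0 one_ser.
Proof.
move=> k; exists (k == 0)%:Z; rewrite /one_ser; split; last by case: k.
by case: k => [|k] /=; rewrite ?fact0 ?expr1n ?divr1 // mul0r.
Qed.

Lemma factint_pow a b : factint (a + 2 * b) (pow_ser a b).
Proof.
elim: a => [|a IH]; last by rewrite -add1n -addnA; exact: factint_conv factint_ser1 IH.
elim: b => [|b IH]; first exact: factint_one.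
by rewrite add0n mulnS; exact: factint_conv factint_ser2 IH.
Qed.

Lemma entire_pow a b : entire (pow_ser a b).
Proof. exact: factint_entire (factint_pow a b). Qed.
Arguments entire_pow : clear implicits.

Lemma entire_iter_shift j (u : nat -> R) : entire u -> entire (iter j (@sshift R) u).
Proof. by elim: j => // j IH h; apply: entire_shift; exact: IH. Qed.

Lemma entire_mono j a b : entire (mono j a b).
Proof. exact/entire_iter_shift/entire_pow. Qed.
Arguments entire_mono : clear implicits.

Lemma ev_pow a b x : ev (pow_ser a b) x = ev ser1 x ^+ a * ev ser2 x ^+ b.
Proof.
have e1 : entire ser1 by exact: entire_bes_coef.
have e2 : entire ser2 by exact: entire_theta.
elim: a => [|a IH].
  rewrite expr0 mul1r; elim: b => [|b IH].
    rewrite expr0; apply/cvg_lim => //; apply: cvg_near_cst; exists 1%N => //= n n0.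
    rewrite /series /= (bigD1_seq 0%N) ?mem_index_iota ?iota_uniq //= big1.
      by rewrite addr0 expr0 mulr1.
    by move=> [|i] // _; rewrite mul0r.
  by rewrite exprS -IH -ev_conv // ?entire_pow //; exact: (entire_pow 0).
by rewrite exprS -mulrA -IH -ev_conv //; exact: entire_pow.
Qed.

Lemma ev_mono j a b x : ev (mono j a b) x = x ^+ j * (ev ser1 x ^+ a * ev ser2 x ^+ b).
Proof.
elim: j => [|j IH]; first by rewrite mul1r ev_pow.
by rewrite /mono iterS ev_shift ?exprS -?mulrA -?IH //; exact: entire_mono.
Qed.

Lemma monoE j a b k : mono j a b k = if (k < j)%N then 0 else pow_ser a b (k - j)%N.
Proof.
elim: j k => [|j IH] k; first by rewrite subn0.
by rewrite /mono iterS; case: k => [|k] //=; rewrite -/(mono j a b) IH ltnS subSS.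
Qed.

(** Bessel's equation of order 0 in this variable. *)
Lemma theta_ser2 k : theta ser2 k = - sshift ser1 k.
Proof.
rewrite /theta /ser2 /theta; case: k => [|k] /=; first by rewrite mul0r oppr0.
rewrite !ser1E exprS factS natrM.
have : k.+1%:R != 0 :> R by rewrite pnatr_eq0.
have : k`!%:R != 0 :> R by rewrite pnatr_eq0 -lt0n fact_gt0.
move: (k.+1%:R : R) (k`!%:R : R) => a b h h1.
by field; rewrite ?h ?h1.
Qed.

Lemma pow_serSr a b : conv ser2 (pow_ser a b) = pow_ser a b.+1.
Proof. by elim: a => [|a IH] //; rewrite /pow_ser iterS convCA -/(pow_ser a b) IH. Qed.

(** Leibniz rule. When [a] or [b] is 0, the truncated predecessor is harmless, being multiplied by
    0. *)
Lemma theta_pow a b k : theta (pow_ser a b) k =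
  a%:R * pow_ser a.-1 b.+1 k - b%:R * sshift (pow_ser a.+1 b.-1) k.
Proof.
elim: a k => [|a IH] k.
  rewrite mul0r sub0r; elim: b k => [|b IH] k.
    by rewrite mul0r oppr0 /theta; case: k => [|k]; rewrite ?mul0r ?mulr0.
  have -> : pow_ser 0 b.+1 = conv ser2 (pow_ser 0 b) by [].
  rewrite theta_conv (_ : theta ser2 = fun k => -1 * sshift ser1 k); last first.
    by apply/funext => ?; rewrite theta_ser2 mulN1r.
  rewrite convC convZr conv_shiftr convC -/(pow_ser 1 b).
  rewrite (_ : theta (pow_ser 0 b) = fun k => - b%:R * sshift (pow_ser 1 b.-1) k); last first.
    by apply/funext => ?; rewrite IH mulNr.
  rewrite convZr conv_shiftr pow_serSr /= -natr1.
  by case: b {IH} => [|b] /=; ring.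
have -> : pow_ser a.+1 b = conv ser1 (pow_ser a b) by [].
rewrite theta_conv -/ser2 pow_serSr.
rewrite (_ : theta (pow_ser a b) = fun k => a%:R * pow_ser a.-1 b.+1 k + - b%:R * sshift (pow_ser a.+1 b.-1) k); last first.
  by apply/funext => ?; rewrite IH mulNr.
rewrite convDr !convZr conv_shiftr -/(pow_ser a.+2 b.-1) /= -natr1.
by case: a {IH} => [|a] /=; ring.
Qed.

Lemma theta_mono j a b k : theta (mono j a b) k =
  j%:R * mono j a b k + a%:R * mono j a.-1 b.+1 k - b%:R * mono j.+1 a.+1 b.-1 k.
Proof.
elim: j k => [|j IH] k; first by rewrite mul0r add0r theta_pow.
rewrite {1}/mono iterS theta_shift -/(mono j a b).
case: k => [|k] /=; first by rewrite !mulr0 addr0 subr0.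
by rewrite IH /mono !iterS /= -natr1; ring.
Qed.

Section Algebraic.
Variables (x c : R) (al be : {poly int}).
Let evz (p : {poly int}) : R := (map_poly intr p).[x].
Hypotheses (hal : ev ser1 x = c * evz al) (hbe : ev ser2 x = c * evz be).
Let de := maxn (size al) (size be).
Let K : int := 1 + pnorm al + pnorm be.

Lemma evzD p q : evz (p + q) = evz p + evz q.
Proof. by rewrite /evz rmorphD hornerD. Qed.
Lemma evzZ a p : evz (a *: p) = a%:~R * evz p.
Proof. by rewrite /evz map_polyZ hornerZ. Qed.
Lemma evzM p q : evz (p * q) = evz p * evz q.
Proof. by rewrite /evz rmorphM hornerM. Qed.
Lemma evzX p n : evz (p ^+ n) = evz p ^+ n.
Proof. by rewrite /evz rmorphXn hornerX || rewrite /evz rmorphXn /= horner_exp. Qed.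

Lemma K_ge1 : 1 <= K. Proof. by rewrite /K -addrA lerDl addr_ge0 // pnorm_ge0. Qed.

(** Homogeneity lets the unknown factor [c] come out as a power, leaving an integer polynomial at
    [x] fit for Liouville's inequality. Each application of [theta] adds 1 to the bound on the size
    and one linear factor to the bound on the norm. *)
Lemma theta_pow_mono i j a b : exists Q : {poly int},
  [/\ ev (fun k => k%:R ^+ i * mono j a b k) x = c ^+ (a + b) * evz Q,
      (size Q <= j + i + (a + b) * de + 1)%N &
      pnorm Q <= K ^+ (a + b) * (j + i + (a + b))%N%:Z ^+ i].
Proof.
elim: i j a b => [|i IH] j a b.
  exists ('X^j * (al ^+ a * be ^+ b)); split.
  - under eq_fun do rewrite expr0 mul1r.
    rewrite ev_mono hal hbe !evzM !evzX /evz map_polyX hornerX !exprMn exprD; ring.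
  - have sX (p : {poly int}) n : (size p <= de)%N -> (size (p ^+ n) <= n * de + 1)%N.
      move=> pd; rewrite (leq_trans (size_poly_exp_leq _ _)) // addn1 ltnS.
      by rewrite mulnC leq_mul2l (leq_trans (leq_pred _)) ?orbT.
    rewrite (leq_trans (size_polyMleq _ _)) // size_polyXn.
    have := size_polyMleq (al ^+ a) (be ^+ b).
    have := sX al a (leq_maxl _ _); have := sX be b (leq_maxr _ _); lia.
  - rewrite expr0 mulr1 (le_trans (pnormM _ _)) // pnormXn mul1r (le_trans (pnormM _ _)) // exprD.
    have pK p n : pnorm p <= K -> pnorm (p ^+ n) <= K ^+ n.
      move=> pK; rewrite (le_trans (pnormX _ _)) //; apply: lerXn2r => //.
        by rewrite nnegrE pnorm_ge0.
      by rewrite nnegrE (le_trans _ K_ge1).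
    apply: ler_pM; rewrite ?pnorm_ge0 // pK // /K.
      by rewrite addrAC lerDr addr_ge0 // pnorm_ge0.
    by rewrite lerDr addr_ge0 // pnorm_ge0.
have E : (fun k => k%:R ^+ i.+1 * mono j a b k) = (fun k =>
    j%:R * (k%:R ^+ i * mono j a b k) + (a%:R * (k%:R ^+ i * mono j a.-1 b.+1 k) +
    - b%:R * (k%:R ^+ i * mono j.+1 a.+1 b.-1 k))).
  apply/funext => k; rewrite exprSr -mulrA -/(theta (mono j a b) k) theta_mono; ring.
have ent j' a' b' : entire (fun k => k%:R ^+ i * mono j' a' b' k).
  elim: i {IH E} => [|i IH]; first by under eq_fun do rewrite expr0 mul1r; exact: entire_mono.
  have -> : (fun k => k%:R ^+ i.+1 * mono j' a' b' k) = theta (fun k => k%:R ^+ i * mono j' a' b' k).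
    by apply/funext => k; rewrite /theta exprS mulrA.
  exact: entire_theta.
have [Q1 [e1 s1 n1]] := IH j a b.
have [Q2 [e2 s2 n2]] : exists Q : {poly int},
  [/\ a%:R * ev (fun k => k%:R ^+ i * mono j a.-1 b.+1 k) x = a%:R * (c ^+ (a + b) * evz Q),
      (size Q <= j + i + (a + b) * de + 1)%N &
      pnorm Q <= K ^+ (a + b) * (j.+1 + i + (a + b))%N%:Z ^+ i].
  (* At [a = 0] the induction hypothesis has total degree [b + 1] instead of [b], but the term
     carries the coefficient 0: [Q = 0] serves. *)
  case: a {IH n1 s1 e1 E} (IH j a.-1 b.+1) => [|a] [Q [e s n]].
    exists 0; rewrite !mul0r size_poly0; split => //.
    by rewrite /pnorm size_poly0 big_ord0 mulr_ge0 // exprn_ge0 // (le_trans _ K_ge1).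
  exists Q; rewrite /= in e s n *; rewrite addSnnS e; split => //.
  rewrite (le_trans n) // ler_wpM2l ?exprn_ge0 ?(le_trans _ K_ge1) //.
  by apply: lerXn2r; rewrite ?nnegrE // lez_nat; lia.
have [Q3 [e3 s3 n3]] : exists Q : {poly int},
  [/\ b%:R * ev (fun k => k%:R ^+ i * mono j.+1 a.+1 b.-1 k) x = b%:R * (c ^+ (a + b) * evz Q),
      (size Q <= j.+1 + i + (a + b) * de + 1)%N &
      pnorm Q <= K ^+ (a + b) * (j.+1 + i + (a + b))%N%:Z ^+ i].
  case: b {IH n1 s1 e1 E n2 s2 e2} (IH j.+1 a.+1 b.-1) => [|b] [Q [e s n]].
    exists 0; rewrite !mul0r size_poly0; split => //.
    by rewrite /pnorm size_poly0 big_ord0 mulr_ge0 // exprn_ge0 // (le_trans _ K_ge1).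
  by exists Q; rewrite /= in e s n *; rewrite -addSnnS e; split.
exists (j%:Z *: Q1 + (a%:Z *: Q2 + (- b%:Z) *: Q3)); split.
- rewrite E evD; [|exact: entireZ|by apply: entireD; exact: entireZ].
  rewrite evD; try exact: entireZ.
  rewrite !evZ // !mulNr e1 e2 e3 !evzD !evzZ mulrNz -!pmulrn; ring.
- rewrite (leq_trans (size_polyD _ _)) // geq_max; apply/andP; split.
    by apply: (leq_trans (size_scale_leq _ _)); lia.
  rewrite (leq_trans (size_polyD _ _)) // geq_max.
  by apply/andP; split; apply: (leq_trans (size_scale_leq _ _)); lia.
- rewrite (le_trans (pnormD _ _)) // (le_trans (lerD (pnormZ _ _) (pnormD _ _))) //.
  rewrite (le_trans (lerD (lexx _) (lerD (pnormZ _ _) (pnormZ _ _)))) //.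
  set n := (j.+1 + i + (a + b))%N; have -> : (j + i.+1 + (a + b) = n)%N by rewrite /n; lia.
  have K0 : 0 <= K ^+ (a + b) by rewrite exprn_ge0 // (le_trans _ K_ge1).
  have {}n1 : pnorm Q1 <= K ^+ (a + b) * n%:Z ^+ i.
    rewrite (le_trans n1) // ler_wpM2l //.
    by apply: lerXn2r; rewrite ?nnegrE // lez_nat /n; lia.
  set M := K ^+ (a + b) * n%:Z ^+ i in n1 n2 n3.
  have M0 : 0 <= M by rewrite mulr_ge0 // exprn_ge0.
  have -> : K ^+ (a + b) * n%:Z ^+ i.+1 = n%:Z * M by rewrite exprS /M; ring.
  have : n%:Z = j%:Z + 1 + i%:Z + (a%:Z + b%:Z) by rewrite /n; lia.
  rewrite normrN !ger0_norm //; have := pnorm_ge0 Q1; have := pnorm_ge0 Q2; have := pnorm_ge0 Q3.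
  by nia.
Qed.

End Algebraic.
End Monomials.

Section Siegel.
Variable R : realType.

Lemma poly_unbounded_roots (p : {poly R}) :
  (forall a, exists2 t, a < t & p.[t] = 0) -> p = 0.
Proof.
move=> h; apply/eqP/negPn/negP => p0.
have [s [us rs ss]] : exists s : seq R, [/\ uniq s, all (root p) s & size s = size p].
  elim: (size p) => [|n [s [us rs ss]]]; first by exists [::].
  (* A root beyond the sum of the absolute values of the previous ones is new. *)
  have [t ts pt] := h (\sum_(y <- s) `|y|).
  exists (t :: s); split => /=; rewrite ?ss //.
    rewrite us andbT; apply/negP => tin; move: ts; apply/negP; rewrite -leNgt.
    by rewrite (big_rem t) //= (le_trans (ler_norm _)) // lerDl sumr_ge0.
  by rewrite rs andbT; apply/eqP.
by have := max_poly_roots p0 rs us; rewrite ss ltnn.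
Qed.

(** The constant coefficient of [ser1] is 1, so it can be cancelled; [forms_eq0] does so
    repeatedly. *)
Lemma conv_ser1_inj (u : nat -> R) : (forall k, conv (ser1 R) u k = 0) -> forall k, u k = 0.
Proof.
move=> h k; elim/ltn_ind: k => k IH; have := h k; rewrite /conv big_ord_recl /= subn0.
rewrite big1 ?addr0; first by rewrite ser1E expr0 fact0 expr1n divr1 mul1r.
by move=> i _; rewrite IH ?mulr0 // /bump /=; have := ltn_ord i; lia.
Qed.

Lemma conv_sumr (I : Type) (r : seq I) (P : pred I) (u : nat -> R) (F : I -> nat -> R) k :
  conv u (fun k => \sum_(i <- r | P i) F i k) k = \sum_(i <- r | P i) conv u (F i) k.
Proof.
by rewrite /conv exchange_big /=; apply: eq_bigr => i _; rewrite mulr_sumr.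
Qed.

Lemma ev_ser2 (x : R) : ev (ser2 R) x = - x * bes 1 x.
Proof.
rewrite /bes mulNr -mulrN -[- ev _ _]mulN1r -evZ ?(entire_bes_coef R 1) //; last exact: entire_bes_coef.
rewrite -ev_shift; last exact/entireZ/entire_bes_coef.
congr (ev _ x); apply/funext => -[|k]; first by rewrite /ser2 /theta mul0r.
rewrite /ser2 /theta /= -/(pseries_diffs (ser1 R) k) /ser1 bes_coef_diffs mulN1r //.
Qed.

(* At a zero of [bes 0] only the term with the lowest power of [bes 0] survives,
   so its coefficient, a polynomial, vanishes at infinitely many points. *)
Lemma forms_eq0 (nu n : nat) (q : 'I_nu.+1 -> 'I_n -> R) :
  (forall a, exists2 t, a < t & bes 0 t = 0 :> R) ->
  (forall k, \sum_a \sum_j q a j * mono R j a (nu - a) k = 0) ->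
  forall a j, q a j = 0.
Proof.
move=> zeros F0.
(* The form divided by [ser1^s], which is meaningful once the coefficients with [a < s] vanish. *)
pose G s k := \sum_(a < nu.+1 | (s <= a)%N) \sum_j q a j * mono R j (a - s) (nu - a) k.
suff H s : (s <= nu.+1)%N -> (forall a : 'I_nu.+1, (a < s)%N -> forall j, q a j = 0) /\
    forall k, G s k = 0.
  by move=> a j; apply: (H _ (leqnn _)).1.
elim: s => [|s IH] sn.
  split => // k; rewrite -[RHS](F0 k) /G; apply: eq_bigr => a _.
  by apply: eq_bigr => j _; rewrite subn0.
have [qs Gs] := IH (ltnW sn).
have qS (a : 'I_nu.+1) : a = s :> nat -> forall j, q a j = 0.
  move=> ea; pose p : {poly R} := \sum_j q a j *: 'X^j.
  suff p0 : p = 0.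
    move=> j; have := congr1 (fun p : {poly R} => p`_j) p0; rewrite /p coef_sum coef0.
    rewrite (bigD1 j) //= big1 ?addr0; first by rewrite coefZ coefXn eqxx mulr1.
    by move=> i ij; rewrite coefZ coefXn eq_sym (inj_eq val_inj) (negbTE ij) mulr0.
  apply: poly_unbounded_roots => b.
  have [t bt zt] := zeros (Num.max b 0).
  move: bt; rewrite gt_max => /andP[bt t0]; exists t => //.
  (* The zero was taken positive for this: there the Euler derivative of J_0 is [- t bes 1 t], which
     is not 0. *)
  have y2 : ev (ser2 R) t != 0.
    by rewrite ev_ser2 mulf_neq0 ?oppr_eq0 ?(gt_eqF t0) // bes_neq0_succ.
  apply: (mulIf (expf_neq0 (nu - s) y2)); rewrite mul0r -[RHS](ev0 t).
  have -> : (fun=> 0) = G s by apply/funext => k; rewrite Gs.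
  rewrite /G (_ : (fun k => _) = fun k => \sum_(a < nu.+1) \sum_j
      ((s <= a)%N%:R * q a j) * mono R j (a - s) (nu - a) k); last first.
    apply/funext => k; rewrite big_mkcond; apply: eq_bigr => i _; case: ifP => _.
      by apply: eq_bigr => j _; rewrite mul1r.
    by rewrite big1 // => j _; rewrite !mul0r.
  have entm j a' b' (z : R) : entire (fun k => z * mono R j a' b' k).
    by apply: entireZ; exact: entire_mono.
  rewrite ev_sum; last by move=> i; apply: entire_sum => j; exact: entm.
  rewrite (bigD1 a) //= big1 ?addr0.
    rewrite ev_sum; last by move=> j; exact: entm.
    rewrite /p horner_sum mulr_suml; apply: eq_bigr => j _.
    rewrite evZ; last exact: entire_mono.
    rewrite ev_mono ea leqnn subnn expr0 mul1r mul1r hornerZ hornerXn; ring.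
  move=> i ia; rewrite ev_sum; last by move=> j; exact: entm.
  rewrite big1 // => j _; rewrite evZ; last exact: entire_mono.
  rewrite ev_mono; case: (leqP s i) => si; last by rewrite !mul0r.
  have -> : ev (ser1 R) t = 0 by exact: zt.
  rewrite expr0n subn_eq0 leqNgt ltn_neqAle si andbT /=.
  by rewrite -ea eq_sym (inj_eq val_inj) ia /= !(mul0r, mulr0).
have qs' (a : 'I_nu.+1) : (a < s.+1)%N -> forall j, q a j = 0.
  by rewrite ltnS leq_eqVlt => /orP[/eqP /qS|/qs].
split => //; apply: conv_ser1_inj => k; rewrite -[RHS](Gs k) /G conv_sumr.
rewrite [RHS](bigID (fun a : 'I_nu.+1 => (s < a)%N)) /= [X in _ = _ + X]big1 ?addr0; last first.
  move=> a /andP[sa]; rewrite -leqNgt => as_; apply: big1 => j _.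
  by rewrite qs' ?mul0r // ltnS.
apply: eq_big => [a|a sa].
  by case: (ltnP s a) => sa; rewrite ?andbF // andbT ltnW.
rewrite conv_sumr; apply: eq_bigr => j _.
rewrite convZr; congr (_ * _).
have -> : (a - s = (a - s.+1).+1)%N by lia.
rewrite /mono; elim: (nat_of_ord j) k => [|j' IHj] k //.
by rewrite !iterS conv_shiftr; case: k => [|k] //=; rewrite IHj.
Qed.

Lemma exp_lt_fact (C : R) : exists n0, forall n, (n0 <= n)%N -> C ^+ n < n`!%:R.
Proof.
have : exp_coeff C @ \oo --> 0 by apply: cvg_series_cvg_0; exact: is_cvg_series_exp_coeff.
move=> /cvgr0Pnorm_lt /(_ 1 ltr01) [N _ hN]; exists N => n Nn.
have := hN n Nn; rewrite /exp_coeff /= => h.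
have := le_lt_trans (ler_norm _) h.
by rewrite ltr_pdivrMr ?mul1r // ltr0n fact_gt0.
Qed.

Lemma fact_exp_le n h : (n`! ^ h <= (h * n)`!)%N.
Proof.
elim: h => [|h IH]; first by rewrite mul0n.
rewrite expnS mulSn -(@bin_fact (n + h * n) n) ?leq_addr // addKn.
by rewrite -[leqLHS]mul1n leq_mul ?bin_gt0 ?leq_addr // leq_mul.
Qed.

End Siegel.

Section SiegelTheorem.
Variable R : realType.
Hypothesis zeros : forall a : R, exists2 t, a < t & bes 0 t = 0.

(** There are [2 T0] integer unknowns for the vanishing of the [T0] lowest coefficients. Dividing
    [q a j] by [j!^2] makes [k!^2] times the coefficient of index [k] integral, with a squared
    binomial of [k] over [j]. [T] is the exact order, finite by [forms_eq0]; in [D], the 16 absorbs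
    two factors [2 T0] and [A^4] the powers of [A]. *)
Lemma siegel_form (nu n T0 : nat) : (0 < nu)%N -> (0 < T0)%N ->
    (nu.+1 * n = 2 * T0)%N ->
  let A := (2 * (2 * nu))%N in
  let D := (16 * A ^ 4)%N in
  exists (q : 'I_nu.+1 -> 'I_n -> int) (phi : nat -> int) (T : nat),
  [/\ (T0 <= T)%N, (forall k, (k < T)%N -> phi k = 0) /\ phi T != 0,
     forall k, (T <= k)%N -> `|phi k| <= (D ^ k)%:Z,
     forall a j, `|q a j| <= (2 * T0 * A ^ (2 * T0))%:Z &
     forall k, (phi k)%:~R / k`!%:R ^+ 2 =
       \sum_a \sum_j ((q a j)%:~R / j`!%:R ^+ 2) * mono R j a (nu - a) k].
Proof.
move=> nu0 T00 nuT A D.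
have A0 : (0 < A)%N by rewrite /A; lia.
have /choice [cE hcE] (a : 'I_nu.+1) : exists c : nat -> int, forall k,
    pow_ser R a (nu - a) k = (c k)%:~R / k`!%:R ^+ 2 /\ `|c k| <= (((2 * nu) ^ k) ^ 2)%:Z.
  have /choice [c hc] := @factint_pow R a (nu - a); exists c => k.
  have [-> h] := hc k; split => //; rewrite (le_trans h) // lez_nat leq_exp2r //.
  by case: k {h} => // k; rewrite leq_exp2r //; have := ltn_ord a; lia.
pose I := ('I_nu.+1 * 'I_n)%type.
(* The binomial vanishes for [j > k], where [k - j] is truncated, so it also encodes the shift by
   [x^j]. *)
pose en k (i : I) : int := ('C(k, i.2) ^ 2)%:Z * cE i.1 (k - i.2)%N.
have en_le k i : `|en k i| <= (A ^ (2 * k))%:Z.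
  rewrite normrM ger0_norm // (le_trans (ler_wpM2l _ (hcE _ _).2)) //.
  rewrite -PoszM lez_nat -expnMn [(2 * k)%N]mulnC expnM leq_exp2r // /A [leqRHS]expnMn.
  apply: leq_mul; first exact: bin_le_exp2.
  by rewrite leq_pexp2l ?leq_subr // muln_gt0.
have [|||q0 [q0n q0e q0b]] := @siegel_lemma I T0 (fun k => en k) (A ^ (2 * T0)) T00.
- by rewrite card_prod !card_ord.
- by rewrite expn_gt0 A0.
- move=> k i; rewrite (le_trans (en_le _ _)) // lez_nat leq_pexp2l // leq_mul2l /=.
  by rewrite ltnW.
pose q a j := q0 (a, j).
pose phi k : int := \sum_i en k i * q0 i.
have cI : #|{: I}| = (2 * T0)%N by rewrite card_prod !card_ord.
have qb a j : `|q a j| <= (2 * T0 * A ^ (2 * T0))%:Z by have := q0b (a, j); rewrite cI.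
have phiE k : (phi k)%:~R / k`!%:R ^+ 2 =
       \sum_a \sum_j ((q a j)%:~R / j`!%:R ^+ 2) * mono R j a (nu - a) k.
  rewrite pair_big /= /phi rmorph_sum mulr_suml; apply: eq_bigr => -[a j] _ /=.
  rewrite -/(q a j) monoE /en !rmorphM /= -pmulrn.
  case: ltnP => jk; first by rewrite bin_small // !(mul0r, mulr0).
  rewrite (hcE a (k - j)%N).1 -(bin_fact jk) !natrM.
  have : j`!%:R != 0 :> R by rewrite pnatr_eq0 -lt0n fact_gt0.
  have : (k - j)`!%:R != 0 :> R by rewrite pnatr_eq0 -lt0n fact_gt0.
  have : 'C(k, j)%:R != 0 :> R by rewrite pnatr_eq0 -lt0n bin_gt0.
  move: (j`!%:R : R) ((k - j)`!%:R : R) ('C(k, j)%:R : R) => r1 r2 r3 h1 h2 h3.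
  by field; rewrite ?h1 ?h2 ?h3.
have phiN : exists k, phi k != 0.
  apply: contrapT => H.
  have {}H k : phi k = 0 by apply/eqP; apply: contra_notT H => ?; exists k.
  have [[a j] /negP] := q0n; apply.
  have : (q a j)%:~R / j`!%:R ^+ 2 = 0 :> R.
    apply: (@forms_eq0 R nu n (fun a j => (q a j)%:~R / j`!%:R ^+ 2) zeros) => k.
    by rewrite -phiE H mul0r.
  move=> /eqP; rewrite mulf_eq0 invr_eq0 expf_eq0 /= pnatr_eq0 intr_eq0.
  by rewrite [(j`! == 0)%N]eqn0Ngt fact_gt0 orbF.
case: (ex_minnP phiN) => T phiT Tmin.
have T0T : (T0 <= T)%N.
  rewrite leqNgt; apply/negP => TT0.
  by move/negP: phiT; apply; rewrite /phi (q0e (Ordinal TT0)).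
exists q, phi, T; split => //.
  split => // k kT; apply/eqP; apply: contraTT kT => kn; rewrite -leqNgt; exact: Tmin.
move=> k Tk; apply: (le_trans (ler_norm_sum _ _ _)).
apply: (@le_trans _ _ (\sum_(i : I) (A ^ (2 * k) * (2 * T0 * A ^ (2 * T0)))%:Z)).
  apply: ler_sum => -[a j] _; rewrite normrM PoszM; apply: ler_pM => //.
  exact: qb.
rewrite sumr_const cI -mulr_natl natz -PoszM lez_nat /D expnMn.
have H1 : (A ^ (2 * T0) <= A ^ (2 * k))%N by rewrite leq_pexp2l // leq_mul2l (leq_trans T0T).
have -> : ((A ^ 4) ^ k = A ^ (2 * k) * A ^ (2 * k))%N.
  by rewrite -expnM -expnD; congr (_ ^ _)%N; lia.
have H2 : (2 * T0 * (2 * T0) <= 16 ^ k)%N.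
  have k2 : (T0 < 2 ^ k)%N by rewrite (leq_ltn_trans (leq_trans T0T Tk)) // ltn_expl.
  have k4 : (4 <= 4 ^ k)%N by rewrite -{1}(expn1 4) leq_exp2l // (leq_trans T00) // (leq_trans T0T).
  have -> : (16 ^ k = 4 ^ k * (2 ^ k * 2 ^ k))%N by rewrite -!expnMn.
  move: (2 ^ k)%N (4 ^ k)%N k2 k4 => u v k2 k4.
  have -> : (2 * T0 * (2 * T0) = 4 * (T0 * T0))%N by lia.
  by rewrite leq_mul // leq_mul // ltnW.
have -> : (2 * T0 * (A ^ (2 * k) * (2 * T0 * A ^ (2 * T0))) =
  (2 * T0 * (2 * T0)) * (A ^ (2 * k) * A ^ (2 * T0)))%N by ring.
by rewrite leq_mul // leq_mul.
Qed.

(* Siegel (1929), for [J_0]: the auxiliary form vanishes to a high order [T] at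
   [0], hence is tiny at [x] together with its first derivatives; one of these
   is nonzero by [zero_estimate], and it is an algebraic number of controlled
   height, against Liouville's inequality. *)
Theorem siegel_bessel (x c : R) (B al be : {poly int}) :
  0 < x -> B != 0 -> (map_poly intr B).[x] = 0 ->
  ev (ser1 R) x = c * (map_poly intr al).[x] ->
  ev (ser2 R) x = c * (map_poly intr be).[x] -> c = 0.
Proof.
move=> x0 B0 Bx hal hbe; apply/eqP/negPn/negP => c0.
have [d [C [C0 hL]]] := liouville B0 Bx.
(* Clearing denominators costs [n!^2], to the power [d + 1] in Liouville's inequality, and
   [n!^h <= (h n)! <= T!]. Of the [T!^2] gained by the vanishing, one [T!] is left to beat the
   geometric factors. [nu + 1 = 2 h] gives [T0 = h n]. *)
pose h := (2 * d.+1)%N; pose nu := (2 * h).-1.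
have h0 : (0 < h)%N by rewrite /h; lia.
have nu0 : (0 < nu)%N by rewrite /nu; lia.
pose A := (2 * (2 * nu))%N; pose D := (16 * A ^ 4)%N.
pose de := maxn (size al) (size be).
pose K : int := 1 + pnorm al + pnorm be.
have K1 : 1 <= K := K_ge1 al be.
pose C2 : int := 16 * (A ^ 2)%:Z * K ^+ nu * 3 * D%:Z.
pose c' : R := `|c| ^+ nu.
have c'0 : 0 < c' by rewrite exprn_gt0 // normr_gt0.
pose C3 : R := C ^+ 3 * C2%:~R ^+ d * (4 * D%:R ^+ 2 * x) * (2 * (1 + c'^-1)).
have [n0 hn0] := exp_lt_fact C3.
(* Each summand is a threshold that [T >= n] has to pass below. *)
pose n := (n0 + D + 2 + nu * de + nu + 1 + Num.truncn (4 * D%:R * x : R))%N.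
have n_gt0 : (0 < n)%N by rewrite /n; lia.
have hn_gt0 : (0 < h * n)%N by rewrite muln_gt0 h0.
have nuh : (nu.+1 * n = 2 * (h * n))%N by rewrite /nu prednK ?mulnA // muln_gt0.
have [q [phi [T [T0T [phi_lt phiT] phiD qb phiE]]]] := siegel_form nu0 hn_gt0 nuh.
have nT : (n <= T)%N by rewrite (leq_trans _ T0T) // leq_pmull.
have T2 : (2 <= T)%N by rewrite (leq_trans _ nT) // /n; lia.
have DT : (D <= T)%N by rewrite (leq_trans _ nT) // /n; lia.
have DxT : 4 * D%:R * x <= T%:R.
  have h1 : 0 <= 4 * D%:R * x by rewrite !mulr_ge0 // ltW.
  have /andP[_ h2] := truncn_itv h1.
  by rewrite (le_trans (ltW h2)) // ler_nat (leq_trans _ nT) // /n; lia.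
set S := trunc_log T (D ^ T).
have ST : (S <= T)%N := leST phiT phiD T2 DT.
have TS : (T ^ S <= D ^ T)%N := expTS phiT phiD T2.
have [i iS evi] := zero_estimate x0 phi_lt phiT phiD T2 DT DxT.
have evi_le := ev_e_le x0 phi_lt phiT phiD T2 DT DxT iS.
rewrite -/A -/D -/S in evi evi_le iS *.
set V := ev _ x in evi evi_le.
have /choice [Q0 hQ0] (p : 'I_nu.+1 * 'I_n) := theta_pow_mono hal hbe i p.2 p.1 (nu - p.1).
have anu (a : 'I_nu.+1) : (a + (nu - a) = nu)%N by rewrite subnKC // -ltnS.
(* The integer [n! / j!], whose square clears the denominator [j!^2]. *)
pose co (j : 'I_n) : nat := (n ^_ (n - j))%N.
have coE (j : 'I_n) : (co j * j`! = n`!)%N.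
  by rewrite /co -[in j`!](subKn (ltnW (ltn_ord j))) ffact_fact ?leq_subr.
pose Q : {poly int} := \sum_p (q p.1 p.2 * (co p.2 ^ 2)%:Z) *: Q0 p.
have VQ : n`!%:R ^+ 2 * V = c ^+ nu * (map_poly intr Q).[x].
  have entm p : entire (fun k => (q p.1 p.2)%:~R / p.2`!%:R ^+ 2 *
      (k%:R ^+ i * mono R p.2 p.1 (nu - p.1) k)).
    apply: entireZ; elim: (i) => [|i' IH].
      by under eq_fun do rewrite expr0 mul1r; exact: entire_mono.
    have -> : (fun k => k%:R ^+ i'.+1 * mono R p.2 p.1 (nu - p.1) k) =
        theta (fun k => k%:R ^+ i' * mono R p.2 p.1 (nu - p.1) k).
      by apply/funext => k; rewrite /theta exprS mulrA.
    exact: entire_theta.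
  have entm' (p : 'I_nu.+1 * 'I_n) : entire (fun k => k%:R ^+ i * mono R p.2 p.1 (nu - p.1) k).
    elim: (i) => [|i' IH].
      by under eq_fun do rewrite expr0 mul1r; exact: entire_mono.
    have -> : (fun k => k%:R ^+ i'.+1 * mono R p.2 p.1 (nu - p.1) k) =
        theta (fun k => k%:R ^+ i' * mono R p.2 p.1 (nu - p.1) k).
      by apply/funext => k; rewrite /theta exprS mulrA.
    exact: entire_theta.
  have -> : V = \sum_p (q p.1 p.2)%:~R / p.2`!%:R ^+ 2 * (c ^+ nu * (map_poly intr (Q0 p)).[x]).
    rewrite /V; transitivity (ev (fun k => \sum_p (q p.1 p.2)%:~R / p.2`!%:R ^+ 2 *
      (k%:R ^+ i * mono R p.2 p.1 (nu - p.1) k)) x).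
      congr (ev _ x); apply/funext => k; rewrite phiE pair_big /= mulr_sumr.
      by apply: eq_bigr => p _; rewrite mulrCA.
    rewrite ev_sum //; apply: eq_bigr => p _.
    have [e _ _] := hQ0 p; rewrite evZ; [by rewrite e anu|exact: entm'].
  rewrite mulr_sumr /Q rmorph_sum horner_sum mulr_sumr; apply: eq_bigr => p _.
  rewrite /= map_polyZ hornerZ rmorphM /= -pmulrn -(coE p.2) natrX natrM.
  have : p.2`!%:R != 0 :> R by rewrite pnatr_eq0 -lt0n fact_gt0.
  move: (p.2`!%:R : R) => r1 h1.
  by field; rewrite ?h1.
have Qx0 : (map_poly intr Q).[x] != 0.
  have : n`!%:R ^+ 2 * V != 0.
    by rewrite mulf_neq0 // expf_neq0 // pnatr_eq0 -lt0n fact_gt0.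
  by rewrite VQ mulf_eq0 negb_or => /andP[].
have sQ : (size Q <= 3 * T)%N.
  apply: (leq_trans (size_sum _ _ _)); apply/bigmax_leqP => p _.
  apply: (leq_trans (size_scale_leq _ _)).
  have [_ s _] := hQ0 p; apply: (leq_trans s); rewrite anu -/de.
  have : (nu * de + 1 <= T)%N by rewrite (leq_trans _ nT) // /n; clear; lia.
  have aux (a b c1 d' e f : nat) : (a < b)%N -> (b <= f)%N -> (c1 <= d')%N -> (d' <= f)%N ->
    (e + 1 <= f)%N -> (a + c1 + e + 1 <= 3 * f)%N by clear; lia.
  by move=> w1; exact: (aux _ _ _ _ _ _ (ltn_ord p.2) nT iS ST w1).
have nQ : pnorm Q <= (n`! ^ 2)%:Z * C2 ^+ T.
  apply: (le_trans (pnorm_sum _ _ _)).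
  set T0 := (h * n)%N in T0T qb.
  have T00 : (0 < T0)%N by [].
  apply: (@le_trans _ _ (\sum_(p : 'I_nu.+1 * 'I_n) (2 * T0 * A ^ (2 * T0))%:Z * (n`! ^ 2)%:Z *
     (K ^+ nu * ((3 * T) ^ S)%:Z))).
    apply: ler_sum => p _; apply: (le_trans (pnormZ _ _)).
    rewrite normrM; apply: ler_pM; rewrite ?mulr_ge0 ?pnorm_ge0 //.
      apply: ler_pM => //.
      by rewrite ger0_norm // lez_nat leq_exp2r // -(coE p.2) leq_pmulr // fact_gt0.
    have [_ _ m] := hQ0 p; apply: (le_trans m); rewrite anu -/K ler_wpM2l //.
      by rewrite exprn_ge0 // (le_trans _ K1).
    have : ((p.2 + i + nu) ^ i <= (3 * T) ^ S)%N.
      apply: (@leq_trans ((3 * T) ^ i)).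
        have le_exp (a b k : nat) : (a <= b)%N -> (a ^ k <= b ^ k)%N.
          by case: k => // k; rewrite leq_exp2r.
        apply: le_exp.
        have aux (a b c1 d' e f : nat) : (a < b)%N -> (b <= f)%N -> (c1 <= d')%N -> (d' <= f)%N ->
          (e <= f)%N -> (a + c1 + e <= 3 * f)%N by clear; lia.
        by apply: (aux _ _ _ _ _ _ (ltn_ord p.2) nT iS ST); rewrite (leq_trans _ nT) // /n; clear; lia.
      by rewrite leq_pexp2l // muln_gt0 (leq_trans _ T2).
    by rewrite -lez_nat -natz natrX natz.
  rewrite sumr_const card_prod !card_ord nuh -/T0 -mulr_natl natz.
  have H1 : (2 * T0 * (2 * T0) <= 16 ^ T)%N.
    have k2 : (T0 < 2 ^ T)%N by rewrite (leq_ltn_trans T0T) // ltn_expl.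
    have k4 : (4 <= 4 ^ T)%N by rewrite -{1}(expn1 4) leq_exp2l // (leq_trans _ T2).
    have -> : (16 ^ T = 4 ^ T * (2 ^ T * 2 ^ T))%N by rewrite -!expnMn.
    move: (2 ^ T)%N (4 ^ T)%N k2 k4 => u v k2 k4.
    have -> : (2 * T0 * (2 * T0) = 4 * (T0 * T0))%N by clear; lia.
    by rewrite leq_mul // leq_mul // ltnW.
  have A0 : (0 < A)%N by rewrite /A; clear; lia.
  have H2 : (A ^ (2 * T0) <= (A ^ 2) ^ T)%N by rewrite expnM leq_pexp2l // expn_gt0 A0.
  have H3 : ((3 * T) ^ S <= 3 ^ T * D ^ T)%N by rewrite expnMn leq_mul // leq_pexp2l.
  have -> : (2 * T0)%N%:Z * ((2 * T0 * A ^ (2 * T0))%:Z * (n`! ^ 2)%:Z * (K ^+ nu * ((3 * T) ^ S)%:Z)) =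
    (n`! ^ 2)%:Z * (((2 * T0 * (2 * T0)) * A ^ (2 * T0) * (3 * T) ^ S)%N%:Z * K ^+ nu).
    rewrite !PoszM; ring.
  rewrite ler_wpM2l //.
  have -> : C2 ^+ T = (16 ^ T * (A ^ 2) ^ T * (3 ^ T * D ^ T))%N%:Z * (K ^+ nu) ^+ T.
    have PX a b : (a ^ b)%N%:Z = a%:Z ^+ b by rewrite -!natz natrX.
    by rewrite /C2 !PoszM !PX !exprMn; ring.
  apply: ler_pM => //.
  - by rewrite exprn_ge0 // (le_trans _ K1).
  - by rewrite lez_nat leq_mul // leq_mul.
  - by rewrite ler_eXnr ?(leq_trans _ T2) // exprn_ege1.
(* The size of [Q] is bounded by three parts, from the power of x, the order [i] of the derivative
   and [nu de + 1], each at most [T]. *)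
have := hL Q (3 * T)%N _ sQ nQ Qx0.
have F0 k : 0 < k`!%:R :> R by rewrite ltr0n fact_gt0.
have c'n : `|c ^+ nu| = c' by rewrite normrX.
have Qxe : `|(map_poly intr Q).[x]| = n`!%:R ^+ 2 * `|V| / c'.
  have := congr1 Num.norm VQ; rewrite normrM [RHS]normrM c'n normrX normr_nat => ->.
  by rewrite mulrC mulKf // gt_eqF.
rewrite Qxe; apply/negP; rewrite -ltNge.
have C20 : 0 <= C2.
  by rewrite /C2 !mulr_ge0 // exprn_ge0 // (le_trans _ K1).
have C20R : 0 <= C2%:~R :> R by rewrite ler0z.
have n0T : (n0 <= T)%N by rewrite (leq_trans _ nT) // /n; clear; lia.
have key := hn0 T n0T.
apply: (@le_lt_trans _ _ (C ^+ (3 * T) * ((n`! ^ 2)%:Z * C2 ^+ T)%:~R ^+ d *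
   (n`!%:R ^+ 2 * (2 * ((4 * D%:R ^+ 2 * x) ^+ T / T`!%:R ^+ 2)) / c'))).
  rewrite ler_wpM2l ?mulr_ge0 ?exprn_ge0 ?(ltW C0) //.
    by rewrite ler0z mulr_ge0 // exprn_ge0.
  by rewrite ler_wpM2r ?invr_ge0 ?(ltW c'0) // ler_wpM2l ?exprn_ge0.
have -> : C ^+ (3 * T) * ((n`! ^ 2)%:Z * C2 ^+ T)%:~R ^+ d *
   (n`!%:R ^+ 2 * (2 * ((4 * D%:R ^+ 2 * x) ^+ T / T`!%:R ^+ 2)) / c') =
   (n`!%:R ^+ h) * ((C ^+ 3 * C2%:~R ^+ d * (4 * D%:R ^+ 2 * x)) ^+ T * (2 * c'^-1)) / T`!%:R ^+ 2 :> R.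
  rewrite rmorphM rmorphXn /= -pmulrn natrX.
  have -> : n`!%:R ^+ h = (n`!%:R ^+ 2) ^+ d * n`!%:R ^+ 2 :> R.
    by rewrite -exprM -exprD; congr (_ ^+ _); rewrite /h; clear; lia.
  rewrite (exprMn d) (exprAC _ T d) (exprM C 3 T).
  rewrite (exprMn T (C ^+ 3 * C2%:~R ^+ d)) (exprMn T (C ^+ 3)).
  move: ((C ^+ 3) ^+ T) ((C2%:~R ^+ d) ^+ T) ((4 * D%:R ^+ 2 * x) ^+ T) ((n`!%:R ^+ 2) ^+ d : R) => r1 r2 r3 r4.
  move: (T`!%:R ^+ 2 : R)^-1 (n`!%:R ^+ 2 : R) c'^-1 => r5 r6 r7; ring.
rewrite ltr_pdivrMr ?exprn_gt0 // mul1r [ltRHS]expr2.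
apply: (@le_lt_trans _ _ (T`!%:R * C3 ^+ T)); last by rewrite ltr_pM2l.
have X0 : 0 <= C ^+ 3 * C2%:~R ^+ d * (4 * D%:R ^+ 2 * x).
  by apply: mulr_ge0; apply: mulr_ge0; rewrite ?exprn_ge0 ?mulr_ge0 ?exprn_ge0 // ltW.
have ci : 0 < c'^-1 by rewrite invr_gt0.
apply: ler_pM; [by rewrite exprn_ge0| |by rewrite -natrX ler_nat (leq_trans (fact_exp_le _ _)) // leq_fact|].
  by apply: mulr_ge0; rewrite ?exprn_ge0 //; lra.
rewrite /C3 [leRHS]exprMn ler_wpM2l ?exprn_ge0 //.
apply: (@le_trans _ _ (2 * (1 + c'^-1))); first by rewrite ler_wpM2l // lerDr.
by rewrite ler_eXnr ?(leq_trans _ T2) //; lra.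
Qed.

End SiegelTheorem.

(** * Common zeros of two Bessel functions *)

Section Bourget.
Variable R : realType.
Hypothesis zeros : forall a : R, exists2 t, a < t & bes 0 t = 0.

(* Consecutive Lommel polynomials [(p_(k-1), p_k)]: at a zero [t] of [bes m],
   [t^k * bes (m+k+1) t = p_k(t) * bes (m+1) t]. *)
Fixpoint lommel (m k : nat) : {poly int} * {poly int} :=
  if k is k'.+1 then
    let p := lommel m k' in (p.2, (m + k').+1%:R *: p.2 - 'X * p.1)
  else (0, 1).

Lemma lommelE (m k : nat) (t : R) : bes m t = 0 ->
  t ^+ k * bes (m + k).+1 t = (map_poly intr (lommel m k).2).[t] * bes m.+1 t /\
  t ^+ k * bes (m + k) t = t * (map_poly intr (lommel m k).1).[t] * bes m.+1 t.
Proof.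
move=> f0; elim: k => [|k [h1 h2]].
  by rewrite addn0 /= rmorph1 rmorph0 hornerC horner0 f0 expr0 !(mul1r, mulr0, mul0r).
rewrite addnS exprSr; split; last by rewrite /= -!mulrA mulrCA -h1; ring.
have := bes_rec (m + k) t => E.
have -> : t ^+ k * t * bes (m + k).+2 t = t ^+ k * ((m + k).+1%:R * bes (m + k).+1 t - bes (m + k) t).
  by rewrite -E; ring.
rewrite mulrBr h2 mulrCA h1 /= rmorphB /= map_polyZ rmorphM /= map_polyX.
by rewrite hornerD hornerN hornerZ hornerM hornerX rmorph_nat; ring.
Qed.

(** The constant term is (m+1)...(m+k). It certifies that the polynomial vanishing at a common zero
    is not 0, so that the zero is algebraic. *)
Lemma lommel0 (m k : nat) : 0 < ((lommel m k).2).[0].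
Proof.
elim: k => [|k IH] /=; first by rewrite hornerC.
by rewrite hornerD hornerN hornerZ hornerM hornerX mul0r subr0 mulr_gt0 // ltr0n.
Qed.

(** The recurrence run downwards. At [i = m] it makes [bes 0] and [bes 1] integer polynomials in [t]
    times [bes m.+1 t], the common factor [c] of [siegel_bessel]. *)
Lemma bes_down (m i : nat) (t : R) : bes m t = 0 -> (i <= m)%N ->
  exists p q : {poly int}, bes (m - i).+1 t = bes m.+1 t * (map_poly intr p).[t] /\
    bes (m - i) t = bes m.+1 t * (map_poly intr q).[t].
Proof.
move=> f0; elim: i => [|i IH] im.
  exists 1, 0; rewrite subn0 f0 rmorph1 rmorph0 hornerC horner0; by rewrite mulr1 mulr0.
have [p [q [hp hq]]] := IH (ltnW im).
exists q, ((m - i)%N%:R *: q - 'X * p).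
have E : (m - i.+1).+1 = (m - i)%N by rewrite subnSK.
split; first by rewrite E.
have := bes_rec (m - i.+1) t; rewrite E hp hq => /(canRL (addrK _)) ->.
rewrite rmorphB /= map_polyZ rmorphM /= map_polyX.
by rewrite hornerD hornerN hornerZ hornerM hornerX rmorph_nat; ring.
Qed.

Theorem bourget (m n : nat) (t : R) : 0 < t -> bes m t = 0 -> bes n t = 0 -> m = n.
Proof.
wlog mn : m n / (m <= n)%N.
  by move=> H t0 fm fn; case: (leqP m n) => [|/ltnW] mn; [|symmetry]; apply: H.
move=> t0 fm fn; apply/eqP; rewrite eqn_leq mn /= leqNgt; apply/negP => {}mn.
have f1 := bes_neq0_succ fm; move/negP: f1; apply; apply/eqP.
have [p [q []]] := bes_down fm (leqnn m); rewrite subnn => hp hq.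
(* The index is [n - m - 1] because [lommel m k] reaches order [m + k + 1]. *)
have tE : (map_poly intr (lommel m (n - m).-1).2).[t] = 0.
  have [+ _] := lommelE (n - m).-1 fm.
  have -> : (m + (n - m).-1).+1 = n by lia.
  rewrite fn mulr0 => /esym/eqP; rewrite mulf_eq0.
  by rewrite (negbTE (bes_neq0_succ fm)) orbF => /eqP.
(* The factor [- 'X] in [be] is that of [ev_ser2]. *)
apply: (siegel_bessel zeros t0 _ tE (al := q) (be := - 'X * p)).
- by apply/eqP => h; have := lommel0 m (n - m).-1; rewrite h horner0 ltxx.
- exact: hq.
- by rewrite ev_ser2 hp rmorphM rmorphN /= map_polyX hornerM hornerN hornerX; ring.
Qed.

End Bourget.

(** * Sturm theory for the zeros of Bessel functions *)

Section Sturm.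
Variable R : realType.

Lemma derM (f g : R -> R) (r df dg : R) : is_derive r 1 f df -> is_derive r 1 g dg ->
  is_derive r 1 (fun x => f x * g x) (df * g r + f r * dg).
Proof.
move=> hf hg; have := @is_deriveM _ _ f g r 1 _ _ hf hg.
by move/is_derive_eq; apply; rewrite /GRing.scale /=; ring.
Qed.

Lemma derD (f g : R -> R) (r df dg : R) : is_derive r 1 f df -> is_derive r 1 g dg ->
  is_derive r 1 (fun x => f x + g x) (df + dg).
Proof. by move=> hf hg; exact: is_deriveD. Qed.

Lemma derB (f g : R -> R) (r df dg : R) : is_derive r 1 f df -> is_derive r 1 g dg ->
  is_derive r 1 (fun x => f x - g x) (df - dg).
Proof. by move=> hf hg; exact: is_deriveB. Qed.

Lemma derV (f : R -> R) (r df : R) : f r != 0 -> is_derive r 1 f df ->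
  is_derive r 1 (fun x => (f x)^-1) (- df / f r ^+ 2).
Proof.
move=> f0 hf; have d : derivable f r 1 by exact: ex_derive.
have := @deriveV _ _ f r 1 f0 d; rewrite [X in _ = _ *: X]derive_val => e.
apply: DeriveDef; first exact: derivableV; rewrite e /GRing.scale /=; ring.
Qed.

Lemma derX n (r : R) : is_derive r 1 (fun x => x ^+ n) (n%:R * r ^+ n.-1).
Proof.
apply: DeriveDef; first exact: exprn_derivable.
by rewrite exp_derive /GRing.scale /= mulr1.
Qed.

Lemma derZ (a : R) (f : R -> R) (r df : R) : is_derive r 1 f df ->
  is_derive r 1 (fun x => a * f x) (a * df).
Proof. by move=> hf; exact: is_deriveZ. Qed.

Lemma derC (f g : R -> R) (r df dg : R) : is_derive (g r) 1 f df -> is_derive r 1 g dg ->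
  is_derive r 1 (fun x => f (g x)) (df * dg).
Proof. by move=> hf hg; have := @is_derive1_comp _ f g r _ _ hf hg. Qed.

Lemma derive_eq0_of_ends (f df : R -> R) (a b : R) : a < b ->
  (forall r, a < r < b -> is_derive r 1 f (df r)) ->
  (forall r, a < r < b -> 0 <= df r) ->
  {within `[a, b], continuous f} -> f a = 0 -> f b = 0 ->
  forall r, a < r < b -> df r = 0.
Proof.
move=> ab fd d0 cf fa fb.
have mono x y : a <= x -> x <= y -> y <= b -> f x <= f y.
  apply: ger0_derive1_ndecr => // r; rewrite in_itv /= => rab; have h := fd r rab.
    exact: ex_derive.
  by rewrite derive1E derive_val d0.
have f0 x : a <= x -> x <= b -> f x = 0.
  move=> ax xb; apply/eqP; rewrite eq_le; apply/andP; split.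
    by rewrite -fb mono.
  by rewrite -fa mono.
move=> r rab; have fr := fd r rab.
have -> : df r = 'D_1 f r by rewrite derive_val.
rewrite (@near_eq_derive _ _ _ f (cst 0)) ?derive_cst //.
case/andP: rab => ar rb; near=> x; rewrite f0 //; apply/ltW; near: x.
- exact: lt_nbhsr.
- exact: lt_nbhsl.
Unshelve. all: by end_near. Qed.

(* [bj m] is [2^m * J_m], and [bjd m r] is [r * (bj m)'(r)]. *)
Definition bj m (r : R) := r ^+ m * bes m (r ^+ 2 / 4).
Definition bjd m (r : R) := m%:R * bj m r - r / 2 * bj m.+1 r.

Lemma is_derive_bes_sq m (r : R) :
  is_derive r 1 (fun r => bes m (r ^+ 2 / 4)) (- (r / 2) * bes m.+1 (r ^+ 2 / 4)).
Proof.
have h1 : is_derive r 1 (fun r : R => r ^+ 2 / 4) (r / 2).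
  by apply: is_derive_eq; rewrite /GRing.scale /=; field.
have h2 := is_derive_bes m (r ^+ 2 / 4).
have := @is_derive1_comp _ (bes m) (fun r : R => r ^+ 2 / 4) _ _ _ h2 h1.
by move=> h; apply: is_derive_eq; ring.
Qed.

Lemma is_derive_bj m (r : R) : r != 0 -> is_derive r 1 (bj m) (bjd m r / r).
Proof.
move=> r0; have h := is_derive_bes_sq m r.
apply: (is_derive_eq (derM (derX m r) h)); rewrite /bjd /bj.
by case: m h => [|m] h /=; rewrite ?exprS; field.
Qed.

(** Bessel's equation in self-adjoint form, (r y')' = (m^2/r - r) y. *)
Lemma is_derive_bjd m (r : R) : r != 0 ->
  is_derive r 1 (bjd m) ((m%:R ^+ 2 / r - r) * bj m r).
Proof.
move=> r0; have h2 : is_derive r 1 (fun r : R => r / 2) 2^-1.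
  by apply: is_derive_eq; rewrite /GRing.scale /=; ring.
apply: (is_derive_eq (derB (derZ m%:R (is_derive_bj m r0)) (derM h2 (is_derive_bj m.+1 r0)))).
have := bes_rec m (r ^+ 2 / 4) => /(canRL (addrK _)) E.
rewrite /bjd /bj E !exprS -!natr1; field.
exact: r0.
Qed.

End Sturm.

Section SturmZeros.
Variable R : realType.

Lemma derivable_within (f df : R -> R) (a b : R) :
  (forall r, a <= r <= b -> is_derive r 1 f (df r)) -> {within `[a, b], continuous f}.
Proof.
move=> h; apply: derivable_within_continuous => x; rewrite in_itv /= => /h hx.
exact: ex_derive.
Qed.

Lemma is_derive_continuous (f : R -> R) (r df : R) : is_derive r 1 f df -> {for r, continuous f}.
Proof. by move=> h; apply: differentiable_continuous; apply/derivable1_diffP; exact: ex_derive. Qed.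

Lemma continuous_bes m : continuous (@bes R m).
Proof. by move=> x; apply: is_derive_continuous (is_derive_bes m x). Qed.

Lemma continuous_bj m : continuous (@bj R m).
Proof.
move=> x; apply: is_derive_continuous.
exact: derM (derX m x) (is_derive_bes_sq m x).
Qed.

Lemma continuous_bjd m : continuous (@bjd R m).
Proof.
move=> x; apply: is_derive_continuous.
have h2 : is_derive x 1 (fun r : R => r / 2) 2^-1.
  by apply: is_derive_eq; rewrite /GRing.scale /=; ring.
have h n := derM (derX n x) (is_derive_bes_sq n x).
exact: derB (derZ m%:R (h m)) (derM h2 (h m.+1)).
Qed.

Lemma bj_bjd_neq0 m (r : R) : r != 0 -> bj m r = 0 -> bjd m r = 0 -> False.
Proof.
move=> r0 j0 d0; have b0 : bes m (r ^+ 2 / 4) = 0.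
  by move/eqP: j0; rewrite /bj mulf_eq0 expf_eq0 (negbTE r0) andbF => /eqP.
move: d0; rewrite /bjd j0 mulr0 sub0r => /eqP; rewrite oppr_eq0 !mulf_eq0 (negbTE r0) /=.
rewrite invr_eq0 pnatr_eq0 /= expf_eq0 (negbTE r0) andbF /=.
by rewrite (negbTE (bes_neq0_succ b0)).
Qed.

(* Picone's identity for the Bessel equation: the derivative of
   [bj * bjd - bj^2 * sigma] is a square plus [bj^2] times the second hypothesis. *)
Lemma picone m (sigma sigma1 : R -> R) (a b : R) : 0 <= a -> a < b ->
  (forall r, a <= r <= b -> is_derive r 1 sigma (sigma1 r)) ->
  (forall r, a < r < b -> 0 < m%:R ^+ 2 / r - r - sigma r ^+ 2 / r - sigma1 r) ->
  bj m a * bjd m a - bj m a ^+ 2 * sigma a = 0 ->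
  bj m b * bjd m b - bj m b ^+ 2 * sigma b = 0 -> False.
Proof.
move=> a0 ab ds Gpos fa fb.
pose F r := bj m r * bjd m r - bj m r ^+ 2 * sigma r.
pose dF r := (bjd m r - bj m r * sigma r) ^+ 2 / r +
  bj m r ^+ 2 * (m%:R ^+ 2 / r - r - sigma r ^+ 2 / r - sigma1 r).
have rpos r : a < r < b -> 0 < r by case/andP => ar _; exact: le_lt_trans ar.
have FdF r : a < r < b -> is_derive r 1 F (dF r).
  move=> rab; have r0 : r != 0 by rewrite gt_eqF // rpos.
  have hs : is_derive r 1 sigma (sigma1 r).
    by apply: ds; case/andP: rab => h1 h2; rewrite !ltW.
  have d1 := is_derive_bj m r0; have d2 := is_derive_bjd m r0.
  apply: (is_derive_eq (derB (derM d1 d2) (derM (derM d1 d1) hs))).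
  by rewrite /dF; field.
have dF0 r : a < r < b -> 0 <= dF r.
  move=> rab; rewrite /dF addr_ge0 // ?divr_ge0 ?sqr_ge0 ?(ltW (rpos r rab)) //.
  by rewrite mulr_ge0 ?sqr_ge0 // ltW // Gpos.
have cF : {within `[a, b], continuous F}.
  apply: continuous_in_subspaceT => r; rewrite inE /= in_itv /= => rab.
  apply: cvgB; first by apply: cvgM; [exact: continuous_bj|exact: continuous_bjd].
  apply: cvgM; last exact: is_derive_continuous (ds r rab).
  by apply: cvgM; exact: continuous_bj.
have [r rab] : exists r, a < r < b by exists ((a + b) / 2); apply/andP; split; lra.
have := derive_eq0_of_ends ab FdF dF0 cF fa fb rab.
have r0 := rpos r rab; have G0 := Gpos r rab.
rewrite /dF => /eqP; rewrite paddr_eq0 ?divr_ge0 ?sqr_ge0 ?(ltW r0) //; last first.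
  by rewrite mulr_ge0 ?sqr_ge0 // ltW.
rewrite mulf_eq0 sqrf_eq0 invr_eq0 (gt_eqF r0) orbF mulf_eq0 sqrf_eq0 (gt_eqF G0) orbF.
case/andP => /eqP h1 /eqP h2; apply: (@bj_bjd_neq0 m r) => //; first by rewrite gt_eqF.
by move: h1; rewrite h2 mul0r subr0.
Qed.

(** Picone with [sigma = 0]: the potential [m^2/r - r] is positive below [m], and [m > 0] makes the
    boundary term at 0 vanish. *)
Lemma bj_zero_gt m (r : R) : (0 < m)%N -> 0 < r -> bj m r = 0 -> m%:R < r.
Proof.
move=> m0 r0 jr; rewrite ltNge; apply/negP => rm.
apply: (@picone m (fun=> 0) (fun=> 0) 0 r) => //.
- move=> x /andP[x0 xr]; rewrite expr0n /= mul0r !subr0 subr_gt0 ltr_pdivlMr //.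
  by rewrite -expr2 ltr_pXn2r ?nnegrE ?(ltW x0) // (lt_le_trans xr).
- by rewrite /bj !expr0n gtn_eqF //= !(mul0r, mulr0) subr0.
- by rewrite jr !(mul0r, expr0n, mulr0) subr0.
Qed.

(** At order 0 the function is not 0 at the origin, so [sigma] has to vanish there; [- r^2] does,
    with remainder [r (1 - r^2)]. The crude bound 1 serves [bj_gap_zero]. *)
Lemma bj0_zero_ge (r : R) : 0 < r -> bj 0 r = 0 -> 1 <= r.
Proof.
move=> r0 jr; rewrite leNgt; apply/negP => r1.
apply: (@picone 0 (fun x => - x ^+ 2) (fun x => - (2 * x)) 0 r) => //.
- move=> x _; have := derZ (-1) (derX 2 x).
  under [X in is_derive _ _ X _]eq_fun do rewrite mulN1r.
  by move/is_derive_eq; apply => /=; ring.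
- move=> x /andP[x0 xr]; have x1 : x ^+ 2 < 1 by rewrite expr_lt1 ?(ltW x0) // (lt_trans xr).
  have -> : 0%:R ^+ 2 / x - x - (- x ^+ 2) ^+ 2 / x - - (2 * x) = x * (1 - x ^+ 2).
    by field; rewrite gt_eqF.
  by rewrite mulr_gt0 // subr_gt0.
- by rewrite /bjd mul0r !mul0r subr0 mulr0 expr0n /= oppr0 mulr0 subr0.
- by rewrite jr !(mul0r, expr0n, mulr0) subr0.
Qed.

Lemma is_derive_sinl (k a r : R) : is_derive r 1 (fun x => sin (k * (x - a))) (k * cos (k * (r - a))).
Proof.
have h : is_derive r 1 (fun x : R => k * (x - a)) k.
  by apply: (is_derive_eq (derZ k (derB (is_derive_id r 1) (is_derive_cst a r 1)))); ring.
by apply: (is_derive_eq (derC (is_derive_sin _) h)); rewrite mulrC.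
Qed.

Lemma is_derive_cosl (k a r : R) : is_derive r 1 (fun x => cos (k * (x - a))) (- (k * sin (k * (r - a)))).
Proof.
have h : is_derive r 1 (fun x : R => k * (x - a)) k.
  by apply: (is_derive_eq (derZ k (derB (is_derive_id r 1) (is_derive_cst a r 1)))); ring.
by apply: (is_derive_eq (derC (is_derive_cos _) h)); rewrite mulNr mulrC.
Qed.

(** Here [sigma] is r times the logarithmic derivative of r^(-1/2) sin(k (r - a + d)), and Picone's
    remainder becomes exactly the expression of the last hypothesis. *)
Lemma bj_gap m (k a b : R) : 0 < k -> 0 < a -> a < b -> bj m a = 0 -> bj m b = 0 ->
  (forall r, a < r -> 0 < (m%:R ^+ 2 - 4^-1) / r + (k ^+ 2 - 1) * r) ->
  pi / k <= b - a.
Proof.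
move=> k0 a0 ab ja jb hG; rewrite leNgt; apply/negP => bak.
have kba : k * (b - a) < pi by rewrite mulrC -ltr_pdivlMr.
(* Half of the slack, brought to the scale of [r]: the sine shifted by [d] is positive on all of
   [a, b]. *)
pose d := (pi - k * (b - a)) / 2 / k.
have kd : k * d = (pi - k * (b - a)) / 2 by rewrite /d; field; rewrite gt_eqF.
have d0 : 0 < d by rewrite divr_gt0 // divr_gt0 // subr_gt0.
pose s r := sin (k * (r - (a - d))); pose c r := cos (k * (r - (a - d))).
have s0 r : a <= r <= b -> 0 < s r.
  move=> /andP[ar rb]; apply: sin_gt0_pi; rewrite mulr_gt0 //=; last by lra.
  have : k * (r - (a - d)) <= k * (b - (a - d)) by rewrite ler_pM2l //; lra.
  have -> : k * (b - (a - d)) = k * (b - a) + k * d by ring.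
  rewrite kd => h; apply: (le_lt_trans h); lra.
apply: (@picone m (fun r => k * r * (c r / s r) - 2^-1)
  (fun r => k * (c r / s r) - k ^+ 2 * r / s r ^+ 2) a b (ltW a0) ab).
- move=> r rab; have sr := s0 r rab.
  have ds : is_derive r 1 s (k * c r) by exact: is_derive_sinl.
  have dc : is_derive r 1 c (- (k * s r)) by exact: is_derive_cosl.
  have dk : is_derive r 1 (fun x : R => k * x) k.
    by apply: (is_derive_eq (derZ k (is_derive_id r 1))); rewrite mulr1.
  have sn : s r != 0 by rewrite gt_eqF.
  apply: (is_derive_eq (derB (derM dk (derM dc (derV sn ds))) (is_derive_cst (2^-1 : R) r 1))).
  have cs : c r ^+ 2 = 1 - s r ^+ 2 by rewrite /c cos2sin2.
  transitivity (k * (c r / s r) - k ^+ 2 * r * (s r ^+ 2 + c r ^+ 2) / s r ^+ 2).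
    by field.
  have -> : s r ^+ 2 + c r ^+ 2 = 1 by rewrite cs; ring.
  by rewrite mulr1.
- move=> r rab; have /andP[ar rb] := rab.
  have sr : 0 < s r by apply: s0; rewrite !ltW.
  have r0 : 0 < r by exact: lt_trans ar.
  have := hG r ar.
  have cs : c r ^+ 2 = 1 - s r ^+ 2 by rewrite /c cos2sin2.
  have -> : m%:R ^+ 2 / r - r - (k * r * (c r / s r) - 2^-1) ^+ 2 / r -
      (k * (c r / s r) - k ^+ 2 * r / s r ^+ 2) =
    (m%:R ^+ 2 - 4^-1) / r - r + k ^+ 2 * r * (1 - c r ^+ 2) / s r ^+ 2.
    by field; rewrite !gt_eqF.
  have -> : 1 - c r ^+ 2 = s r ^+ 2 by rewrite cs; ring.
  rewrite mulfK ?expf_neq0 ?gt_eqF //.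
  by move: ((m%:R ^+ 2 - 4^-1) / r) => X; lra.
- by rewrite ja !(mul0r, expr0n, mulr0) subr0.
- by rewrite jb !(mul0r, expr0n, mulr0) subr0.
Qed.

Lemma bj_gap_pos m (a b : R) : (0 < m)%N -> 0 < a -> a < b -> bj m a = 0 -> bj m b = 0 ->
  pi <= b - a.
Proof.
move=> m0 a0 ab ja jb; have := @bj_gap m 1 a b ltr01 a0 ab ja jb; rewrite divr1; apply.
move=> r ar; rewrite expr1n subrr mul0r addr0.
have h : 1 <= m%:R ^+ 2 :> R by rewrite -natrX ler1n expn_gt0 m0.
by apply: divr_gt0; [lra|exact: lt_trans ar].
Qed.

(** At order 0 the frequency exceeds 1, so [bj_gap] does not apply with [k = 1]; [k = 2] dominates
    beyond any positive zero, as those are at least 1. *)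
Lemma bj_gap_zero (a b : R) : 0 < a -> a < b -> bj 0 a = 0 -> bj 0 b = 0 ->
  pi / 2 <= b - a.
Proof.
move=> a0 ab ja jb; apply: (@bj_gap 0) => // r ar.
have a1 := bj0_zero_ge a0 ja.
have r0 : 0 < r by exact: lt_trans ar.
have -> : (0%:R ^+ 2 - 4^-1) / r + (2 ^+ 2 - 1) * r = (12 * r ^+ 2 - 1) / (4 * r).
  by field; rewrite gt_eqF.
rewrite divr_gt0 ?mulr_gt0 // subr_gt0.
have : 1 <= r ^+ 2 by rewrite exprn_ege1 // (le_trans a1) // ltW.
lra.
Qed.

(* Sturm comparison with [sin (k (r - a))], through the logarithmic derivative
   [tau] of [sqrt r * bj m r]. *)
Lemma bj_zero_exists m (k a : R) : 0 < k -> 0 < a ->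
  (forall r, a < r -> k ^+ 2 < 1 - (m%:R ^+ 2 - 4^-1) / r ^+ 2) ->
  exists r, a <= r <= a + pi / k /\ bj m r = 0.
Proof.
move=> k0 a0 hq; apply: contrapT => H.
set b := a + pi / k in H.
have ab : a < b by rewrite /b ltrDl divr_gt0 // pi_gt0.
have jn r : a <= r <= b -> bj m r != 0.
  by move=> rab; apply/eqP => jr; apply: H; exists r.
have rpos r : a <= r <= b -> 0 < r by case/andP => ar _; exact: lt_le_trans ar.
pose s r := sin (k * (r - a)); pose c r := cos (k * (r - a)).
pose tau (r : R) := (bjd m r / bj m r + 2^-1) / r.
pose F r := s r * (k * c r - s r * tau r).
pose dF r := (k * c r - s r * tau r) ^+ 2 +
  (1 - (m%:R ^+ 2 - 4^-1) / r ^+ 2 - k ^+ 2) * s r ^+ 2.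
have FdF r : a <= r <= b -> is_derive r 1 F (dF r).
  move=> rab; have r0 := rpos r rab; have rn : r != 0 by rewrite gt_eqF.
  have jr := jn r rab.
  have ds : is_derive r 1 s (k * c r) by exact: is_derive_sinl.
  have dc : is_derive r 1 c (- (k * s r)) by exact: is_derive_cosl.
  have d1 := is_derive_bj m rn; have d2 := is_derive_bjd m rn.
  have dt := derM (derD (derM d2 (derV jr d1)) (is_derive_cst (2^-1 : R) r 1)) (derV rn (is_derive_id r 1)).
  apply: (is_derive_eq (derM ds (derB (derZ k dc) (derM ds dt)))).
  rewrite /dF /tau /=. by field; rewrite rn jr.
have dF0 r : a < r < b -> 0 <= dF r.
  move=> /andP[ar rb]; rewrite /dF addr_ge0 ?sqr_ge0 // mulr_ge0 ?sqr_ge0 //.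
  by rewrite subr_ge0 ltW // hq.
have cF : {within `[a, b], continuous F} by exact: derivable_within FdF.
have Fa : F a = 0 by rewrite /F /s subrr mulr0 sin0 mul0r.
have Fb : F b = 0.
  rewrite /F /s; have -> : k * (b - a) = pi by rewrite /b; field; rewrite gt_eqF.
  by rewrite sinpi mul0r.
have [r [rab rE]] : exists r, a < r < b /\ k * (r - a) = pi / 2.
  exists ((a + b) / 2); split; first by apply/andP; split; lra.
  by rewrite /b; field; rewrite gt_eqF.
have FdF' x : a < x < b -> is_derive x 1 F (dF x).
  by case/andP => ? ?; apply: FdF; rewrite !ltW.
have := derive_eq0_of_ends ab FdF' dF0 cF Fa Fb rab.
have /andP[ar rb] := rab.
have s0 : 0 < s r.
  apply: sin_gt0_pi; rewrite mulr_gt0 ?subr_gt0 //=.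
  rewrite rE.
  have := pi_gt0 R; lra.
have : 0 < (1 - (m%:R ^+ 2 - 4^-1) / r ^+ 2 - k ^+ 2) * s r ^+ 2.
  by rewrite mulr_gt0 ?exprn_gt0 // subr_gt0 hq.
have := sqr_ge0 (k * c r - s r * tau r).
rewrite /dF; lra.
Qed.

Lemma bes0_unbounded_zeros (a : R) : exists2 t, a < t & bes 0 t = 0 :> R.
Proof.
pose a' := 2 * (`|a| + 1).
have aa : 0 <= `|a| by [].
have a'0 : 0 < a' by rewrite /a'; lra.
have [|r [/andP[ar _] jr]] := @bj_zero_exists 0 1 a' ltr01 a'0.
  move=> r ar; rewrite expr1n expr0n /= sub0r mulNr opprK ltrDl divr_gt0 // exprn_gt0 //.
  exact: lt_trans ar.
exists (r ^+ 2 / 4); last by move: jr; rewrite /bj expr0 mul1r.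
have h : a' ^+ 2 <= r ^+ 2 by apply: lerXn2r => //; rewrite nnegrE ltW // (lt_le_trans a'0).
rewrite ltr_pdivlMr //; apply: lt_le_trans h.
rewrite /a' exprMn; have := ler_norm a; nra.
Qed.

Definition bj_bourget := @bourget R bes0_unbounded_zeros.

End SturmZeros.

Section ZerosCount.
Variable R : realType.

(** Zeros are sorted by their distance to [x] into cells of width [g]. The gap bounds, applied also
    to [x] itself, leave at most one zero per cell and none within [g] of [x]; zeros are at least
    [m], so [n] cells suffice. For [m > 0], [g = pi] and [z i <= x] give [pi sum z <= (x - m) x].
    For [m = 0] the cells are half as wide, so the finer bound [z i <= x - (i+1) g] is summed and
    [(x - pi n / 2)^2 >= 0] concludes. *)
Lemma bj_zeros_cover m (x : R) : 0 < x -> bj m x = 0 ->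
  exists (n : nat) (z : 'I_n -> R), [/\ forall i, 0 <= z i,
    forall r, 0 < r < x -> bj m r = 0 -> exists i, r = z i &
    m%:R * x + pi * \sum_i z i <= x ^+ 2].
Proof.
move=> x0 jx; have pi0 := pi_gt0 R.
pose g : R := if m is 0%N then pi / 2 else pi.
have g0 : 0 < g by rewrite /g; case: (m) => [|_] //; rewrite divr_gt0.
have gap a b : 0 < a -> a < b -> bj m a = 0 -> bj m b = 0 -> g <= b - a.
  rewrite /g; case: (m) => [|m'] a0 ab ja jb; first exact: bj_gap_zero.
  exact: (@bj_gap_pos _ m'.+1).
have mlt r : 0 < r -> bj m r = 0 -> m%:R <= r.
  case: (m) => [|m'] r0 jr; first exact: ltW.
  by apply/ltW/(@bj_zero_gt _ m'.+1).
pose n := Num.truncn ((x - m%:R) / g).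
have mx : m%:R <= x by exact: mlt.
have ng : n%:R * g <= x - m%:R.
  rewrite -ler_pdivlMr //; have h : 0 <= (x - m%:R) / g by rewrite divr_ge0 ?subr_ge0 // ltW.
  by have /andP[] := truncn_itv h.
pose Z (i : 'I_n) : set R := [set r | [/\ 0 < r < x, bj m r = 0 & i.+1%:R * g <= x - r < i.+2%:R * g]].
(* An empty cell gets the value 0, which adds nothing to the sum. *)
pose z i := xget 0 (Z i).
have zP i : z i = 0 \/ Z i (z i).
  by rewrite /z; case: xgetP => [y -> Zy|_]; [right|left].
exists n, z; split.
- by move=> i; have [->//|[/andP[/ltW]]] := zP i.
- move=> r /andP[r0 rx] jr.
  have xr0 : 0 <= (x - r) / g by rewrite divr_ge0 ?subr_ge0 // ltW.
  have /andP[h1 h2] := truncn_itv xr0; set k := Num.truncn _ in h1 h2.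
  rewrite ler_pdivlMr // in h1; rewrite ltr_pdivrMr // in h2.
  have k0 : (0 < k)%N.
    have := gap r x r0 rx jr jx; case: k h1 h2 => // _; rewrite mul1r => h2.
    by rewrite leNgt h2.
  have kn : (k <= n)%N.
    rewrite /n truncn_ge_nat ?divr_ge0 ?subr_ge0 ?(ltW g0) // ler_pdivlMr //.
    by rewrite (le_trans h1) // lerB // mlt.
  have kn' : (k.-1 < n)%N by rewrite prednK.
  exists (Ordinal kn').
  have Zr : Z (Ordinal kn') r by split; rewrite /= ?r0 ?prednK // h1.
  rewrite /z; case: xgetP => [y _ [/andP[y0 yx] jy /andP[y1 y2]]|/(_ r)]; last by case.
  rewrite /= prednK // in y1 y2.
  have kS : k.+1%:R * g = k%:R * g + g by rewrite -natr1 mulrDl mul1r.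
  rewrite kS in h2 y2.
  case: (ltgtP r y) => // ry; first by have := gap r y r0 ry jr jy; lra.
  by have := gap y r y0 ry jy jr; lra.
- have zle (i : 'I_n) : z i <= x - i.+1%:R * g.
    have [->|[_ _ /andP[h _]]] := zP i; last by lra.
    have : i.+1%:R * g <= n%:R * g by rewrite ler_wpM2r ?(ltW g0) // ler_nat.
    have : 0 <= m%:R :> R by [].
    lra.
  have [m0|m0] := posnP m; last first.
    have gpi : g = pi by rewrite /g; case: (m) m0.
    have : \sum_i z i <= \sum_(i < n) x.
      by apply: ler_sum => i _; rewrite (le_trans (zle i)) // gerBl mulr_ge0 // ltW //.
    rewrite sumr_const card_ord -[x *+ n]mulr_natl => S; rewrite gpi in ng.
    have : pi * \sum_i z i <= pi * (n%:R * x).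
      by rewrite ler_pM2l.
    have : n%:R * pi * x <= (x - m%:R) * x by rewrite ler_pM2r.
    lra.
  have gpi : g = pi / 2 by rewrite /g m0.
  have S : \sum_i z i <= n%:R * x - g * n%:R * (n%:R + 1) / 2.
    apply: (le_trans (ler_sum _ (fun i _ => zle i))).
    rewrite sumrB sumr_const card_ord -[x *+ n]mulr_natl lerB // -mulr_suml.
    rewrite le_eqVlt; apply/orP; left; apply/eqP.
    elim: (n) => [|k IH]; first by rewrite big_ord0; ring.
    have kS : k.+1%:R = k%:R + 1 :> R by rewrite natr1.
    by rewrite big_ord_recr mulrDl /= -IH kS; field.
  rewrite m0 mul0r add0r.
  have : pi * \sum_i z i <= pi * (n%:R * x - g * n%:R * (n%:R + 1) / 2) by rewrite ler_pM2l.
  move=> h; apply: (le_trans h); rewrite gpi.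
  have n0 : 0 <= n%:R :> R by [].
  move: (n%:R : R) n0 => N N0.
  have : 0 <= pi * pi * N by rewrite !mulr_ge0 // ltW.
  have := sqr_ge0 (x - pi / 2 * N); rewrite sqrrB expr2.
  nra.
Qed.

(** The infimum is over the zeros of [bes m (r^2/4)], which is [1/m!] at 0, whereas [bj m] vanishes
    there for [m > 0]; so it is positive, and a zero by continuity. Some zero exists because the
    frequency exceeds 1/2 beyond [2 (m+1)]. *)
Lemma bj_first_zero m : exists j : R, [/\ 0 < j, bj m j = 0 &
  forall r, 0 < r < j -> bj m r != 0].
Proof.
have [r1 r10 jr1] : exists2 r1 : R, 0 < r1 & bj m r1 = 0.
  pose a : R := 2 * (m%:R + 1).
  have m0 : 0 <= m%:R :> R by [].
  have a0 : 0 < a by rewrite /a; lra.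
  have [||r [/andP[ar _] jr]] := @bj_zero_exists R m 2^-1 a _ a0; first by rewrite invr_gt0.
    move=> r ar; have r0 : 0 < r by exact: lt_trans ar.
    have : a ^+ 2 <= r ^+ 2 by apply: lerXn2r; rewrite ?nnegrE ltW.
    rewrite ltrBrDr -ltrBrDl ltr_pdivrMr ?exprn_gt0 // /a => h.
    have : 4 * (m%:R + 1) ^+ 2 <= r ^+ 2 by rewrite (le_trans _ h) // exprMn; lra.
    have := sqr_ge0 (m%:R : R); nra.
  by exists r => //; exact: lt_le_trans ar.
pose Z : set R := [set r | 0 < r /\ bes m (r ^+ 2 / 4) = 0].
have bz r : 0 < r -> bj m r = 0 -> Z r.
  by move=> r0 /eqP; rewrite /bj mulf_eq0 expf_eq0 (gt_eqF r0) andbF => /eqP.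
have Z1 : Z r1 by exact: bz.
have hZ : has_inf Z by split; [exists r1|exists 0 => r [/ltW]].
set j := inf Z.
have j0 : 0 <= j by apply: lb_le_inf; [exists r1|move=> r [/ltW]].
have cb : continuous (fun r : R => bes m (r ^+ 2 / 4)).
  by move=> x; exact: is_derive_continuous (is_derive_bes_sq m x).
have bj0 : bes m (j ^+ 2 / 4) = 0.
  apply/eqP/negPn/negP => bn.
  have : \forall r \near j, bes m (r ^+ 2 / 4) != 0 by move: (cb j) => /cvgr_neq0; apply.
  case/nbhs_ballP => e /= e0 he.
  have [r Zr rj] := inf_adherent e0 hZ.
  have jr : j <= r by apply: ge_inf => //; exact: hZ.2.
  have := he r; rewrite /ball /= => /(_ _) /negP; apply; last by apply/eqP; exact: Zr.2.
  by rewrite distrC ger0_norm ?subr_ge0 // ltrBlDl.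
have jn0 : j != 0.
  apply/eqP => jE; move: bj0; rewrite jE expr0n mul0r bes0 => /eqP.
  by rewrite invr_eq0 pnatr_eq0 eqn0Ngt fact_gt0.
have jpos : 0 < j by rewrite lt_neqAle eq_sym jn0.
exists j; split => //; first by rewrite /bj bj0 mulr0.
move=> r /andP[r0 rj]; apply/eqP => jr.
have : j <= r by apply: ge_inf; [exact: hZ.2|exact: bz].
by rewrite leNgt rj.
Qed.

(** Beyond [m (1 + e/2)] the frequency exceeds a constant [k] independent of [m], so a zero follows
    within [pi / k], which is below [m e / 2] for large [m]. *)
Lemma bj_first_zero_le (e : R) : 0 < e -> exists M, forall m, (M <= m)%N ->
  forall j, 0 < j -> (forall r, 0 < r < j -> bj m r != 0) -> j <= m%:R * (1 + e).
Proof.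
move=> e0; pose d := e / 2; have d0 : 0 < d by rewrite divr_gt0.
pose q : R := 1 - (1 + d)^-1 ^+ 2.
have q0 : 0 < q.
  by rewrite subr_gt0 expr_lt1 ?invr_ge0 ?addr_ge0 ?(ltW d0) // invf_lt1 ?ltrDl // addr_gt0.
pose k := Num.sqrt q; have k0 : 0 < k by rewrite sqrtr_gt0.
have k2 : k ^+ 2 = q by rewrite sqr_sqrtr // ltW.
exists (Num.truncn (pi / k / d)).+1 => m hm j j0 jn; rewrite leNgt; apply/negP => hj.
have m0 : 0 < m%:R :> R by rewrite ltr0n (leq_trans _ hm).
pose a := m%:R * (1 + d).
have a0 : 0 < a by rewrite mulr_gt0 // addr_gt0.
have [|r [/andP[ar rb] jr]] := @bj_zero_exists R m k a k0 a0.
  move=> r ar; have r0 : 0 < r by exact: lt_trans ar.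
  rewrite k2 /q ltrD2l ltrN2 -exprVn.
  apply: (@lt_le_trans _ _ (m%:R ^+ 2 * r^-1 ^+ 2)).
    by rewrite ltr_pM2r ?exprn_gt0 ?invr_gt0 // gtrDl oppr_lt0 invr_gt0.
  rewrite -exprMn; apply: lerXn2r; rewrite ?nnegrE ?invr_ge0 ?mulr_ge0 ?addr_ge0 ?(ltW d0) ?(ltW r0) //.
    by rewrite invr_ge0 ltW.
  rewrite ler_pdivrMr // mulrC ler_pdivlMr ?addr_gt0 // ltW //.
have : pi / k < m%:R * d.
  rewrite -ltr_pdivrMr //; have h : 0 <= pi / k / d by rewrite divr_ge0 ?(ltW d0) // divr_ge0 ?pi_ge0 // ltW.
  have /andP[_ h2] := truncn_itv h; apply: (lt_le_trans h2); by rewrite ler_nat.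
move=> h; have : r < j.
  apply: (le_lt_trans rb); apply: lt_trans hj.
  have -> : m%:R * (1 + e) = a + m%:R * d by rewrite /a /d; field.
  by rewrite ltrD2l.
by move=> rj; have := jn r; rewrite (lt_le_trans a0 ar) rj jr eqxx => /(_ isT).
Qed.

End ZerosCount.

(** * Length of curves and of rays *)

Section Hausdorff.
Variable R : realType.
Implicit Types (A U : set (R * R)) (x y : R * R).

Lemma ediam_ge0 A : (0 <= ediam A)%E.
Proof. by apply: ereal_sup_ubound; left. Qed.

Lemma ediam_le A (d : R) : 0 <= d -> (forall x y, A x -> A y -> edist x y <= d) ->
  (ediam A <= d%:E)%E.
Proof.
move=> d0 Ad; apply: ge_ereal_sup => _ [->|[[x y] /= [Ax Ay] <-]]; rewrite lee_fin //.
exact: Ad.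
Qed.

Lemma le_ediam A x y : A x -> A y -> ((edist x y)%:E <= ediam A)%E.
Proof. by move=> Ax Ay; apply: ereal_sup_ubound; right; exists (x, y). Qed.

(** The finite cover is numbered by [enum_rank] and continued by empty sets, whose diameter is 0 by
    the convention in [ediam]. *)
Lemma hausdorff1_delta_finite (I : finType) (V : I -> set (R * R)) (d : I -> R)
    (delta : R) A : 0 <= delta ->
  (forall i, 0 <= d i <= delta) -> (forall i x y, V i x -> V i y -> edist x y <= d i) ->
  A `<=` \bigcup_i V i -> (hausdorff1_delta delta A <= (\sum_i d i)%:E)%E.
Proof.
move=> delta0 d0 Vd AV.
pose U k := [set x | exists2 i : I, (enum_rank i = k :> nat) & V i x].
pose e k : R := \sum_(i | enum_rank i == k :> nat) d i.
have dge i : 0 <= d i by case/andP: (d0 i).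
have e_ge0 k : 0 <= e k by apply: sumr_ge0 => i _.
have dE i : e (enum_rank i) = d i.
  by rewrite /e (big_pred1 i) // => j; apply/eqP/eqP => [/val_inj/enum_rank_inj|->].
have Ue k : (ediam (U k) <= (e k)%:E)%E.
  apply: ediam_le => // x y [i ik Vx] [j jk Vy].
  have ij : i = j by apply/enum_rank_inj/val_inj; rewrite /= ik jk.
  by rewrite -ik dE; apply: Vd => //; rewrite ij.
apply: (@le_trans _ _ (\sum_(0 <= k <oo) ediam (U k))%E).
  apply: ereal_inf_lbound; exists U => //; split.
    by move=> x /AV [i _ Vx]; exists (enum_rank i) => //; exists i.
  move=> k; have [[i ik]|nk] := pselect (exists i : I, enum_rank i = k :> nat).
    by rewrite (le_trans (Ue k)) // -ik dE lee_fin; case/andP: (d0 i).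
  by apply: ediam_le => // x y [j jk]; exfalso; apply: nk; exists j.
apply: lime_le.
  by apply: is_cvg_nneseries => k _ _; exact: ediam_ge0.
apply: nearW => n; apply: (@le_trans _ _ (\sum_(0 <= k < n) (e k)%:E)%E).
  by apply: lee_sum => k _; exact: Ue.
rewrite sumEFin lee_fin /e.
under eq_bigr do rewrite big_mkcond.
rewrite exchange_big /=; apply: ler_sum => i _.
have [ni|ni] := ltnP (enum_rank i) n.
  rewrite (bigD1_seq (enum_rank i : nat)) ?mem_index_iota ?iota_uniq ?eqxx //=.
  by rewrite big1 ?addr0 // => k; rewrite eq_sym => /negbTE ->.
rewrite big_nat big1 ?dge // => k kn; case: eqP => // ik; move: kn.
by rewrite -ik ltnNge ni andbF.
Qed.

Lemma hausdorff1_le_curves n (g : 'I_n -> R -> R * R) (L : 'I_n -> R) A :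
  (forall i, 0 <= L i) ->
  (forall i s t, 0 <= s <= 1 -> 0 <= t <= 1 -> edist (g i s) (g i t) <= L i * `|s - t|) ->
  (forall x, A x -> exists i t, 0 <= t <= 1 /\ x = g i t) ->
  (hausdorff1 A <= (\sum_i L i)%:E)%E.
Proof.
move=> L0 Lip AG; apply: ge_ereal_sup => _ [delta /= d0 <-].
(* More pieces than any [L i / delta]: each piece has diameter at most [delta], and the total
   remains the sum of the [L i]. *)
pose N := (Num.truncn (\sum_i L i / delta)).+1.
have N0 : 0 < N%:R :> R by rewrite ltr0n.
have LN i : L i / N%:R <= delta.
  rewrite ler_pdivrMr // mulrC -ler_pdivrMr //.
  have h : 0 <= \sum_i L i / delta by apply: sumr_ge0 => j _; rewrite divr_ge0 // ltW.
  have /andP[_ h2] := truncn_itv h; apply/ltW; apply: le_lt_trans h2.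
  by rewrite (bigD1 i) //= lerDl sumr_ge0 // => j _; rewrite divr_ge0 // ltW.
pose V (p : 'I_n * 'I_N) : set (R * R) :=
  [set x | exists t, [/\ p.2%:R / N%:R <= t <= p.2.+1%:R / N%:R, 0 <= t <= 1 & x = g p.1 t]].
have -> : (\sum_i L i = \sum_(p : 'I_n * 'I_N) L p.1 / N%:R).
  rewrite -(pair_big xpredT xpredT (fun i (_ : 'I_N) => L i / N%:R)) /=.
  apply: eq_bigr => i _; rewrite sumr_const card_ord -[_ *+ N]mulr_natr divfK //.
  by rewrite gt_eqF.
apply: (@hausdorff1_delta_finite _ V); first exact: ltW.
- by move=> p; rewrite LN divr_ge0 // ltW.
- move=> p x y [s [/andP[s1 s2] s01 ->]] [t [/andP[t1 t2] t01 ->]].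
  rewrite (le_trans (Lip _ _ _ s01 t01)) // ler_wpM2l //.
  have : p.2.+1%:R / N%:R = p.2%:R / N%:R + N%:R^-1 :> R by rewrite -natr1 mulrDl mul1r.
  rewrite ler_norml; lra.
- move=> x /AG [i [t [t01 ->]]]; have /andP[t0 t1] := t01.
  pose q := Num.truncn (t * N%:R).
  have tN : 0 <= t * N%:R by rewrite mulr_ge0 // ltW.
  have /andP[q1 q2] := truncn_itv tN; rewrite -/q in q1 q2.
  have [qN|qN] := ltnP q N.
    exists (i, Ordinal qN) => //; exists t; split => //=.
    by rewrite ler_pdivrMr // ler_pdivlMr // q1 ltW.
  have t1' : t = 1.
    apply/eqP; rewrite eq_le t1 /= -(ler_pM2r N0) mul1r (le_trans _ q1) // ler_nat //.
  exists (i, ord_max) => //; exists t; split => //=.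
  by rewrite t1' ler_pdivrMr // mul1r ler_nat leqnSn /= divff // gt_eqF.
Qed.

(* Rays [r e_i] are unfolded to the disjoint intervals [i rho + r], which sets
   too small to meet two rays cover isometrically. *)
Lemma hausdorff1_ge_rays n (e : 'I_n -> R * R) (rho : R) A : 0 < rho ->
  (forall i, (e i).1 ^+ 2 + (e i).2 ^+ 2 = 1) ->
  (forall i j, i != j -> (e i).1 * (e j).1 + (e i).2 * (e j).2 < 1) ->
  (forall i r, 0 < r < rho -> A (r * (e i).1, r * (e i).2)) ->
  ((n%:R * rho)%:E <= hausdorff1 A)%E.
Proof.
move=> rho0 e1 e_neq Ae.
(* Near the origin a small set can meet several rays, so a disc of radius [eps] is left out and
   [eps] tends to 0. *)
suff H (eps : R) : 0 < eps < rho -> ((n%:R * (rho - eps))%:E <= hausdorff1 A)%E.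
  apply/lee_addgt0Pr => d d0.
  pose eps := Num.min (rho / 2) (d / n.+1%:R).
  have n0 : 0 < n.+1%:R :> R by rewrite ltr0n.
  have eps0 : 0 < eps by rewrite lt_min !divr_gt0.
  have epsr : eps < rho by rewrite gt_min ltr_pdivrMr // ltr_pMr // ltr1n.
  have := H eps; rewrite eps0 epsr => /(_ isT) h.
  apply: (@le_trans _ _ ((n%:R * (rho - eps))%:E + d%:E)%E); last by rewrite leeD2r.
  rewrite -EFinD lee_fin.
  have : n%:R * eps <= d.
    apply: (@le_trans _ _ (n.+1%:R * eps)); first by rewrite ler_pM2r // ler_nat.
    by rewrite mulrC -ler_pdivlMr // ge_min lexx orbT.
  by rewrite mulrBr; lra.
case/andP => eps0 epsr.
(* A bound below 1 for the cosines between distinct rays. Outside radius [eps], two rays are at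
   squared distance at least [2 eps^2 (1 - c)], more than [delta^2]. *)
pose c : R := \big[Order.max/0]_(p : 'I_n * 'I_n | p.1 != p.2)
  ((e p.1).1 * (e p.2).1 + (e p.1).2 * (e p.2).2).
have c1 : c < 1 by apply/bigmax_ltP; split => // -[i j] /= /e_neq.
pose delta := Num.sqrt (eps ^+ 2 * (1 - c)).
have dd : 0 < eps ^+ 2 * (1 - c) by rewrite mulr_gt0 ?exprn_gt0 // subr_gt0.
have delta0 : 0 < delta by rewrite sqrtr_gt0.
have far i j r s : i != j -> eps <= r -> eps <= s ->
    delta < edist (r * (e i).1, r * (e i).2) (s * (e j).1, s * (e j).2).
  move=> ij er es.
  have pc : (e i).1 * (e j).1 + (e i).2 * (e j).2 <= c.
    exact: (@le_bigmax_cond _ _ _ _ (i, j) (fun p => p.1 != p.2) (fun p : 'I_n * 'I_n => (e p.1).1 * (e p.2).1 + (e p.1).2 * (e p.2).2)).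
  have E : (r * (e i).1 - s * (e j).1) ^+ 2 + (r * (e i).2 - s * (e j).2) ^+ 2 =
      (r - s) ^+ 2 + 2 * (r * s) * (1 - ((e i).1 * (e j).1 + (e i).2 * (e j).2)).
    have h1 := e1 i; have h2 := e1 j.
    transitivity (r ^+ 2 * ((e i).1 ^+ 2 + (e i).2 ^+ 2) + s ^+ 2 * ((e j).1 ^+ 2 + (e j).2 ^+ 2) -
        2 * (r * s) * ((e i).1 * (e j).1 + (e i).2 * (e j).2)); first by ring.
    by rewrite h1 h2; ring.
  have rs : eps ^+ 2 <= r * s by rewrite expr2 ler_pM // ltW.
  have lt2 : eps ^+ 2 * (1 - c) <
      (r * (e i).1 - s * (e j).1) ^+ 2 + (r * (e i).2 - s * (e j).2) ^+ 2.
    rewrite E; apply: (@lt_le_trans _ _ (2 * (eps ^+ 2 * (1 - c)))); first by lra.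
    have h : 2 * (eps ^+ 2 * (1 - c)) <= 2 * (r * s) * (1 - ((e i).1 * (e j).1 + (e i).2 * (e j).2)).
      rewrite -mulrA ler_pM2l //; apply: ler_pM => //; rewrite ?sqr_ge0 //; lra.
    by have := sqr_ge0 (r - s); lra.
  by rewrite ltr_sqrt // (lt_trans dd).
apply: (@le_trans _ _ (hausdorff1_delta delta A)); last first.
  by apply: ereal_sup_ubound; exists delta.
apply: le_ereal_inf_tmp => _ [U [AU Ud] <-].
pose V k := [set v | exists (i : 'I_n) r, [/\ eps <= r < rho, v = i%:R * rho + r &
  U k (r * (e i).1, r * (e i).2)]].
have Vd k v w : V k v -> V k w -> `|v - w| <= fine (ediam (U k)).
  move=> [i [r [/andP[er rr] -> Ui]]] [j [s [/andP[es sr] -> Uj]]].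
  have dfin : ediam (U k) \is a fin_num.
    by rewrite ge0_fin_numE ?ediam_ge0 // (le_lt_trans (Ud k)) // ltry.
  have le_d : edist (r * (e i).1, r * (e i).2) (s * (e j).1, s * (e j).2) <= fine (ediam (U k)).
    by rewrite -lee_fin fineK // le_ediam.
  have ij : i = j.
    apply/eqP/negPn/negP => ij; have := far i j r s ij er es; apply/negP; rewrite -leNgt.
    by rewrite (le_trans le_d) // -lee_fin fineK.
  move: le_d; rewrite -ij; apply: le_trans; rewrite /edist /=.
  have -> : (r * (e i).1 - s * (e i).1) ^+ 2 + (r * (e i).2 - s * (e i).2) ^+ 2 =
     (r - s) ^+ 2 * ((e i).1 ^+ 2 + (e i).2 ^+ 2) by ring.
  rewrite e1 mulr1 sqrtr_sqr.
  by have -> : i%:R * rho + r - (i%:R * rho + s) = r - s by ring.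
(* The closed interval spanned by [V k] is measurable and no longer than the diameter of [U k]. *)
pose J k : set R := if pselect (V k !=set0) then `[inf (V k), sup (V k)]%classic else set0.
have VJ k : V k `<=` J k.
  move=> v Vv; rewrite /J; case: pselect => [V0|]; last by case; exists v.
  have hu : has_ubound (V k).
    exists (v + fine (ediam (U k))) => w Vw; have := Vd k w v Vw Vv; rewrite ler_norml; lra.
  have hl : has_lbound (V k).
    exists (v - fine (ediam (U k))) => w Vw; have := Vd k v w Vv Vw; rewrite ler_norml; lra.
  by rewrite /= in_itv /= ge_inf // sup_ubound.
have mJ k : measurable (J k) by rewrite /J; case: pselect => ?; [exact: measurable_itv|exact: measurable0].
have muJ k : (lebesgue_measure (J k) <= ediam (U k))%E.
  rewrite /J; case: pselect => [Vn|?]; last by rewrite measure0 ediam_ge0.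
  have [v Vv] := Vn.
  rewrite lebesgue_measure_itv /=; case: ifP => [_|_]; last exact: ediam_ge0.
  have dfin : ediam (U k) \is a fin_num.
    by rewrite ge0_fin_numE ?ediam_ge0 // (le_lt_trans (Ud k)) // ltry.
  rewrite -(fineK dfin) -EFinB lee_fin lerBlDr.
  apply: ge_sup; first by exists v.
  move=> w Vw; rewrite -lerBlDl; apply: lb_le_inf; first by exists v.
  by move=> z Vz; have := Vd k w z Vw Vz; rewrite ler_norml; lra.
pose D i : set R := `[i%:R * rho + eps, i%:R * rho + rho[%classic.
have mD i : measurable (D i) by exact: measurable_itv.
have tD : trivIset [set: nat] D.
  apply/trivIsetP => i j _ _ ij; rewrite -subset0 => x [] /=.
  rewrite /D /= !in_itv /= => /andP[i1 i2] /andP[j1 j2].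
  wlog ltij : i j ij i1 i2 j1 j2 / (i < j)%N.
    by move=> H; case: (ltngtP i j) ij => // h _; [apply: (H i j)|apply: (H j i)]; rewrite ?ltn_eqF ?gtn_eqF.
  have : (i.+1)%:R * rho <= j%:R * rho by rewrite ler_pM2r // ler_nat.
  rewrite -natr1; lra.
have DJ : \big[setU/set0]_(i < n) D i `<=` \bigcup_k J k.
  move=> x; rewrite -bigcup_mkord => -[i /= ni]; rewrite /D /= in_itv /= => /andP[x1 x2].
  have r0 : 0 < x - i%:R * rho < rho by apply/andP; split; lra.
  have [k _ Uk] := AU _ (Ae (Ordinal ni) _ r0).
  exists k => //; apply: VJ; exists (Ordinal ni), (x - i%:R * rho); split => //=.
  - by apply/andP; split; lra.
  - by rewrite addrC subrK.
have -> : (n%:R * (rho - eps))%:E = lebesgue_measure (\big[setU/set0]_(i < n) D i).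
  rewrite measure_bigsetU // (eq_bigr (fun=> (rho - eps)%:E)); last first.
    move=> i _; apply: (etrans (lebesgue_measure_itv `[i%:R * rho + eps, i%:R * rho + rho[)).
    by rewrite /= lte_fin ltrD2l epsr -EFinB; congr (_%:E); ring.
  by rewrite sumEFin sumr_const card_ord mulr_natl.
have mDn : measurable (\big[setU/set0]_(i < n) D i) by exact: bigsetU_measurable.
have := @measure_sigma_subadditive _ _ _ lebesgue_measure _ _ mJ mDn DJ.
move=> h; apply: (le_trans h).
by apply: lee_nneseries => // k _; exact: muJ.
Qed.

End Hausdorff.

(** * Separation of variables *)

Section ChainRule.
Variable R : realType.
Implicit Types (f : R * R -> R) (z : R * R).

Lemma cvg_pairR (T : Type) (F : set_system T) {FF : Filter F} (f g : T -> R) (a b : R) :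
  f x @[x --> F] --> a -> g x @[x --> F] --> b -> (f x, g x) @[x --> F] --> (a, b).
Proof. by move=> ha hb; apply: (@cvg_pair _ _ _ F (nbhs a) (nbhs b) _ _ _ f g ha hb). Qed.

Lemma dir_x_shift (h : R) z : h *: @dir_x R + z = (h + z.1, z.2).
Proof.
case: z => a b; rewrite -[LHS]/(h *: (1 : R) + a, h *: (0 : R) + b) scaler0 add0r.
by rewrite [h *: 1]mulr1.
Qed.

Lemma dir_y_shift (h : R) z : h *: @dir_y R + z = (z.1, h + z.2).
Proof.
case: z => a b; rewrite -[LHS]/(h *: (0 : R) + a, h *: (1 : R) + b) scaler0 add0r.
by rewrite [h *: 1]mulr1.
Qed.

Lemma is_derive_slice_x f z (df : R) : is_derive z dir_x f df <-> is_derive z.1 1 (fun s => f (s, z.2)) df.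
Proof.
have E : (fun h : R => h^-1 *: (((f \o shift z) (h *: @dir_x R)) - f z)) =
    (fun h : R => h^-1 *: ((((fun s => f (s, z.2)) \o shift z.1) (h *: (1 : R))) - f (z.1, z.2))).
  apply/funext => h; rewrite /= dir_x_shift -surjective_pairing.
  by rewrite [h *: 1]mulr1.
by split=> -[h1 h2]; split; move: h1 h2; rewrite /derivable /derive E.
Qed.

Lemma is_derive_slice_y f z (df : R) : is_derive z dir_y f df <-> is_derive z.2 1 (fun s => f (z.1, s)) df.
Proof.
have E : (fun h : R => h^-1 *: (((f \o shift z) (h *: @dir_y R)) - f z)) =
    (fun h : R => h^-1 *: ((((fun s => f (z.1, s)) \o shift z.2) (h *: (1 : R))) - f (z.1, z.2))).
  apply/funext => h; rewrite /= dir_y_shift -surjective_pairing.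
  by rewrite [h *: 1]mulr1.
by split=> -[h1 h2]; split; move: h1 h2; rewrite /derivable /derive E.
Qed.

Lemma mvt_between (g : R -> R) (dg : R -> R) (a b : R) :
  (forall s, `|s - a| <= `|b - a| -> is_derive s 1 g (dg s)) ->
  exists2 c, `|c - a| <= `|b - a| & g b - g a = dg c * (b - a).
Proof.
move=> d; have cont s t : (forall r, s <= r <= t -> `|r - a| <= `|b - a|) ->
    {within `[s, t], continuous g}.
  move=> h; apply: derivable_within_continuous => r; rewrite in_itv /= => /h /d hr.
  exact: ex_derive.
have [ab|ab] := leP a b.
  have H r : a <= r <= b -> `|r - a| <= `|b - a|.
    by move=> /andP[ar rb]; rewrite !ger0_norm ?subr_ge0 // lerB.
  have [||c cab e] := @MVT_segment R g dg a b ab.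
  - by move=> r /subset_itv_oo_cc; rewrite in_itv /= => /H /d.
  - exact: cont.
  - by exists c => //; apply: H; move: cab; rewrite in_itv.
have H r : b <= r <= a -> `|r - a| <= `|b - a|.
  move=> /andP[ar rb]; rewrite !ler0_norm ?subr_le0 //; last exact: ltW.
  by rewrite lerN2 lerB.
have [||c cab e] := @MVT_segment R g dg b a (ltW ab).
- by move=> r /subset_itv_oo_cc; rewrite in_itv /= => /H /d.
- exact: cont.
- exists c; first by apply: H; move: cab; rewrite in_itv.
  by rewrite -opprB e -mulrN opprB.
Qed.

(** The increment is split along two sides of a coordinate rectangle, with the mean value theorem on
    each. The intermediate points are chosen for all [s] at once, which turns the convergence of the
    partial derivatives there into an ordinary limit. *)
Lemma chain_rule f (p q : R -> R) (t dp dq : R) :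
  (\forall z \near (p t, q t), derivable f z dir_x /\ derivable f z dir_y) ->
  {for (p t, q t), continuous ('D_dir_x f)} -> {for (p t, q t), continuous ('D_dir_y f)} ->
  is_derive t 1 p dp -> is_derive t 1 q dq ->
  is_derive t 1 (fun s => f (p s, q s)) ('D_dir_x f (p t, q t) * dp + 'D_dir_y f (p t, q t) * dq).
Proof.
move=> /nbhs_ballP [e /= e0 he] cx cy hp hq.
have cp : {for t, continuous p} by exact: is_derive_continuous hp.
have cq : {for t, continuous q} by exact: is_derive_continuous hq.
have dx z : ball (p t, q t) e z -> is_derive z.1 1 (fun s => f (s, z.2)) ('D_dir_x f z).
  by move=> /he [h _]; apply/is_derive_slice_x; exact: derivableP.
have dy z : ball (p t, q t) e z -> is_derive z.2 1 (fun s => f (z.1, s)) ('D_dir_y f z).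
  by move=> /he [_ h]; apply/is_derive_slice_y; exact: derivableP.
pose P s (c : R * R) := [/\ `|c.1 - p t| <= `|p s - p t|, `|c.2 - q t| <= `|q s - q t| &
  f (p s, q s) - f (p t, q t) =
   'D_dir_x f (c.1, q s) * (p s - p t) + 'D_dir_y f (p t, c.2) * (q s - q t)].
have Pex : forall s, exists c, (`|p s - p t| < e -> `|q s - q t| < e -> P s c).
  move=> s; have [ps|] := ltP `|p s - p t| e; last by exists (0, 0).
  have [qs|] := ltP `|q s - q t| e; last by exists (0, 0).
  have [r|c1 c1h e1] := @mvt_between (fun r => f (r, q s)) (fun r => 'D_dir_x f (r, q s)) (p t) (p s).
    move=> rh; apply: (dx (r, q s)); split; rewrite /ball /= distrC ?(le_lt_trans rh) //.
  have [r|c2 c2h e2] := @mvt_between (fun r => f (p t, r)) (fun r => 'D_dir_y f (p t, r)) (q t) (q s).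
    move=> rh; apply: (dy (p t, r)); split; rewrite /ball /= ?subrr ?normr0 // distrC (le_lt_trans rh) //.
  exists (c1, c2) => _ _; split => //.
  rewrite -e1 -e2; ring.
have [c hc] := choice Pex.
have near_P : \forall s \near t, P s (c s).
  near=> s; apply: hc; near: s.
    by move/cvgrPdist_lt : cp => /(_ e e0); apply: filterS => s; rewrite distrC.
  by move/cvgrPdist_lt : cq => /(_ e e0); apply: filterS => s; rewrite distrC.
have cc1 : (c s).1 @[s --> t] --> p t.
  apply/cvgrPdist_le => d d0; near=> s.
  have [+ _ _] : P s (c s) by near: s.
  rewrite distrC => /le_trans; apply; near: s.
  by move/cvgrPdist_le : cp => /(_ d d0); apply: filterS => s; rewrite distrC.
have cc2 : (c s).2 @[s --> t] --> q t.
  apply/cvgrPdist_le => d d0; near=> s.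
  have [_ + _] : P s (c s) by near: s.
  rewrite distrC => /le_trans; apply; near: s.
  by move/cvgrPdist_le : cq => /(_ d d0); apply: filterS => s; rewrite distrC.
have lx : 'D_dir_x f ((c s).1, q s) @[s --> t] --> 'D_dir_x f (p t, q t).
  have h2 : ((c s).1, q s) @[s --> t] --> (p t, q t) by apply: cvg_pairR; [exact: cc1|exact: cq].
  exact: (cvg_comp _ _ h2 cx).
have ly : 'D_dir_y f (p t, (c s).2) @[s --> t] --> 'D_dir_y f (p t, q t).
  have h2 : (p t, (c s).2) @[s --> t] --> (p t, q t) by apply: cvg_pairR; [exact: cvg_cst|exact: cc2].
  exact: (cvg_comp _ _ h2 cy).
have w0 : h *: (1 : R) + t @[h --> 0^'] --> t.
  have -> : (fun h : R => h *: (1 : R) + t) = (fun h => h + t).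
    by apply/funext => h; rewrite [h *: 1]mulr1.
  rewrite -[X in _ --> X]add0r; apply: cvgD; last exact: cvg_cst.
  exact: cvg_within.
have lim_q (g : R -> R) dg : is_derive t 1 g dg ->
    h^-1 *: (g (h *: (1 : R) + t) - g t) @[h --> 0^'] --> dg.
  by move=> hg; have [d <-] := hg; exact: d.
suff L : h^-1 *: (f (p (h *: (1 : R) + t), q (h *: (1 : R) + t)) - f (p t, q t)) @[h --> 0^'] -->
    'D_dir_x f (p t, q t) * dp + 'D_dir_y f (p t, q t) * dq.
  by apply: DeriveDef; [exact: cvgP L|exact: cvg_lim L].
pose w (h : R) := h *: (1 : R) + t.
have L1 : 'D_dir_x f ((c (w h)).1, q (w h)) * (h^-1 *: (p (w h) - p t)) +
    'D_dir_y f (p t, (c (w h)).2) * (h^-1 *: (q (w h) - q t)) @[h --> 0^'] -->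
    'D_dir_x f (p t, q t) * dp + 'D_dir_y f (p t, q t) * dq.
  apply: cvgD; apply: cvgM.
  - exact: (cvg_comp _ _ w0 lx).
  - exact: lim_q.
  - exact: (cvg_comp _ _ w0 ly).
  - exact: lim_q.
have near_w : \forall h \near (0 : R)^', P (h *: (1 : R) + t) (c (h *: (1 : R) + t)).
  by apply: (w0 [set s | P s (c s)]); exact: near_P.
apply: cvg_trans L1; apply: near_eq_cvg; near=> h.
have [_ _ E] : P (h *: (1 : R) + t) (c (h *: (1 : R) + t)).
  by near: h.
rewrite /w E /GRing.scale /=; ring.
Unshelve. all: by end_near. Qed.

End ChainRule.

(** * Integrals over a period and uniqueness of Fourier coefficients *)

Section CircleIntegrals.
Variable R : realType.
Local Notation mu := (@lebesgue_measure R).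

Definition circle_int (g : R -> R) : R := (\int[mu]_(x in `[0%R, (2 * pi)%R]) g x)%R.

Let pi2_gt0 : 0 < 2 * pi :> R. Proof. by rewrite mulr_gt0 // pi_gt0. Qed.

Lemma continuous_integrable (g : R -> R) (a b : R) : continuous g ->
  mu.-integrable `[a, b] (EFin \o g).
Proof.
move=> cg; apply: continuous_compact_integrable; first exact: segment_compact.
exact: continuous_subspaceT.
Qed.

Lemma circle_intD (f g : R -> R) : continuous f -> continuous g ->
  circle_int (fun x => f x + g x) = circle_int f + circle_int g.
Proof. by move=> cf cg; apply: RintegralD => //; exact: continuous_integrable. Qed.

Lemma circle_intZ (a : R) (f : R -> R) : continuous f -> circle_int (fun x => a * f x) = a * circle_int f.
Proof. by move=> cf; apply: RintegralZl => //; exact: continuous_integrable. Qed.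

Lemma circle_int_FTC (F f : R -> R) : (forall x : R, is_derive x 1 F (f x)) -> continuous f ->
  circle_int f = F (2 * pi) - F 0.
Proof.
move=> dF cf; rewrite /circle_int /Rintegral (@continuous_FTC2 _ f F 0 (2 * pi)) //.
- exact: continuous_subspaceT.
- have cF x : {for x, continuous F} by exact: is_derive_continuous (dF x).
  split; first by move=> x _; have h := dF x; exact: ex_derive.
  + exact: cvg_at_right_filter (cF 0).
  + exact: cvg_at_left_filter (cF (2 * pi)).
- by move=> x _; have h := dF x; rewrite derive1E derive_val.
Qed.

Lemma circle_int_cst (c : R) : circle_int (fun=> c) = c * (2 * pi).
Proof.
rewrite /circle_int Rintegral_cst; last exact: measurable_itv.
congr (_ * _); transitivity (fine (2 * pi : R)%:E) => //; congr fine.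
have := @lebesgue_measure_itv R `[0%R, (2 * pi)%R]; rewrite /= lte_fin pi2_gt0 -EFinB subr0.
exact.
Qed.

Lemma circle_int_le (f g : R -> R) : continuous f -> continuous g ->
  (forall x, 0 <= x <= 2 * pi -> f x <= g x) -> circle_int f <= circle_int g.
Proof.
move=> cf cg fg; apply: le_Rintegral; first exact: measurable_itv.
- exact: continuous_integrable.
- exact: continuous_integrable.
- by move=> x; rewrite /= in_itv /= => /fg.
Qed.

Lemma circle_int_ge (f : R -> R) (a b c : R) : continuous f -> (forall x, 0 <= f x) ->
  0 <= a -> a < b -> b <= 2 * pi -> (forall x, a <= x <= b -> c <= f x) ->
  c * (b - a) <= circle_int f.
Proof.
move=> cf f0 a0 ab b1 fc.
have /integrableP[mf _] := continuous_integrable 0 (2 * pi) cf.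
have Ifin : (\int[mu]_(x in `[0%R, (2 * pi)%R]) (EFin \o f) x)%E \is a fin_num.
  exact: (integrable_fin_num _ (continuous_integrable _ _ cf)).
rewrite /circle_int /Rintegral -lee_fin fineK //.
have sub : (\int[mu]_(x in `[a, b]) (EFin \o f) x <= \int[mu]_(x in `[0%R, (2 * pi)%R]) (EFin \o f) x)%E.
  apply: ge0_subset_integral => //.
  - by move=> x _; rewrite lee_fin.
  - by move=> x; rewrite /= !in_itv /= => /andP[ax xb]; rewrite (le_trans a0) // (le_trans xb).
apply: le_trans sub.
have If : mu.-integrable `[a, b] (EFin \o f) by exact: continuous_integrable.
have Ic : mu.-integrable `[a, b] (EFin \o (fun=> c)).
  by apply: continuous_integrable => x; exact: cvg_cst.
have Ifab : (\int[mu]_(x in `[a, b]) (EFin \o f) x)%E \is a fin_num by exact: integrable_fin_num.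
rewrite -[leRHS]fineK // lee_fin.
have -> : c * (b - a) = (\int[mu]_(x in `[a, b]) c)%R.
  rewrite Rintegral_cst //=; congr (_ * _).
  transitivity (fine (b - a)%:E) => //; congr fine.
  by have := @lebesgue_measure_itv R `[a, b]; rewrite /= lte_fin ab -EFinB.
by apply: le_Rintegral => // x; rewrite /= in_itv /= => /fc.
Qed.

Lemma circle_int_derive (f df : R -> R -> R) (a b r M : R) : a < r < b ->
  (forall x : R, a < x < b -> continuous (f x)) ->
  (forall x t : R, a < x < b -> is_derive x 1 (f ^~ t) (df x t)) ->
  (forall x t : R, a < x < b -> `|df x t| <= M) ->
  is_derive r 1 (fun x => circle_int (f x)) (circle_int (df r)).
Proof.
move=> rab cf d dM.
have M0 : 0 <= M by exact: le_trans (dM r 0 rab).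
have Ir : `]a, b[%classic r by rewrite /= in_itv.
have i1 x : `]a, b[%classic x -> mu.-integrable `[0%R, 2 * pi] (EFin \o f x).
  by rewrite /= in_itv => h; exact: continuous_integrable (cf x h).
have i2 x y : `]a, b[%classic x -> `[0%R, 2 * pi]%classic y -> derivable (f^~ y) x 1.
  by rewrite /= in_itv => /(d x y) h _; exact: ex_derive.
have i3 : mu.-integrable `[0%R, 2 * pi] (EFin \o (fun=> M)).
  by apply: continuous_integrable => x; exact: cvg_cst.
have i4 x y : `]a, b[%classic x -> `[0%R, 2 * pi]%classic y -> `|partial1of2 f x y| <= M.
  move=> xab _; move: xab; rewrite /= in_itv /= => xab.
  have h := d x y xab; by rewrite partial1of2E derive_val dM.
apply: DeriveDef.
  exact: (@derivable_under_integral R _ _ mu f _ (measurable_itv _) _ _ _ Ir i1 i2 (fun=> M) (fun=> M0) i3 i4).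
rewrite -derive1E (@differentiation_under_integral R _ _ mu f _ (measurable_itv _) _ _ _ Ir i1 i2 (fun=> M) (fun=> M0) i3 i4).
apply: eq_Rintegral => y _; have h := d r y rab; by rewrite partial1of2E derive_val.
Qed.

Lemma compact_closed_disc (rho : R) : compact (closed_disc rho).
Proof.
have cb : compact (`[- `|rho|, `|rho|]%classic `*` `[- `|rho|, `|rho|]%classic : set (R * R)).
  by apply: compact_setX; exact: segment_compact.
apply: (subclosed_compact _ cb).
  have cn : continuous (fun x : R * R => x.1 ^+ 2 + x.2 ^+ 2).
    by move=> x; apply: cvgD; apply: continuousM; (exact: cvg_fst || exact: cvg_snd).
  have -> : closed_disc rho = (fun x : R * R => x.1 ^+ 2 + x.2 ^+ 2) @^-1` [set y | y <= rho ^+ 2] by [].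
  apply: closed_comp; last exact: closed_le.
  by move=> x _; exact: cn.
move=> [x y] /= xy; have rr : rho ^+ 2 = `|rho| ^+ 2 by rewrite real_normK ?num_real.
split => /=; rewrite in_itv /= -ler_norml -(ler_pXn2r (n := 2)) ?nnegrE // -rr real_normK ?num_real //;
  apply: le_trans xy; rewrite ?lerDl ?lerDr sqr_ge0 //.
Qed.

Lemma closed_disc_bounded (rho : R) (g : R * R -> R) :
  {within closed_disc rho, continuous g} ->
  exists2 M, 0 <= M & forall z, closed_disc rho z -> `|g z| <= M.
Proof.
move=> cg; have := continuous_compact cg (@compact_closed_disc rho).
move/compact_bounded => [M [_ hM]]; exists (`|M| + 1); first by rewrite addr_ge0.
move=> z hz; apply: (hM (`|M| + 1)); last by exists z.
by rewrite (le_lt_trans (ler_norm _)) // ltrDl.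
Qed.

(* The kernels [((1 + cos (theta - t)) / 2)^N] are trigonometric polynomials
   concentrating at [t]. *)
Lemma fourier_uniqueness (V : R -> R) : continuous V ->
  (forall (k : nat) (ph : R), circle_int (fun x => V x * cos (k%:R * x + ph)) = 0) ->
  forall t, 0 < t < 2 * pi -> V t = 0.
Proof.
move=> cV hV.
(* Only [W t <= 0] is proved; [V] and [- V] together give equality. *)
suff H (W : R -> R) : continuous W ->
    (forall (k : nat) (ph : R), circle_int (fun x => W x * cos (k%:R * x + ph)) = 0) ->
    forall t, 0 < t < 2 * pi -> W t <= 0.
  move=> t t01; apply/eqP; rewrite eq_le (H V) //= -oppr_le0.
  apply: (H (fun x => - V x)) => //.
    by move=> x; apply: cvgN; exact: cV.
  move=> k ph; have -> : (fun x => - V x * cos (k%:R * x + ph)) = (fun x => (-1) * (V x * cos (k%:R * x + ph))).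
    by apply/funext => x; ring.
  rewrite circle_intZ ?hV ?mulr0 // => x; apply: cvgM; first exact: cV.
  apply: (@continuous_comp _ _ _ (fun x : R => k%:R * x + ph) cos); last exact: continuous_cos.
  by apply: cvgD; [apply: cvgM; [exact: cvg_cst|exact: cvg_id]|exact: cvg_cst].
move=> {V cV hV} cW hW t /andP[t0 t1]; rewrite leNgt; apply/negP => Wt.
pose P x := (1 + cos (x - t)) / 2.
have cP : continuous P.
  move=> x; apply: cvgM; last exact: cvg_cst.
  apply: cvgD; first exact: cvg_cst.
  apply: (@continuous_comp _ _ _ (fun x : R => x - t) cos); last exact: continuous_cos.
  by apply: cvgB; [exact: cvg_id|exact: cvg_cst].
have ccos (k : nat) ph : continuous (fun x : R => cos (k%:R * x + ph)).
  move=> x; apply: (@continuous_comp _ _ _ (fun x : R => k%:R * x + ph) cos); last exact: continuous_cos.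
  by apply: cvgD; [apply: cvgM; [exact: cvg_cst|exact: cvg_id]|exact: cvg_cst].
have cPn N : continuous (fun x => P x ^+ N).
  by move=> x; apply: (@continuous_comp _ _ _ P (fun y => y ^+ N)); [exact: cP|exact: exprn_continuous].
(* Multiplication by [P] shifts frequencies by at most 1. For [k = 0] the frequency [-1] is replaced
   by 1 with the opposite phase, the cosine being even. *)
have WPc N k ph : circle_int (fun x => W x * P x ^+ N * cos (k%:R * x + ph)) = 0.
  elim: N k ph => [|N IH] k ph.
    by rewrite -[RHS](hW k ph); congr circle_int; apply/funext => x; rewrite expr0 mulr1.
  have cg k' ph' : continuous (fun x => W x * P x ^+ N * cos (k'%:R * x + ph')).
    move=> x; apply: cvgM; last exact: ccos.
    by apply: cvgM; [exact: cW|exact: cPn].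
  pose k1 := if k is k'.+1 then k' else 1%N.
  pose ph1 := if k is _.+1 then ph + t else - (ph + t).
  have E : (fun x => W x * P x ^+ N.+1 * cos (k%:R * x + ph)) = (fun x =>
      2^-1 * (W x * P x ^+ N * cos (k%:R * x + ph)) +
      (4^-1 * (W x * P x ^+ N * cos (k.+1%:R * x + (ph - t))) +
       4^-1 * (W x * P x ^+ N * cos (k1%:R * x + ph1)))).
    apply/funext => x.
    have -> : k.+1%:R * x + (ph - t) = (k%:R * x + ph) + (x - t) by rewrite -natr1; ring.
    have -> : cos (k1%:R * x + ph1) = cos ((k%:R * x + ph) - (x - t)).
      rewrite /k1 /ph1; case: (k) => [|k'].
        by rewrite -cosN; congr cos; ring.
      by congr cos; rewrite -natr1; ring.
    rewrite exprS [P x * _]mulrC mulrA {2}/P.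
    by move: (k%:R * x + ph) (x - t) => A B; rewrite cosD cosB; field.
  rewrite E circle_intD; last 2 first.
  - by move=> x; apply: cvgM; [exact: cvg_cst|exact: cg].
  - by move=> x; apply: cvgD; apply: cvgM; try exact: cvg_cst; exact: cg.
  rewrite circle_intD; try by move=> x; apply: cvgM; [exact: cvg_cst|exact: cg].
  by rewrite !circle_intZ // !IH !mulr0 !addr0.
have WP N : circle_int (fun x => W x * P x ^+ N) = 0.
  rewrite -[RHS](WPc N 0%N 0); congr circle_int; apply/funext => x.
  by rewrite mul0r add0r cos0 mulr1.
pose eta := W t / 2.
have eta0 : 0 < eta by rewrite divr_gt0.
have [d [d0 dt dt2 hd]] : exists d, [/\ 0 < d, d < t, d < 2 * pi - t &
    forall x, `|x - t| <= d -> eta <= W x].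
  have : \forall x \near t, eta < W x.
    by move/cvgr_gt : (cW t); apply; rewrite /eta ltr_pdivrMr // ltr_pMr // ltr1n.
  case/nbhs_ballP => e /= e0 he.
  exists (Num.min (e / 2) (Num.min (t / 2) ((2 * pi - t) / 2))); split.
  - by rewrite !lt_min !divr_gt0 // subr_gt0.
  - by rewrite !gt_min (_ : t / 2 < t) ?orbT // ltr_pdivrMr // ltr_pMr // ltr1n.
  - by rewrite !gt_min (_ : (2 * pi - t) / 2 < 2 * pi - t) ?orbT // ltr_pdivrMr // ltr_pMr ?ltr1n ?subr_gt0.
  - move=> x; rewrite !le_min => /andP[xe _]; apply/ltW/he; rewrite /ball /= distrC.
    by apply: (le_lt_trans xe); rewrite ltr_pdivrMr // ltr_pMr // ltr1n.
have tpi : d < pi by lra.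
have [M M0 hM] : exists2 M, 0 <= M & forall x, 0 <= x <= 2 * pi -> `|W x| <= M.
  have cc : compact (W @` `[0, 2 * pi]).
    by apply: continuous_compact; [exact: continuous_subspaceT|exact: segment_compact].
  have /compact_bounded [M [_ h]] := cc; exists (`|M| + 1); first by rewrite addr_ge0.
  move=> x hx; apply: (h (`|M| + 1)); first by rewrite (le_lt_trans (ler_norm _)) // ltrDl.
  by exists x => //; rewrite /= in_itv.
pose p := (1 + cos (d / 2)) / 2 : R; pose q := (1 + cos d) / 2 : R.
have cosabs x : cos (x - t) = cos `|x - t|.
  by case: (ger0P (x - t)) => // _; rewrite cosN.
have cos_le (x y : R) : 0 <= x -> x <= y -> y <= pi -> cos y <= cos x.
  move=> x0 xy ypi; move: xy; rewrite le_eqVlt => /predU1P[-> //|xy].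
  by apply: ltW; rewrite ltr_cos ?in_itv //=; apply/andP; split; lra.
have Ppos x : 0 <= P x by rewrite /P divr_ge0 // -lerBlDl sub0r cos_geN1.
have Pin x : `|x - t| <= d / 2 -> p <= P x.
  move=> h; rewrite /P /p cosabs ler_pM2r // lerD2l.
  by apply: cos_le => //; lra.
have Pout x : 0 <= x <= 2 * pi -> d <= `|x - t| -> P x <= q.
  move=> /andP[x0 x1] dx; rewrite /P /q cosabs ler_pM2r // lerD2l.
  have xb : `|x - t| <= 2 * pi - d by rewrite ler_norml; apply/andP; split; lra.
  have [xp|xp] := leP `|x - t| pi.
    by apply: cos_le => //; lra.
  have -> : cos `|x - t| = cos (2 * pi - `|x - t|).
    by rewrite cosB [2 * pi]mulr_natl cos2pi sin2pi; ring.
  by apply: cos_le => //; lra.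
have qp : q < p.
  by rewrite /p /q ltr_pM2r // ltrD2l ltr_cos ?in_itv /=; lra.
have q0 : 0 <= q by rewrite divr_ge0 // -lerBlDl sub0r cos_geN1.
have p0 : 0 < p by exact: le_lt_trans qp.
(* The kernel is at least [p] within [d/2] of [t] and at most [q < p] beyond distance [d], so this
   inequality fails for large [N]. *)
have key N : eta * (p ^+ N * d) <= (M + eta) * q ^+ N * (2 * pi).
  have h1 : p ^+ N * d <= circle_int (fun x => P x ^+ N).
    have -> : d = (t + d / 2) - (t - d / 2) by lra.
    apply: circle_int_ge => //; try lra.
    - by move=> x; rewrite exprn_ge0.
    - move=> x xx; apply: lerXn2r; rewrite ?nnegrE ?Ppos ?(ltW p0) //.
      by apply: Pin; rewrite ler_norml; apply/andP; split; lra.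
  have h2 : circle_int (fun x => eta * P x ^+ N) <=
      circle_int (fun x => W x * P x ^+ N + (M + eta) * q ^+ N).
    apply: circle_int_le.
    - by move=> x; apply: cvgM; [exact: cvg_cst|exact: cPn].
    - by move=> x; apply: cvgD; [apply: cvgM; [exact: cW|exact: cPn]|exact: cvg_cst].
    move=> x xx; have [h|h] := leP `|x - t| d.
      apply: ler_wpDr; first by rewrite mulr_ge0 ?exprn_ge0 // addr_ge0 // ltW.
      by apply: ler_wpM2r; [rewrite exprn_ge0|exact: hd].
    rewrite -lerBlDl -mulrBl.
    have PN : P x ^+ N <= q ^+ N.
      by apply: lerXn2r; rewrite ?nnegrE ?Ppos // Pout // ltW.
    apply: le_trans (_ : (M + eta) * P x ^+ N <= _).
      apply: ler_wpM2r; first by rewrite exprn_ge0.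
      have := hM x xx; rewrite ler_norml => /andP[+ _]; lra.
    by apply: ler_wpM2l => //; rewrite addr_ge0 // ltW.
  rewrite circle_intZ // circle_intD ?WP ?add0r ?circle_int_cst in h2; last 2 first.
  - by move=> x; apply: cvgM; [exact: cW|exact: cPn].
  - by move=> x; exact: cvg_cst.
  by apply: le_trans h2; rewrite ler_pM2l.
have : ((q / p) ^+ N) @[N --> \oo] --> (0 : R).
  by apply: cvg_expr; rewrite ger0_norm ?divr_ge0 // ?(ltW p0) // ltr_pdivrMr // mul1r.
have B0 : 0 < (M + eta) * (2 * pi) by rewrite mulr_gt0 // ltr_wpDl.
move: B0 key; move BE : ((M + eta) * (2 * pi)) => B B0 key.
have eB0 : 0 < eta * d / B by rewrite divr_gt0 // mulr_gt0.
move/cvgrPdist_lt => /(_ _ eB0) [N _ /(_ N (leqnn N))] /=.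
rewrite sub0r normrN ger0_norm; last by rewrite exprn_ge0 // divr_ge0 // ltW.
rewrite expr_div_n ltr_pdivrMr ?exprn_gt0 // mulrAC ltr_pdivlMr // => h.
have := key N; rewrite [leRHS]mulrAC BE => /(lt_le_trans _) k1.
have E : eta * (p ^+ N * d) = eta * d * p ^+ N by ring.
by have := k1 (q ^+ N * B); rewrite E [B * _]mulrC ltxx => /(_ h).
Qed.

End CircleIntegrals.

(** * Bounded solutions of Bessel's equation *)

Section BesselODE.
Variable R : realType.

Lemma eq_of_derive0 (f : R -> R) (a b x y : R) :
  (forall r : R, a < r < b -> is_derive r 1 f 0) -> a < x < b -> a < y < b -> f x = f y.
Proof.
move=> d; wlog xy : x y / x <= y.
  by move=> H xab yab; case: (leP x y) => [|/ltW] xy; [|symmetry]; apply: H.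
move=> /andP[ax xb] /andP[ay yb].
have sub (r : R) : r \in `[x, y]%R -> a < r < b.
  by rewrite in_itv /= => /andP[xr ry]; rewrite (lt_le_trans ax) // (le_lt_trans ry).
have [||c _] := @MVT_segment R f (fun=> 0) x y xy.
- by move=> r rxy; apply: d; apply: sub; apply: subset_itv_oo_cc.
- by apply: derivable_within_continuous => r /sub /d h; exact: ex_derive.
by rewrite mul0r => /eqP; rewrite subr_eq0 => /eqP ->.
Qed.

Lemma near_norm_le_cvg0 (f g : R -> R) (F : set_system R) : Filter F ->
  (\forall x \near F, `|f x| <= g x) -> g x @[x --> F] --> 0 -> f x @[x --> F] --> 0.
Proof.
move=> FF fg g0; apply: (@squeeze_cvgr _ _ _ _ (fun x => - g x) g).
- by apply: filterS fg => x; rewrite ler_norml.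
- by rewrite -[X in _ --> X]oppr0; exact: cvgN.
- exact: g0.
Qed.
Arguments near_norm_le_cvg0 f g {F FF}.

Lemma is_derive_mulr_id (mu r : R) : is_derive r 1 (fun x : R => mu * x) mu.
Proof. by apply: (is_derive_eq (derZ mu (is_derive_id r 1))); rewrite mulr1. Qed.

(* The Wronskian with [bj k (mu r)] is constant and vanishes at [0]; hence
   [(A, P)] is a multiple [c] of [(J, Q)], and [c' J = c' Q = 0]. *)
Lemma bessel_ode_sol (k : nat) (mu rho M : R) (A P : R -> R) : 0 < mu -> 0 < rho ->
  (forall r : R, 0 < r < rho -> is_derive r 1 A (P r / r)) ->
  (forall r : R, 0 < r < rho -> is_derive r 1 P ((k%:R ^+ 2 / r - mu ^+ 2 * r) * A r)) ->
  (\forall r \near 0^'+, `|A r| <= M) -> (\forall r \near 0^'+, `|P r| <= M * r) ->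
  exists c, forall r, 0 < r < rho -> A r = c * bj k (mu * r).
Proof.
move=> mu0 rho0 dA dP Ab Pb.
pose J (r : R) := bj k (mu * r); pose Q (r : R) := bjd k (mu * r).
have dJ (r : R) : 0 < r -> is_derive r 1 J (Q r / r).
  move=> r0; have mr : mu * r != 0 by rewrite gt_eqF // mulr_gt0.
  apply: (is_derive_eq (derC (is_derive_bj k mr) (is_derive_mulr_id mu r))).
  by rewrite /Q; field; rewrite !gt_eqF.
have dQ (r : R) : 0 < r -> is_derive r 1 Q ((k%:R ^+ 2 / r - mu ^+ 2 * r) * J r).
  move=> r0; have mr : mu * r != 0 by rewrite gt_eqF // mulr_gt0.
  apply: (is_derive_eq (derC (is_derive_bjd k mr) (is_derive_mulr_id mu r))).
  by rewrite /J; field; rewrite !gt_eqF.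
pose W (r : R) := P r * J r - A r * Q r.
have dW (r : R) : 0 < r < rho -> is_derive r 1 W 0.
  move=> rr; have /andP[r0 _] := rr.
  apply: (is_derive_eq (derB (derM (dP r rr) (dJ r r0)) (derM (dA r rr) (dQ r r0)))).
  by field; rewrite gt_eqF.
have cJ : J x @[x --> 0^'+] --> J 0.
  have c0 : {for (0 : R), continuous J}.
    apply: (@continuous_comp _ _ _ (fun x : R => mu * x) (bj k)); last exact: continuous_bj.
    exact: is_derive_continuous (is_derive_mulr_id mu 0).
  exact: cvg_at_right_filter c0.
have cQ : Q x @[x --> 0^'+] --> (0 : R).
  have Q0 : Q 0 = 0 by rewrite /Q mulr0 /bjd mul0r mul0r subr0 /bj; case: (k) => [|k']; rewrite ?mul0r // expr0n !mul0r mulr0.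
  rewrite -[X in _ --> X]Q0.
  have c0 : {for (0 : R), continuous Q}.
    apply: (@continuous_comp _ _ _ (fun x : R => mu * x) (bjd k)); last exact: continuous_bjd.
    exact: is_derive_continuous (is_derive_mulr_id mu 0).
  exact: cvg_at_right_filter c0.
have W0 : W x @[x --> 0^'+] --> (0 : R).
  have id0 : M * x @[x --> 0^'+] --> (0 : R).
    rewrite -[X in _ --> X](mulr0 M); apply: cvgM; first exact: cvg_cst.
    exact: cvg_at_right_filter cvg_id.
  have P0 : P x @[x --> 0^'+] --> (0 : R) by exact: near_norm_le_cvg0 Pb id0.
  have AQ0 : A x * Q x @[x --> 0^'+] --> (0 : R).
    apply: (@near_norm_le_cvg0 _ (fun x => M * `|Q x|)).
      near=> x; rewrite normrM ler_wpM2r //; near: x; exact: Ab.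
    rewrite -[X in _ --> X](mulr0 M) -[in X in _ --> X](normr0 R).
    by apply: cvgM; [exact: cvg_cst|exact: cvg_norm].
  rewrite -[X in _ --> X](subr0 0) -[X in _ --> X - _](mul0r (J 0)).
  by apply: cvgB => //; exact: cvgM.
have W_eq0 (r : R) : 0 < r < rho -> W r = 0.
  move=> rr; suff : W x @[x --> 0^'+] --> W r.
    by move/cvg_lim => <- //; apply/cvg_lim.
  apply: cvg_near_cst; near=> x; apply: (@eq_of_derive0 W 0 rho) => //.
  by apply/andP; split; near: x; [exact: nbhs_right_gt|exact: nbhs_right_lt].
have JQ (r : R) : 0 < r -> 0 < J r * J r + Q r * Q r.
  move=> r0; rewrite -!expr2 lt_neqAle addr_ge0 ?sqr_ge0 // andbT eq_sym paddr_eq0 ?sqr_ge0 // !sqrf_eq0.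
  apply/negP => /andP[/eqP j0 /eqP q0]; apply: (bj_bjd_neq0 _ j0 q0).
  by rewrite gt_eqF // mulr_gt0.
pose c (r : R) := (A r * J r + P r * Q r) / (J r * J r + Q r * Q r).
have cA (r : R) : 0 < r < rho -> A r = c r * J r.
  move=> rr; have /andP[r0 _] := rr; have /eqP := W_eq0 r rr; rewrite subr_eq0 => /eqP w.
  rewrite /c mulrAC; apply/(canRL (mulfK _)); first by rewrite gt_eqF // JQ.
  have e : P r * Q r * J r = A r * Q r * Q r by rewrite mulrAC w.
  by rewrite [RHS]mulrDl e; ring.
have cP (r : R) : 0 < r < rho -> P r = c r * Q r.
  move=> rr; have /andP[r0 _] := rr; have /eqP := W_eq0 r rr; rewrite subr_eq0 => /eqP w.
  rewrite /c mulrAC; apply/(canRL (mulfK _)); first by rewrite gt_eqF // JQ.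
  have e : A r * J r * Q r = P r * J r * J r by rewrite mulrAC -w.
  by rewrite [RHS]mulrDl e; ring.
have dc (r : R) : 0 < r < rho -> is_derive r 1 c 0.
  move=> rr; have /andP[r0 _] := rr.
  have JQn : J r * J r + Q r * Q r != 0 by rewrite gt_eqF // JQ.
  have h1 := dA r rr; have h2 := dP r rr; have h3 := dJ r r0; have h4 := dQ r r0.
  have dN := derD (derM h1 h3) (derM h2 h4).
  have dD := derD (derM h3 h3) (derM h4 h4).
  have := derM dN (@derV _ (fun x => J x * J x + Q x * Q x) _ _ JQn dD).
  move/is_derive_eq; apply.
  rewrite (cA r rr) (cP r rr). by field; rewrite JQn gt_eqF.
exists (c (rho / 2)) => r rr; rewrite (cA r rr); congr (_ * _).
by apply: (@eq_of_derive0 c 0 rho) => //; apply/andP; split; lra.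
Unshelve. all: by end_near. Qed.

End BesselODE.

(** * Polar coordinates *)

Section Polar.
Variable R : realType.

Definition polar (r t : R) : R * R := (r * cos t, r * sin t).

Lemma polar_sqr (r t : R) : (polar r t).1 ^+ 2 + (polar r t).2 ^+ 2 = r ^+ 2.
Proof. by rewrite /polar /= !exprMn -mulrDr cos2Dsin2 mulr1. Qed.

Lemma polar_disc (rho r t : R) : 0 < rho -> `|r| < rho -> disc rho (polar r t).
Proof.
by move=> r0 h; rewrite /disc /= polar_sqr -[r ^+ 2]real_normK ?num_real // ltrXn2r ?normr_ge0 ?(ltW r0).
Qed.

Lemma polar_closed_disc (rho r t : R) : `|r| <= rho -> closed_disc rho (polar r t).
Proof.
move=> h; rewrite /closed_disc /= polar_sqr -[r ^+ 2]real_normK ?num_real //.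
by apply: lerXn2r; rewrite ?nnegrE ?normr_ge0 // (le_trans _ h).
Qed.

Lemma polar2pi (r t : R) : polar r (t + 2 * pi) = polar r t.
Proof. by rewrite /polar mulr_natl cosD2pi sinD2pi. Qed.

Lemma polarP (z : R * R) : exists r t, [/\ 0 <= r, r ^+ 2 = z.1 ^+ 2 + z.2 ^+ 2, 0 <= t < 2 * pi & z = polar r t].
Proof.
case: z => x y /=; pose r := Num.sqrt (x ^+ 2 + y ^+ 2).
have s0 : 0 <= x ^+ 2 + y ^+ 2 by rewrite addr_ge0 // sqr_ge0.
have r0 : 0 <= r := sqrtr_ge0 _.
have r2 : r ^+ 2 = x ^+ 2 + y ^+ 2 by rewrite sqr_sqrtr.
have pi0 : 0 < pi :> R := pi_gt0 R.
move: r r0 r2 => r; rewrite le_eqVlt => /predU1P[<- | r0] r2.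
  have /andP[/eqP x0 /eqP y0] : (x == 0) && (y == 0).
    by rewrite -[x == 0]sqrf_eq0 -[y == 0]sqrf_eq0 -paddr_eq0 ?sqr_ge0 // -r2 expr0n.
  exists 0, 0; split => /=; [by []|by rewrite x0 y0 !expr0n addr0| |].
    by rewrite lexx /= mulr_gt0.
  by rewrite /polar !mul0r x0 y0.
have c1 : -1 <= x / r <= 1.
  rewrite -ler_norml normrM normfV (gtr0_norm r0) ler_pdivrMr // mul1r.
  by rewrite -(ler_pXn2r (n := 2)) ?nnegrE ?normr_ge0 ?(ltW r0) // real_normK ?num_real // r2 lerDl sqr_ge0.
have [a0 a1] : 0 <= acos (x / r) /\ acos (x / r) <= pi by split; [exact: acos_ge0|exact: acos_lepi].
have ca : cos (acos (x / r)) = x / r by rewrite acosK // in_itv.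
have sa : sin (acos (x / r)) = `|y| / r.
  rewrite sin_acos // -[RHS]ger0_norm; last by rewrite divr_ge0 // ltW.
  rewrite -sqrtr_sqr; congr Num.sqrt; rewrite !expr_div_n real_normK ?num_real //.
  have -> : y ^+ 2 = r ^+ 2 - x ^+ 2 by rewrite r2; ring.
  by field; rewrite gt_eqF.
have [y0|y0] := leP 0 y.
  exists r, (acos (x / r)); split => //; first exact: ltW.
    by rewrite a0 /=; apply: (le_lt_trans a1); lra.
  by rewrite /polar ca sa ger0_norm //; congr pair; field; rewrite gt_eqF.
exists r, (2 * pi - acos (x / r)); split => //; first exact: ltW.
  apply/andP; split; first lra.
  rewrite ltrBlDr ltrDl lt_neqAle a0 andbT; apply/eqP => e.
  by move: sa; rewrite -e sin0 => /esym/eqP; rewrite mulf_eq0 invr_eq0 normr_eq0 (gt_eqF r0) (lt_eqF y0).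
have -> : polar r (2 * pi - acos (x / r)) = polar r (- acos (x / r)).
  by rewrite -[RHS]polar2pi addrC.
rewrite /polar cosN sinN ca sa ltr0_norm //; congr pair; field; rewrite gt_eqF //.
Qed.

Lemma continuous_polar (r : R) : continuous (polar r).
Proof.
move=> t; apply: cvg_pairR; apply: cvgM; try exact: cvg_cst.
- exact: continuous_cos.
- exact: continuous_sin.
Qed.

Lemma continuous_polar_r (t : R) : continuous (polar ^~ t).
Proof. by move=> r; apply: cvg_pairR; (apply: cvgM; [exact: cvg_id|exact: cvg_cst]). Qed.

Lemma open_disc (rho : R) : open (disc rho).
Proof.
have cn : continuous (fun x : R * R => x.1 ^+ 2 + x.2 ^+ 2).
  by move=> x; apply: cvgD; apply: continuousM; (exact: cvg_fst || exact: cvg_snd).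
have -> : disc rho = (fun x : R * R => x.1 ^+ 2 + x.2 ^+ 2) @^-1` [set y | y < rho ^+ 2] by [].
by apply: open_comp; [move=> x _; exact: cn|exact: open_lt].
Qed.

Let dir_y_in : @dir_y R \in [:: dir_x; dir_y].
Proof. by rewrite !inE eqxx orbT. Qed.

Lemma chain_disc (rho : R) f (p q : R -> R) (t dp dq : R) : C1_on (disc rho) f ->
  disc rho (p t, q t) -> is_derive t 1 p dp -> is_derive t 1 q dq ->
  is_derive t 1 (fun s => f (p s, q s)) ('D_dir_x f (p t, q t) * dp + 'D_dir_y f (p t, q t) * dq).
Proof.
move=> cf dpq hp hq; apply: chain_rule => //.
- have : \forall z \near (p t, q t), disc rho z by apply: open_nbhs_nbhs; split => //; exact: open_disc.
  apply: filterS => z hz.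
  by split; [have [] := cf dir_x (mem_head _ _) z hz|have [] := cf dir_y dir_y_in z hz].
- by have [] := cf dir_x (mem_head _ _) _ dpq.
- by have [] := cf dir_y dir_y_in _ dpq.
Qed.

Lemma polar_derive_r (rho : R) f (r t : R) : C1_on (disc rho) f -> disc rho (polar r t) ->
  is_derive r 1 (fun s => f (polar s t)) ('D_dir_x f (polar r t) * cos t + 'D_dir_y f (polar r t) * sin t).
Proof.
move=> cf d; have h (c : R) : is_derive r 1 (fun s => s * c) c.
  by apply: is_derive_eq; rewrite /GRing.scale /=; ring.
exact: (@chain_disc rho f (fun s => s * cos t) (fun s => s * sin t) r _ _ cf d (h _) (h _)).
Qed.

Lemma polar_derive_t (rho : R) f (r t : R) : C1_on (disc rho) f -> disc rho (polar r t) ->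
  is_derive t 1 (fun s => f (polar r s)) (- 'D_dir_x f (polar r t) * (r * sin t) + 'D_dir_y f (polar r t) * (r * cos t)).
Proof.
move=> cf d.
have h1 : is_derive t 1 (fun s => r * cos s) (r * - sin t) by apply: derZ.
have h2 : is_derive t 1 (fun s => r * sin s) (r * cos t) by apply: derZ.
by apply: (is_derive_eq (@chain_disc rho f (fun s => r * cos s) (fun s => r * sin s) t _ _ cf d h1 h2)); rewrite /polar; ring.
Qed.

Lemma within_continuous_comp (T : topologicalType) (A : set (R * R)) (u : R * R -> R) (g : T -> R * R) :
  continuous g -> (forall x, A (g x)) -> {within A, continuous u} -> continuous (u \o g).
Proof.
move=> cg Ag cu x; have hu := (subspace_continuousP _ _).1 cu (g x) (Ag x).
have h : g @ x --> within A (nbhs (g x)).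
  move=> P wP; have := cg x _ wP; rewrite !nbhs_simpl /= => h.
  by apply: (@filterS _ (nbhs x)) h => y hy; exact: hy (Ag (y)).
exact: (cvg_comp _ _ h hu).
Qed.

Lemma within_continuous_at (rho : R) (u : R * R -> R) z : {within closed_disc rho, continuous u} ->
  disc rho z -> {for z, continuous u}.
Proof.
move=> cu dz; have dcl : closed_disc rho z by exact: ltW.
have hu := (subspace_continuousP _ _).1 cu z dcl.
apply: cvg_trans hu => P /= wP; have : \forall y \near z, disc rho y.
  by apply: open_nbhs_nbhs; split => //; exact: open_disc.
by move=> hd; apply: (@filterS2 _ (nbhs z)) wP hd => y hP /ltW; exact: hP.
Qed.

Lemma polar_bounded (rho b : R) (g : R * R -> R) : 0 <= b < rho ->
  (forall z, disc rho z -> {for z, continuous g}) ->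
  exists2 M, 0 <= M & forall r t, `|r| <= b -> `|g (polar r t)| <= M.
Proof.
move=> /andP[b0 brho] cg; have rho0 : 0 < rho by exact: le_lt_trans brho.
have [|M M0 hM] := @closed_disc_bounded R b g.
  apply/subspace_continuousP => z /= hz; apply: cvg_within_filter.
  apply: cg; rewrite /disc /=; apply: (le_lt_trans hz).
  by rewrite ltrXn2r // ltW.
by exists M => // r t hr; apply: hM; exact: polar_closed_disc.
Qed.

Lemma continuous_polar_disc (rho r : R) (g : R * R -> R) : 0 < rho -> `|r| < rho ->
  (forall z, disc rho z -> {for z, continuous g}) -> continuous (fun t => g (polar r t)).
Proof.
move=> r0 h cg t; apply: (@continuous_comp _ _ _ (polar r) g); first exact: continuous_polar.
by apply: cg; exact: polar_disc.
Qed.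

Lemma circle_int_norm_le (f : R -> R) M : continuous f -> (forall x, `|f x| <= M) ->
  `|circle_int f| <= M * (2 * pi).
Proof.
move=> cf hM; rewrite ler_norml -mulNr -!circle_int_cst.
apply/andP; split; apply: circle_int_le => //; try by move=> x; exact: cvg_cst.
  by move=> x _; move: (hM x); rewrite ler_norml => /andP[].
by move=> x _; move: (hM x); rewrite ler_norml => /andP[].
Qed.

(** Covers every angle of [0, 2 pi), including 0, and leaves an open interval around them on which
    equations in [t] can be solved. *)
Lemma fourier_uniqueness_periodic (V : R -> R) : continuous V -> (forall x, V (x + 2 * pi) = V x) ->
  (forall (k : nat) (ph : R), circle_int (fun x => V x * cos (k%:R * x + ph)) = 0) ->
  forall t, - (2 * pi) < t < 2 * pi -> V t = 0.
Proof.
move=> cV pV hV t /andP[t0 t1]; have H := fourier_uniqueness cV hV.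
have pi0 : 0 < pi :> R := pi_gt0 R.
have [tn|tp|->] := ltgtP t 0; last 1 first.
- have h : V x @[x --> 0^'+] --> V 0 by apply: cvg_at_right_filter; exact: cV.
  rewrite -(cvg_lim _ h) //; apply/cvg_lim => //; apply: cvg_near_cst; near=> x.
  apply: H; apply/andP; split; near: x; first exact: nbhs_right_gt.
  by apply: nbhs_right_lt; rewrite mulr_gt0.
- by rewrite -pV; apply: H; apply/andP; split; lra.
- by apply: H; rewrite tp.
Unshelve. all: by end_near. Qed.

End Polar.

Section Oscillator.
Variable R : realType.

(** Variation of constants: [m f cos - f' sin] and [m f sin + f' cos], at the angle [m t], have
    derivative 0. For [m = 0] the solutions are affine, and equality at [- T/2] and [T/2] kills the
    slope. *)
Lemma oscillator_sol (m : nat) (f f' : R -> R) (T : R) : 0 < T ->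
  (forall t, - T < t < T -> is_derive t 1 f (f' t)) ->
  (forall t, - T < t < T -> is_derive t 1 f' (- m%:R ^+ 2 * f t)) ->
  f (- (T / 2)) = f (T / 2) ->
  exists a b, forall t, - T < t < T -> f t = a * cos (m%:R * t) + b * sin (m%:R * t).
Proof.
move=> T0 df df' fT; have T00 : - T < 0 < T by rewrite oppr_lt0 T0.
case: m df' => [|m] df'.
  have f'c t : - T < t < T -> f' t = f' 0.
    move=> tt; apply: (@eq_of_derive0 _ f' (- T) T) => // s ss.
    by have := df' s ss; rewrite expr0n oppr0 mul0r.
  have fl t : - T < t < T -> f t - f' 0 * t = f 0.
    move=> tt; transitivity (f 0 - f' 0 * 0); last by rewrite mulr0 subr0.
    apply: (@eq_of_derive0 _ (fun t => f t - f' 0 * t) (- T) T) => // s ss.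
    by apply: (is_derive_eq (derB (df s ss) (is_derive_mulr_id (f' 0) s))); rewrite f'c // subrr.
  have c0 : f' 0 = 0.
    have /fl h1 : - T < - (T / 2) < T by apply/andP; split; lra.
    have /fl h2 : - T < T / 2 < T by apply/andP; split; lra.
    have /eqP : f' 0 * T = 0.
      have -> : f' 0 * T = (f (- (T / 2)) - f' 0 * (- (T / 2))) - (f (T / 2) - f' 0 * (T / 2)) by rewrite fT; field.
      by rewrite h1 h2 subrr.
    by rewrite mulf_eq0 (gt_eqF T0) orbF => /eqP.
  by exists (f 0), 0 => t tt; rewrite mul0r cos0 mulr1 mul0r addr0 -(fl t tt) c0 mul0r subr0.
have m0 : m.+1%:R != 0 :> R by rewrite pnatr_eq0.
have dc (t : R) : is_derive t 1 (fun t => cos (m.+1%:R * t)) (- sin (m.+1%:R * t) * m.+1%:R).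
  exact: (derC (is_derive_cos _) (is_derive_mulr_id m.+1%:R t)).
have ds (t : R) : is_derive t 1 (fun t => sin (m.+1%:R * t)) (cos (m.+1%:R * t) * m.+1%:R).
  exact: (derC (is_derive_sin _) (is_derive_mulr_id m.+1%:R t)).
have Aeq t : - T < t < T -> m.+1%:R * f t * cos (m.+1%:R * t) - f' t * sin (m.+1%:R * t) = m.+1%:R * f 0.
  move=> tt; transitivity (m.+1%:R * f 0 * cos (m.+1%:R * 0) - f' 0 * sin (m.+1%:R * 0)); last first.
    by rewrite mulr0 cos0 sin0 mulr0 subr0 mulr1.
  apply: (@eq_of_derive0 _ (fun t => m.+1%:R * f t * cos (m.+1%:R * t) - f' t * sin (m.+1%:R * t)) (- T) T) => // s ss.
  by apply: (is_derive_eq (derB (derM (derZ m.+1%:R (df s ss)) (dc s)) (derM (df' s ss) (ds s)))); ring.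
have Beq t : - T < t < T -> m.+1%:R * f t * sin (m.+1%:R * t) + f' t * cos (m.+1%:R * t) = f' 0.
  move=> tt; transitivity (m.+1%:R * f 0 * sin (m.+1%:R * 0) + f' 0 * cos (m.+1%:R * 0)); last first.
    by rewrite mulr0 cos0 sin0 mulr0 add0r mulr1.
  apply: (@eq_of_derive0 _ (fun t => m.+1%:R * f t * sin (m.+1%:R * t) + f' t * cos (m.+1%:R * t)) (- T) T) => // s ss.
  by apply: (is_derive_eq (derD (derM (derZ m.+1%:R (df s ss)) (ds s)) (derM (df' s ss) (dc s)))); ring.
exists (f 0), (f' 0 / m.+1%:R) => t tt.
apply: (mulfI m0); rewrite mulrDr mulrA -(Aeq t tt) -(Beq t tt).
transitivity (m.+1%:R * f t * (cos (m.+1%:R * t) ^+ 2 + sin (m.+1%:R * t) ^+ 2)).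
  by rewrite cos2Dsin2 mulr1.
by field.
Qed.

End Oscillator.

(** The polar chain rule as a relation between plain functions, so that the separation argument can
    treat partial derivatives as given functions. *)
Definition polar_grad (R : realType) (rho : R) (f fx fy : R * R -> R) := forall r t : R, `|r| < rho ->
  is_derive r 1 (fun s => f (polar s t)) (fx (polar r t) * cos t + fy (polar r t) * sin t) /\
  is_derive t 1 (fun s => f (polar r s)) (- fx (polar r t) * (r * sin t) + fy (polar r t) * (r * cos t)).

(** * Fourier coefficients of an eigenfunction *)

Section Separation.
Variables (R : realType) (rho mu : R).
Hypotheses (rho0 : 0 < rho) (mu0 : 0 < mu).
Variables (u ux uy uxx uxy uyx uyy : R * R -> R).
Local Notation grad := (polar_grad rho).
Hypotheses (C1u : grad u ux uy) (C1x : grad ux uxx uxy) (C1y : grad uy uyx uyy).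
Hypothesis cu : forall z, disc rho z -> {for z, continuous u}.
Hypothesis cux : forall z, disc rho z -> {for z, continuous ux}.
Hypothesis cuy : forall z, disc rho z -> {for z, continuous uy}.
Hypothesis cuxx : forall z, disc rho z -> {for z, continuous uxx}.
Hypothesis cuxy : forall z, disc rho z -> {for z, continuous uxy}.
Hypothesis cuyx : forall z, disc rho z -> {for z, continuous uyx}.
Hypothesis cuyy : forall z, disc rho z -> {for z, continuous uyy}.
Hypothesis pde : forall z, disc rho z -> - (uxx z + uyy z) = mu ^+ 2 * u z.
Hypothesis cclosed : {within closed_disc rho, continuous u}.
Hypothesis u_circle : forall z, circle rho z -> u z = 0.

Let U (r t : R) := u (polar r t).
Let Ur (r t : R) := ux (polar r t) * cos t + uy (polar r t) * sin t.
Let Ut (r t : R) := - ux (polar r t) * (r * sin t) + uy (polar r t) * (r * cos t).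
(** [Utt] is the second angular derivative and [Pr] the radial derivative of [r Ur], so that r^2
    times the Laplacian is [r Pr + Utt]. *)
Let Utt (r t : R) := r ^+ 2 * (uxx (polar r t) * sin t ^+ 2 - (uxy (polar r t) + uyx (polar r t)) * (cos t * sin t)
  + uyy (polar r t) * cos t ^+ 2) - r * Ur r t.
Let Pr (r t : R) := Ur r t + r * (uxx (polar r t) * cos t ^+ 2 + (uxy (polar r t) + uyx (polar r t)) * (cos t * sin t)
  + uyy (polar r t) * sin t ^+ 2).

Let dU_r (r t : R) : `|r| < rho -> is_derive r 1 (U^~ t) (Ur r t).
Proof. by move=> h; have [] := C1u t h. Qed.

Let dU_t (r t : R) : `|r| < rho -> is_derive t 1 (U r) (Ut r t).
Proof. by move=> h; have [] := C1u t h. Qed.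

Let dUt_t (r t : R) : `|r| < rho -> is_derive t 1 (Ut r) (Utt r t).
Proof.
move=> h; have [_ h1] := C1x t h; have [_ h2] := C1y t h.
have d1 : is_derive t 1 (fun s => r * cos s) (r * - sin t) by apply: derZ.
have d2 : is_derive t 1 (fun s => r * sin s) (r * cos t) by apply: derZ.
have h3 : is_derive t 1 (fun s => - ux (polar r s)) (- (- uxx (polar r t) * (r * sin t) + uxy (polar r t) * (r * cos t))).
  exact: is_deriveN.
apply: (is_derive_eq (derD (derM h3 d2) (derM h2 d1))).
by rewrite /Utt /Ur; ring.
Qed.

Let dP_r (r t : R) : `|r| < rho -> is_derive r 1 (fun s => s * Ur s t) (Pr r t).
Proof.
move=> h; have [h1 _] := C1x t h; have [h2 _] := C1y t h.
have i := is_derive_id r 1.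
have c1 := is_derive_cst (cos t) r 1; have c2 := is_derive_cst (sin t) r 1.
apply: (is_derive_eq (derM i (derD (derM h1 c1) (derM h2 c2)))).
by rewrite /Pr /Ur /=; ring.
Qed.

Let Pr_eq (r t : R) : 0 < r < rho -> Pr r t = - (mu ^+ 2 * r * U r t) - Utt r t / r.
Proof.
move=> /andP[r0 r1]; have rn : `|r| < rho by rewrite gtr0_norm.
have h := pde (polar_disc t rho0 rn).
have -> : mu ^+ 2 * r * U r t = r * (mu ^+ 2 * u (polar r t)) by rewrite /U; ring.
rewrite -h /Pr /Utt /Ur; have -> : cos t ^+ 2 = 1 - sin t ^+ 2 by rewrite -(cos2Dsin2 t); ring.
by field; rewrite gt_eqF.
Qed.

Let cvgM_cont (f g : R -> R) : continuous f -> continuous g -> continuous (fun x => f x * g x).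
Proof. by move=> cf cg x; apply: cvgM; [exact: cf|exact: cg]. Qed.
Let cvgD_cont (f g : R -> R) : continuous f -> continuous g -> continuous (fun x => f x + g x).
Proof. by move=> cf cg x; apply: cvgD; [exact: cf|exact: cg]. Qed.
Let cst_cont (c : R) : continuous (fun _ : R => c).
Proof. by move=> x; exact: cvg_cst. Qed.

Let cU (r : R) : `|r| < rho -> continuous (U r).
Proof. by move=> h; exact: (continuous_polar_disc rho0 h cu). Qed.

Let cUr (r : R) : `|r| < rho -> continuous (Ur r).
Proof.
move=> h; apply: cvgD_cont; apply: cvgM_cont.
- exact: (continuous_polar_disc rho0 h cux).
- exact: continuous_cos.
- exact: (continuous_polar_disc rho0 h cuy).
- exact: continuous_sin.
Qed.

Let cPr (r : R) : `|r| < rho -> continuous (Pr r).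
Proof.
move=> h; apply: cvgD_cont; first exact: cUr.
have cc : continuous (fun t : R => cos t * sin t).
  by apply: cvgM_cont; [exact: continuous_cos|exact: continuous_sin].
apply: cvgM_cont; first exact: cst_cont.
apply: cvgD_cont; first apply: cvgD_cont.
- apply: cvgM_cont; first exact: (continuous_polar_disc rho0 h cuxx).
  by apply: cvgM_cont; exact: continuous_cos.
- apply: cvgM_cont => //; apply: cvgD_cont.
    exact: (continuous_polar_disc rho0 h cuxy).
  exact: (continuous_polar_disc rho0 h cuyx).
- apply: cvgM_cont; first exact: (continuous_polar_disc rho0 h cuyy).
  by apply: cvgM_cont; exact: continuous_sin.
Qed.

Let cUtt (r : R) : 0 < r < rho -> continuous (Utt r).
Proof.
move=> h; have /andP[r0 r1] := h; have rn : `|r| < rho by rewrite gtr0_norm.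
have -> : Utt r = fun t => - (mu ^+ 2 * r ^+ 2) * U r t + (- r) * Pr r t.
  by apply/funext => t; rewrite Pr_eq //; field; rewrite gt_eqF.
apply: cvgD_cont; apply: cvgM_cont; try exact: cst_cont.
  exact: cU.
exact: cPr.
Qed.

(** Domination for differentiating under the integral, on smaller discs because the derivatives may
    be unbounded near the circle. *)
Let bounded (b : R) : 0 <= b < rho -> exists2 M, 0 <= M & forall r t, `|r| <= b ->
  [/\ `|U r t| <= M, `|Ur r t| <= M & `|Pr r t| <= M].
Proof.
move=> hb; have b0 : 0 <= b by case/andP: hb.
have [M0 M00 h0] := polar_bounded hb cu.
have [M1 M10 h1] := polar_bounded hb cux.
have [M2 M20 h2] := polar_bounded hb cuy.
have [M3 M30 h3] := polar_bounded hb cuxx.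
have [M4 M40 h4] := polar_bounded hb cuxy.
have [M5 M50 h5] := polar_bounded hb cuyx.
have [M6 M60 h6] := polar_bounded hb cuyy.
have mulc (x y M : R) : `|x| <= M -> `|y| <= 1 -> `|x * y| <= M.
  move=> hx hy; rewrite normrM -[leRHS]mulr1; apply: ler_pM => //.
have c1 := @cos_max R; have s1 := @sin_max R.
have hr r t : `|r| <= b -> `|Ur r t| <= M1 + M2.
  move=> rb; apply: (le_trans (ler_normD _ _)); apply: lerD.
    by apply: mulc => //; exact: h1.
  by apply: mulc => //; exact: h2.
have hp r t : `|r| <= b -> `|Pr r t| <= M1 + M2 + b * (M3 + (M4 + M5) + M6).
  move=> rb; apply: (le_trans (ler_normD _ _)); apply: lerD; first exact: hr.
  rewrite normrM; apply: ler_pM => //.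
  apply: (le_trans (ler_normD _ _)); apply: lerD; last first.
    by apply: mulc; [exact: h6|rewrite normrX expr_le1].
  apply: (le_trans (ler_normD _ _)); apply: lerD.
    by apply: mulc; [exact: h3|rewrite normrX expr_le1].
  apply: mulc; last by rewrite normrM mulr_ile1.
  by apply: (le_trans (ler_normD _ _)); apply: lerD; [exact: h4|exact: h5].
have bM : 0 <= b * (M3 + (M4 + M5) + M6) by rewrite mulr_ge0 // !addr_ge0.
exists (M0 + (M1 + M2 + b * (M3 + (M4 + M5) + M6))); first by rewrite !addr_ge0.
move=> r t rb; split.
- by apply: (le_trans (h0 r t rb)); rewrite lerDl !addr_ge0.
- by apply: (le_trans (hr r t rb)); rewrite addrCA lerDl !addr_ge0.
- by apply: (le_trans (hp r t rb)); rewrite lerDr.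
Qed.

Section Coefficient.
Variables (k : nat) (ph : R).
(** The phase [ph] handles cosine and sine coefficients together. *)
Let e (t : R) := cos (k%:R * t + ph).
Let e' (t : R) := - k%:R * sin (k%:R * t + ph).

Let lin (t : R) : is_derive t 1 (fun t => k%:R * t + ph) (k%:R : R).
Proof.
by apply: (is_derive_eq (derD (is_derive_mulr_id k%:R t) (is_derive_cst ph t 1))); rewrite addr0.
Qed.
Let de (t : R) : is_derive t 1 e (e' t).
Proof.
apply: (is_derive_eq (derC (is_derive_cos _) (lin t))); rewrite /e'; ring.
Qed.
Let de' (t : R) : is_derive t 1 e' (- k%:R ^+ 2 * e t).
Proof.
apply: (is_derive_eq (derZ (- k%:R) (derC (is_derive_sin _) (lin t)))); rewrite /e; ring.
Qed.
Let ce : continuous e.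
Proof. by move=> x; exact: is_derive_continuous (de x). Qed.
Let e1 t : `|e t| <= 1. Proof. exact: cos_max. Qed.

Let per (n : nat) (x : R) : cos (x + 2 * pi * n%:R) = cos x /\ sin (x + 2 * pi * n%:R) = sin x.
Proof.
elim: n x => [|n IH] x; first by rewrite mulr0 addr0.
rewrite -[n.+1%:R]natr1 mulrDr mulr1 addrA; have [c s] := IH x.
by rewrite [2 * pi]mulr_natl cosD2pi sinD2pi -mulr_natl.
Qed.
Let e_per : e (2 * pi) = e 0.
Proof. by rewrite /e mulr0 add0r mulrC addrC (per k ph).1. Qed.
Let e'_per : e' (2 * pi) = e' 0.
Proof. by rewrite /e' mulr0 add0r [_ * (2 * pi)]mulrC addrC (per k ph).2. Qed.

Let A (r : R) := circle_int (fun t => U r t * e t).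
Let P (r : R) := circle_int (fun t => r * Ur r t * e t).

(** Two integrations by parts in one: [Utt e + k^2 U e] is the derivative of the periodic function
    [Ut e - U e']. *)
Let intUtt (r : R) : 0 < r < rho -> circle_int (fun t => Utt r t * e t) = - k%:R ^+ 2 * A r.
Proof.
move=> h; have /andP[r0 r1] := h; have rn : `|r| < rho by rewrite gtr0_norm.
have : circle_int (fun t => Utt r t * e t + k%:R ^+ 2 * (U r t * e t)) = 0.
  have d (t : R) : is_derive t 1 (fun t => Ut r t * e t - U r t * e' t) (Utt r t * e t + k%:R ^+ 2 * (U r t * e t)).
    apply: (is_derive_eq (derB (derM (dUt_t t rn) (de t)) (derM (dU_t t rn) (de' t)))).
    by ring.
  rewrite (circle_int_FTC d); last first.
    apply: cvgD_cont; first by apply: cvgM_cont; [exact: cUtt|exact: ce].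
    apply: cvgM_cont; first exact: cst_cont.
    by apply: cvgM_cont; [exact: cU|exact: ce].
  have -> : Ut r (2 * pi) = Ut r 0.
    by rewrite /Ut -[2 * pi]add0r polar2pi [2 * pi]mulr_natl cosD2pi sinD2pi.
  have -> : U r (2 * pi) = U r 0 by rewrite /U -[2 * pi]add0r polar2pi.
  by rewrite e_per e'_per subrr.
rewrite circle_intD ?circle_intZ.
- by move/eqP; rewrite addr_eq0 mulNr => /eqP.
- by apply: cvgM_cont; [exact: cU|exact: ce].
- by apply: cvgM_cont; [exact: cUtt|exact: ce].
- by apply: cvgM_cont; [exact: cst_cont|apply: cvgM_cont; [exact: cU|exact: ce]].
Qed.

Let dA (r : R) : 0 < r < rho -> is_derive r 1 A (P r / r).
Proof.
move=> h; have /andP[r0 r1] := h; have rn : `|r| < rho by rewrite gtr0_norm.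
pose b := (r + rho) / 2.
have [|M M0 hM] := bounded (b := b); first by rewrite /b; lra.
have -> : P r / r = circle_int (fun t => Ur r t * e t).
  rewrite /P (_ : (fun t => _) = (fun t => r * (Ur r t * e t))); last by apply/funext => t; rewrite mulrA.
  rewrite circle_intZ; first by field; rewrite gt_eqF.
  by apply: cvgM_cont; [exact: cUr|exact: ce].
apply: (@circle_int_derive _ (fun r t => U r t * e t) (fun r t => Ur r t * e t) 0 b r M).
- by rewrite /b; lra.
- move=> x xb; apply: cvgM_cont; last exact: ce.
  by apply: cU; rewrite gtr0_norm; rewrite /b in xb; lra.
- move=> x t xb; apply: (is_derive_eq (derM (dU_r t _) (is_derive_cst (e t) x 1))); last by rewrite mulr0 addr0.
  by rewrite gtr0_norm; rewrite /b in xb; lra.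
- move=> x t xb; rewrite normrM -[leRHS]mulr1; apply: ler_pM => //.
  have xb' : `|x| <= b by rewrite ger0_norm; lra.
  by have [] := hM x t xb'.
Qed.

Let dP (r : R) : 0 < r < rho -> is_derive r 1 P ((k%:R ^+ 2 / r - mu ^+ 2 * r) * A r).
Proof.
move=> h; have /andP[r0 r1] := h; have rn : `|r| < rho by rewrite gtr0_norm.
pose b := (r + rho) / 2.
have [|M M0 hM] := bounded (b := b); first by rewrite /b; lra.
have -> : (k%:R ^+ 2 / r - mu ^+ 2 * r) * A r = circle_int (fun t => Pr r t * e t).
  rewrite (_ : (fun t => Pr r t * e t) = (fun t => - (mu ^+ 2 * r) * (U r t * e t) + - r^-1 * (Utt r t * e t))); last first.
    by apply/funext => t; rewrite Pr_eq //; ring.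
  have cUe : continuous (fun t => U r t * e t) by apply: cvgM_cont; [exact: cU|exact: ce].
  have cUtte : continuous (fun t => Utt r t * e t) by apply: cvgM_cont; [exact: cUtt|exact: ce].
  rewrite circle_intD; try by apply: cvgM_cont; [exact: cst_cont|].
  by rewrite !circle_intZ // intUtt // -/(A r); field; rewrite gt_eqF.
apply: (@circle_int_derive _ (fun r t => r * Ur r t * e t) (fun r t => Pr r t * e t) 0 b r M).
- by rewrite /b; lra.
- move=> x xb; apply: cvgM_cont; last exact: ce.
  apply: cvgM_cont; first exact: cst_cont.
  by apply: cUr; rewrite gtr0_norm; rewrite /b in xb; lra.
- move=> x t xb; apply: (is_derive_eq (derM (dP_r t _) (is_derive_cst (e t) x 1))); last by rewrite mulr0 addr0.
  by rewrite gtr0_norm; rewrite /b in xb; lra.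
- move=> x t xb; rewrite normrM -[leRHS]mulr1; apply: ler_pM => //.
  have xb' : `|x| <= b by rewrite ger0_norm; lra.
  by have [] := hM x t xb'.
Qed.

(** [A] and [P = r A'] solve Bessel's system, and their bounds near 0 select the regular
    solution. *)
Let A_bj : exists c, forall r, 0 < r < rho -> A r = c * bj k (mu * r).
Proof.
move: (rho0) => rp; have [|M M0 hM] := bounded (b := rho / 2); first by apply/andP; split; lra.
apply: (@bessel_ode_sol _ k mu rho (M * (2 * pi)) A P) => //; near=> r.
  have r0 : 0 < r by near: r; exact: nbhs_right_gt.
  have r1 : r < rho / 2 by near: r; apply: nbhs_right_lt; lra.
  have rn : `|r| < rho by rewrite gtr0_norm //; lra.
  apply: circle_int_norm_le; first by apply: cvgM_cont; [exact: cU|exact: ce].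
  move=> t; rewrite normrM -[leRHS]mulr1; apply: ler_pM => //.
  have rb : `|r| <= rho / 2 by rewrite ger0_norm; lra.
  by have [] := hM r t rb.
have r0 : 0 < r by near: r; exact: nbhs_right_gt.
have r1 : r < rho / 2 by near: r; apply: nbhs_right_lt; lra.
have rn : `|r| < rho by rewrite gtr0_norm //; lra.
have -> : M * (2 * pi) * r = r * M * (2 * pi) by ring.
apply: circle_int_norm_le.
  by apply: cvgM_cont; [apply: cvgM_cont; [exact: cst_cont|exact: cUr]|exact: ce].
move=> t; rewrite normrM -[leRHS]mulr1; apply: ler_pM => //.
rewrite normrM gtr0_norm // ler_pM2l //.
have rb : `|r| <= rho / 2 by rewrite ger0_norm; lra.
by have [] := hM r t rb.
Unshelve. all: by end_near. Qed.

(** As [u] is continuous only within the closed disc, the radius is clamped to [min |r| rho]: the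
    integrand becomes continuous and bounded for all real [r], and the limit passes under the
    integral. *)
Let A_boundary : A x @[x --> rho^'-] --> 0.
Proof.
move: (rho0) => rp; have [M M0 hM] := closed_disc_bounded cclosed.
pose f (r t : R) := u (polar (Num.min `|r| rho) t) * e t.
have dcl r t : closed_disc rho (polar (Num.min `|r| rho) t).
  apply: polar_closed_disc; rewrite ger0_norm ?ge_min ?lexx ?orbT //.
  by rewrite le_min normr_ge0 ltW.
have cf r : continuous (f r).
  apply: cvgM_cont; last exact: ce.
  apply: (@within_continuous_comp _ _ (closed_disc rho) u (polar (Num.min `|r| rho))) => //.
  exact: continuous_polar.
have cf' t : continuous (f ^~ t).
  apply: cvgM_cont; last exact: cst_cont.
  apply: (@within_continuous_comp _ _ (closed_disc rho) u (fun r => polar (Num.min `|r| rho) t)) => //.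
  have c1 : continuous (fun r : R => Num.min `|r| rho).
    by move=> x; apply: continuous_min; [exact: norm_continuous|exact: cst_cont].
  by move=> x; exact: (continuous_comp (c1 x) (@continuous_polar_r R t _)).
have I := @continuity_under_integral R _ _ (@lebesgue_measure R) f _ (measurable_itv `[0%R, (2 * pi)%R]) 0 (2 * rho)
  (fun x _ => continuous_integrable 0 (2 * pi) (cf x)).
have fM r t : `|f r t| <= M.
  by rewrite normrM -[leRHS]mulr1; apply: ler_pM => //; exact: hM.
have F0 : circle_int (f rho) = 0.
  rewrite (_ : f rho = fun=> 0) ?circle_int_cst ?mul0r //.
  apply/funext => t; rewrite /f u_circle ?mul0r // /circle /= polar_sqr gtr0_norm // minxx //.
have C : {for rho, continuous (fun r => circle_int (f r))}.
  apply: (I _ (fun=> M)).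
  - by apply: aeW => y _ x _; exact: cf'.
  - by apply: continuous_integrable; exact: cst_cont.
  - by move=> x _; apply: aeW => y _; exact: fM.
  - by rewrite inE /= in_itv /=; lra.
have L : circle_int (f x) @[x --> rho^'-] --> 0.
  by rewrite -[X in _ --> X]F0; apply: cvg_at_left_filter; exact: C.
apply: cvg_trans L; apply: near_eq_cvg; near=> x.
have x0 : 0 < x by near: x; exact: nbhs_left_gt.
have x1 : x < rho by near: x; exact: nbhs_left_lt.
by rewrite /A /f /U gtr0_norm // min_l // ltW.
Unshelve. all: by end_near. Qed.

Lemma polar_fourier_coef_eq0 r : 0 < r < rho -> bj k (mu * rho) != 0 ->
  circle_int (fun t => U r t * e t) = 0.
Proof.
move=> rr b0; have [c hc] := A_bj; rewrite -/(A r) (hc r rr).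
suff : c * bj k (mu * rho) = 0 by move/eqP; rewrite mulf_eq0 (negbTE b0) orbF => /eqP ->; rewrite mul0r.
have cb : {for rho, continuous (fun r : R => c * bj k (mu * r))}.
  apply: cvgM; first exact: cvg_cst.
  apply: (@continuous_comp _ _ _ (fun x : R => mu * x) (bj k)); last exact: continuous_bj.
  exact: is_derive_continuous (is_derive_mulr_id mu rho).
have L : c * bj k (mu * x) @[x --> rho^'-] --> c * bj k (mu * rho) by exact: cvg_at_left_filter.
rewrite -(cvg_lim _ L) //; apply/cvg_lim => //.
apply: cvg_trans A_boundary; apply: near_eq_cvg; near=> x.
apply: hc; apply/andP; split; near: x; [exact: nbhs_left_gt|exact: nbhs_left_lt].
Unshelve. all: by end_near. Qed.

Lemma polar_Utt_coef r : 0 < r < rho -> circle_int (fun t => Utt r t * e t) = - k%:R ^+ 2 * circle_int (fun t => U r t * e t).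
Proof. exact: intUtt. Qed.

End Coefficient.

Let U_per (r x : R) : U r (x + 2 * pi) = U r x.
Proof. by rewrite /U polar2pi. Qed.

Let Utt_per (r x : R) : Utt r (x + 2 * pi) = Utt r x.
Proof. by rewrite /Utt /Ur polar2pi [2 * pi]mulr_natl cosD2pi sinD2pi. Qed.

Let cos_lin_cont (k : nat) (ph : R) : continuous (fun t : R => cos (k%:R * t + ph)).
Proof.
move=> x; apply: (@continuous_comp _ _ _ (fun x : R => k%:R * x + ph) cos); last exact: continuous_cos.
by apply: cvgD; [apply: cvgM; [exact: cvg_cst|exact: cvg_id]|exact: cvg_cst].
Qed.

Lemma polar_eq0 : (forall k, bj k (mu * rho) != 0) ->
  forall r t, 0 < r < rho -> - (2 * pi) < t < 2 * pi -> u (polar r t) = 0.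
Proof.
move=> hb r t rr; have /andP[r0 r1] := rr; have rn : `|r| < rho by rewrite gtr0_norm.
apply: (fourier_uniqueness_periodic (V := U r)); [exact: cU|exact: U_per|].
by move=> k ph; exact: polar_fourier_coef_eq0.
Qed.

(** All Fourier coefficients of [Utt + m^2 U] vanish: those of order [m] by [polar_Utt_coef], the
    others because [bj_bourget] leaves [m] as the only order with a zero at [mu rho]. *)
Lemma polar_angular_ode m : bj m (mu * rho) = 0 ->
  forall r t, 0 < r < rho -> - (2 * pi) < t < 2 * pi -> Utt r t = - m%:R ^+ 2 * U r t.
Proof.
move=> hb r t rr; have /andP[r0 r1] := rr; have rn : `|r| < rho by rewrite gtr0_norm.
have mr0 : 0 < mu * rho by rewrite mulr_gt0.
move=> tt; apply/eqP; rewrite mulNr -addr_eq0; apply/eqP; move: t tt.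
apply: (fourier_uniqueness_periodic (V := fun t => Utt r t + m%:R ^+ 2 * U r t)).
- apply: cvgD_cont; first exact: cUtt.
  by apply: cvgM_cont; [exact: cst_cont|exact: cU].
- by move=> x; rewrite Utt_per U_per.
move=> k ph.
have c1 : continuous (fun t => Utt r t * cos (k%:R * t + ph)).
  by apply: cvgM_cont; [exact: cUtt|exact: cos_lin_cont].
have c2 : continuous (fun t => U r t * cos (k%:R * t + ph)).
  by apply: cvgM_cont; [exact: cU|exact: cos_lin_cont].
rewrite (_ : (fun x => _) = (fun t => Utt r t * cos (k%:R * t + ph) + m%:R ^+ 2 * (U r t * cos (k%:R * t + ph)))); last first.
  by apply/funext => t; rewrite mulrDl mulrA.
rewrite circle_intD //; last by apply: cvgM_cont; [exact: cst_cont|].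
rewrite circle_intZ // polar_Utt_coef //.
have [->|km] := eqVneq k m; first by rewrite mulNr addNr.
rewrite (polar_fourier_coef_eq0 ph rr) ?mulr0 ?addr0 //.
apply: contra km => /eqP hk; apply/eqP.
have bes0 j : bj j (mu * rho) = 0 -> bes j ((mu * rho) ^+ 2 / 4) = 0.
  by rewrite /bj => /eqP; rewrite mulf_eq0 expf_eq0 (gt_eqF mr0) andbF => /eqP.
have x0 : 0 < (mu * rho) ^+ 2 / 4 by rewrite divr_gt0 // exprn_gt0.
exact: (bj_bourget x0 (bes0 _ hk) (bes0 _ hb)).
Qed.

(** Once the angular equation holds, [U] at a fixed angle satisfies Bessel's system itself, with no
    integration over the circle. *)
Lemma polar_radial m : bj m (mu * rho) = 0 -> forall t, - (2 * pi) < t < 2 * pi ->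
  exists c, forall r, 0 < r < rho -> u (polar r t) = c * bj m (mu * r).
Proof.
move=> hb t tt; move: (rho0) => rp; have [|M M0 hM] := bounded (b := rho / 2).
  by apply/andP; split; lra.
have nr (r : R) : 0 < r < rho -> `|r| < rho by case/andP => r0 r1; rewrite gtr0_norm.
apply: (@bessel_ode_sol _ m mu rho M (U^~ t) (fun r => r * Ur r t)) => //.
- move=> r rr; have /andP[r0 _] := rr; have -> : r * Ur r t / r = Ur r t by field; rewrite gt_eqF.
  by apply: dU_r; exact: nr.
- move=> r rr; have /andP[r0 _] := rr; apply: (is_derive_eq (dP_r t (nr r rr))).
  by rewrite Pr_eq // (polar_angular_ode hb) //; field; rewrite gt_eqF.
- near=> r; have rb : `|r| <= rho / 2.
    have r0 : 0 < r by near: r; exact: nbhs_right_gt.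
    have r1 : r < rho / 2 by near: r; apply: nbhs_right_lt; lra.
    by rewrite gtr0_norm // ltW.
  by have [] := hM r t rb.
- near=> r; have r0 : 0 < r by near: r; exact: nbhs_right_gt.
  have r1 : r < rho / 2 by near: r; apply: nbhs_right_lt; lra.
  have rb : `|r| <= rho / 2 by rewrite gtr0_norm // ltW.
  by rewrite normrM gtr0_norm // mulrC ler_pM2r //; have [] := hM r t rb.
Unshelve. all: by end_near. Qed.

(** A nonzero value at the centre is moved off it by continuity, since the polar formulas are for
    [r > 0]. *)
Lemma polar_nonzero : (exists2 z, disc rho z & u z != 0) ->
  exists r t, [/\ 0 < r < rho, 0 <= t < 2 * pi & u (polar r t) != 0].
Proof.
move=> [z dz uz]; have pi0 : 0 < pi :> R := pi_gt0 R.
have [r [t [r0 r2 tt zE]]] := polarP z.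
have rr : r < rho.
  by rewrite -(ltr_pXn2r (n := 2)) ?nnegrE // ?(ltW rho0) // r2; exact: dz.
move: r0; rewrite le_eqVlt => /predU1P[r0|r0]; last by exists r, t; split; rewrite ?r0 // -zE.
apply: contrapT => h; have hz s : 0 < s < rho -> u (polar s 0) = 0.
  move=> ss; apply: contrapT => /eqP us; apply: h; exists s, 0; split => //.
  by rewrite lexx mulr_gt0.
move/eqP: uz; apply; rewrite zE -r0 (_ : polar 0 t = polar 0 0); last by rewrite /polar !mul0r.
have L : u (polar x 0) @[x --> 0^'+] --> u (polar 0 0).
  apply: cvg_at_right_filter; apply: (continuous_comp (@continuous_polar_r R 0 0)); apply: cu.
  by apply: polar_disc; rewrite ?normr0.
rewrite -(cvg_lim _ L) //; apply/cvg_lim => //; apply: cvg_near_cst; near=> x; apply: hz.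
by apply/andP; split; near: x; [exact: nbhs_right_gt|exact: nbhs_right_lt].
Unshelve. all: by end_near. Qed.

Lemma polar_separation : (exists2 z, disc rho z & u z != 0) ->
  exists (m : nat) (a b : R), [/\ bj m (mu * rho) = 0, (a != 0) || ((b != 0) && (0 < m)%N) &
    forall r t, 0 < r < rho -> 0 <= t < 2 * pi ->
      u (polar r t) = (a * cos (m%:R * t) + b * sin (m%:R * t)) * bj m (mu * r)].
Proof.
move=> /polar_nonzero [r2 [t2 [rr2 tt2 u2]]]; move: (rho0) => rp.
have pi0 : 0 < pi :> R := pi_gt0 R.
have tw t : 0 <= t < 2 * pi -> - (2 * pi) < t < 2 * pi.
  by move=> /andP[t0 t1]; apply/andP; split; lra.
have [m hm] : exists m, bj m (mu * rho) = 0.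
  apply: contrapT => h; move/eqP: u2; apply; apply: polar_eq0 => //; last exact: tw.
  by move=> k; apply/negP => /eqP hk; apply: h; exists k.
have [j [j0 hj0 hj]] := @bj_first_zero R m.
(* A radius before the first zero of the radial factor; the circle of this radius carries the
   angular factor. *)
have [r1 rr1 b1] : exists2 r1, 0 < r1 < rho & bj m (mu * r1) != 0.
  exists (Num.min (rho / 2) (j / (2 * mu))).
    by rewrite lt_min gt_min !divr_gt0 ?mulr_gt0 //=; apply/orP; left; lra.
  apply: hj; apply/andP; split; first by rewrite mulr_gt0 // lt_min !divr_gt0 ?mulr_gt0.
  rewrite -ltr_pdivlMl // gt_min; apply/orP; right.
  by rewrite invfM mulrA [_ / mu]mulrC ltr_pM2l ?invr_gt0 // ltr_pdivrMr // ltr_pMr // ltr1n.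
pose B := bj m (mu * r1).
have /andP[r10 r11] := rr1; have rn : `|r1| < rho by rewrite gtr0_norm.
have main r t : 0 < r < rho -> - (2 * pi) < t < 2 * pi -> U r t = U r1 t / B * bj m (mu * r).
  move=> rr tt; have [c hc] := polar_radial hm tt.
  by rewrite /U (hc r1) // (hc r) // mulfK.
have dC (t : R) : is_derive t 1 (U r1) (Ut r1 t) by exact: dU_t.
have dC' (t : R) : - (2 * pi) < t < 2 * pi -> is_derive t 1 (Ut r1) (- m%:R ^+ 2 * U r1 t).
  by move=> tt; rewrite -(polar_angular_ode hm) //; exact: dUt_t.
have [a [b hab]] : exists a b, forall t, - (2 * pi) < t < 2 * pi ->
    U r1 t = a * cos (m%:R * t) + b * sin (m%:R * t).
  apply: (@oscillator_sol R m (U r1) (Ut r1)) => //; first by rewrite mulr_gt0.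
  have -> : 2 * pi / 2 = pi :> R by field.
  by rewrite -[in LHS]U_per; congr (U r1 _); ring.
have B0 : B != 0 := b1.
exists m, (a / B), (b / B); split => //; last first.
  by move=> r t rr tt; rewrite -/(U r t) main ?hab //; try exact: tw; field.
apply: contraNT u2; rewrite negb_or negb_and !negbK mulf_eq0 invr_eq0 (negbTE B0) orbF => /andP[/eqP a0].
rewrite -/(U r2 t2) main //; last exact: tw.
rewrite hab ?a0; last exact: tw.
rewrite mul0r add0r mulf_eq0 invr_eq0 (negbTE B0) orbF -leqNgt leqn0 => /orP[/eqP ->|/eqP ->].
  by rewrite !mul0r.
by rewrite mul0r sin0 mulr0 !mul0r.
Qed.

End Separation.

(** * Upper bound for the nodal ratio *)

Section UpperBound.
Variable R : realType.

Lemma eigenfunction_separation (rho lambda : R) u : 0 < rho -> 0 < lambda ->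
  dirichlet_eigenfunction rho lambda u ->
  exists (m : nat) (a b : R), [/\ bj m (Num.sqrt lambda * rho) = 0, (a != 0) || ((b != 0) && (0 < m)%N) &
    forall r t, 0 < r < rho -> 0 <= t < 2 * pi ->
      u (polar r t) = (a * cos (m%:R * t) + b * sin (m%:R * t)) * bj m (Num.sqrt lambda * r)].
Proof.
move=> rho0 lambda0 [[C1u C1x C1y] cu pde u0 unz].
have dx : @dir_x R \in [:: dir_x; dir_y] by rewrite !inE eqxx.
have dy : @dir_y R \in [:: dir_x; dir_y] by rewrite !inE eqxx orbT.
have G f : C1_on (disc rho) f -> polar_grad rho f ('D_dir_x f) ('D_dir_y f).
  move=> cf r t h; have d := polar_disc t rho0 h.
  by split; [exact: polar_derive_r cf d|exact: polar_derive_t cf d].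
have cD f v z : C1_on (disc rho) f -> v \in [:: dir_x; dir_y] -> disc rho z -> {for z, continuous ('D_v f)}.
  by move=> cf vin dz; have [_ c] := cf v vin z dz; exact: c.
have mu0 : 0 < Num.sqrt lambda by rewrite sqrtr_gt0.
move Ex : ('D_dir_x u) => ux; move Ey : ('D_dir_y u) => uy.
have pde' z : disc rho z -> - ('D_dir_x ux z + 'D_dir_y uy z) = Num.sqrt lambda ^+ 2 * u z.
  by move=> dz; rewrite sqr_sqrtr ?(ltW lambda0) // -(pde z dz) -Ex -Ey.
have Gu := G u C1u.
have cux z : disc rho z -> {for z, continuous ux} by rewrite -Ex => dz; exact: (cD _ _ _ C1u dx dz).
have cuy z : disc rho z -> {for z, continuous uy} by rewrite -Ey => dz; exact: (cD _ _ _ C1u dy dz).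
rewrite Ex in C1x Gu; rewrite Ey in C1y Gu.
have cu' z : disc rho z -> {for z, continuous u} by exact: within_continuous_at.
have H0 := polar_separation rho0 mu0 Gu.
have H1 := H0 _ _ _ _ (G _ C1x) (G _ C1y) cu' cux cuy.
have H2 := H1 (fun z => cD _ _ z C1x dx) (fun z => cD _ _ z C1x dy) (fun z => cD _ _ z C1y dx) (fun z => cD _ _ z C1y dy).
have H3 := H2 pde' cu u0 unz.
exact: H3.
Qed.

Lemma sin_eq0 n (y : R) : 0 <= y < n%:R * pi -> sin y = 0 -> exists2 l : 'I_n, True & y = l%:R * pi.
Proof.
have pi0 : 0 < pi :> R := pi_gt0 R.
elim: n y => [|n IH] y; first by rewrite mul0r => /andP[/le_lt_trans h /h]; rewrite ltxx.
move=> /andP[y0 yn] sy; have [yp|yp] := ltP y pi.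
  move: y0; rewrite le_eqVlt => /predU1P[<-|y0]; first by exists ord0; rewrite ?mul0r.
  by have := @sin_gt0_pi R y; rewrite y0 yp sy ltxx => /(_ isT).
have [||l _ lE] := IH (y - pi).
- by rewrite subr_ge0 yp ltrBlDr (lt_le_trans yn) // -natr1 mulrDl mul1r.
- by rewrite sinB cospi sinpi sy mul0r mulr0 subr0.
- by exists (lift ord0 l) => //; rewrite lift0 -natr1 mulrDl mul1r -lE subrK.
Qed.

Lemma sin_form (a b : R) : (a != 0) || (b != 0) -> exists beta s, [/\ 0 <= beta < pi, s != 0 &
  forall x, a * cos x + b * sin x = s * sin (x - beta)].
Proof.
have pi0 : 0 < pi :> R := pi_gt0 R.
have [->|a0] /= := eqVneq a 0.
  by move=> b0; exists 0, b; rewrite lexx pi0; split=> // x; rewrite mul0r add0r subr0.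
move=> _; pose n := Num.sqrt (a ^+ 2 + b ^+ 2).
have n2 : n ^+ 2 = a ^+ 2 + b ^+ 2 by rewrite sqr_sqrtr // addr_ge0 ?sqr_ge0.
have n0 : 0 < n by rewrite sqrtr_gt0 ltr_pwDl ?sqr_ge0 // lt_neqAle sqr_ge0 eq_sym sqrf_eq0 a0.
(* The sign opposite to [a] makes [sin beta = - a / s] positive, so that [acos] gives [beta] in [0,
   pi). *)
pose s := - Num.sg a * n; have s2 : s ^+ 2 = a ^+ 2 + b ^+ 2.
  by rewrite /s exprMn sqrrN sqr_sg a0 mul1r.
have s0 : s != 0 by rewrite -sqrf_eq0 s2 -n2 sqrf_eq0 gt_eqF.
have c1 : -1 <= b / s <= 1.
  rewrite -ler_norml -(ler_pXn2r (n := 2)) ?nnegrE // -normrX ger0_norm ?sqr_ge0 // expr1n.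
  by rewrite expr_div_n s2 ler_pdivrMr ?mul1r ?lerDr ?sqr_ge0 // -s2 lt_neqAle sqr_ge0 eq_sym sqrf_eq0 s0.
have ca : cos (acos (b / s)) = b / s by rewrite acosK // in_itv.
have sa : sin (acos (b / s)) = - a / s.
  rewrite sin_acos // (_ : 1 - _ = (- a / s) ^+ 2); last first.
    by rewrite !expr_div_n s2 sqrrN; field; rewrite -s2 sqrf_eq0.
  rewrite sqrtr_sqr ger0_norm // /s; have [ap|an|e] := ltgtP a 0.
  - by rewrite ltr0_sg // opprK mul1r divr_ge0 ?oppr_ge0 ?ltW.
  - by rewrite gtr0_sg // mulN1r invrN mulrNN divr_ge0 ?ltW.
  - by rewrite e oppr0 mul0r.
exists (acos (b / s)), s; split => // [|x].
  rewrite acos_ge0 //= lt_neqAle acos_lepi // andbT; apply/eqP => e.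
  by move/eqP: sa; rewrite e sinpi eq_sym mulf_eq0 oppr_eq0 invr_eq0 (negbTE a0) (negbTE s0).
by rewrite sinB ca sa; field.
Qed.

(** The hypothesis rules out a vanishing angular factor, also at [m = 0], where the sine disappears.
    On [0, 2 pi) the phase [m t - beta] runs over a half-open interval of length [2 pi m], with at
    most [2 m] multiples of pi. *)
Lemma trig_zeros (m : nat) (a b : R) : (a != 0) || ((b != 0) && (0 < m)%N) ->
  exists th : 'I_(m + m) -> R, forall t, 0 <= t < 2 * pi ->
    a * cos (m%:R * t) + b * sin (m%:R * t) = 0 -> exists i, t = th i.
Proof.
have pi0 : 0 < pi :> R := pi_gt0 R.
case: m => [|m]; first by rewrite andbF orbF => a0; exists (fun=> 0) => t _ /eqP; rewrite mul0r cos0 sin0 mulr1 mulr0 addr0 (negbTE a0).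
rewrite andbT => /sin_form [beta [s [/andP[b0 b1] s0 E]]].
have m0 : 0 < m.+1%:R :> R by rewrite ltr0n.
exists (fun i => (i%:R * pi + beta) / m.+1%:R) => t /andP[t0 t1] /eqP.
rewrite E mulf_eq0 (negbTE s0) => /eqP st.
have mt0 : 0 <= m.+1%:R * t by rewrite mulr_ge0 // ltW.
have mt1 : m.+1%:R * t < (m.+1 + m.+1)%:R * pi.
  by rewrite (_ : _ * pi = m.+1%:R * (2 * pi)) ?ltr_pM2l // natrD; ring.
have yge : 0 <= m.+1%:R * t - beta.
  rewrite leNgt; apply/negP => yl.
  have := @sin_gt0_pi R (- (m.+1%:R * t - beta)); rewrite sinN st oppr0 ltxx => h.
  have : false by apply: h; apply/andP; split; lra.
  by [].
have [|l _ lE] := @sin_eq0 (m.+1 + m.+1) (m.+1%:R * t - beta) _ st.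
  by rewrite yge /=; lra.
by exists l; rewrite -lE subrK; field; rewrite gt_eqF.
Qed.


Lemma edist_polar_r (r s t : R) : edist (polar r t) (polar s t) = `|r - s|.
Proof.
rewrite /edist /= -!mulrBl !exprMn -mulrDr cos2Dsin2 mulr1 sqrtr_sqr //.
Qed.

(** A chord has length [2 r |sin((s - t)/2)|]. *)
Lemma edist_polar_t (r s t : R) : 0 <= r -> edist (polar r s) (polar r t) <= r * `|s - t|.
Proof.
move=> r0; rewrite -[leRHS]ger0_norm; last by rewrite mulr_ge0.
rewrite -sqrtr_sqr; apply: ler_wsqrtr; rewrite exprMn real_normK ?num_real //.
have -> : ((polar r s).1 - (polar r t).1) ^+ 2 + ((polar r s).2 - (polar r t).2) ^+ 2 =
    r ^+ 2 * (2 - 2 * cos (s - t)).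
  rewrite cosB /polar /=; transitivity (r ^+ 2 * ((cos s ^+ 2 + sin s ^+ 2) + (cos t ^+ 2 + sin t ^+ 2)
    - 2 * (cos s * cos t + sin s * sin t))); first by ring.
  by rewrite !cos2Dsin2.
apply: ler_wpM2l; first exact: sqr_ge0.
have sin_le (x : R) : `|sin x| <= `|x|.
  have [c _] := @mvt_between R sin cos 0 x (fun y _ => is_derive_sin y).
  rewrite sin0 !subr0 => ->; rewrite normrM -[leRHS]mul1r; apply: ler_wpM2r => //.
  exact: cos_max.
have -> : 2 - 2 * cos (s - t) = 4 * sin ((s - t) / 2) ^+ 2.
  rewrite {1}(_ : s - t = (s - t) / 2 + (s - t) / 2); last by field.
  rewrite cosD -!expr2 cos2sin2; ring.
rewrite -[_ ^+ 2]real_normK ?num_real //.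
apply: (@le_trans _ _ (4 * `|(s - t) / 2| ^+ 2)).
  by rewrite ler_pM2l // lerXn2r ?nnegrE.
by rewrite real_normK ?num_real // le_eqVlt; apply/orP; left; apply/eqP; field.
Qed.

(** Circles contribute [2 pi sum z / mu] and the [2 m] radii [2 m rho]; with [x = mu rho] the ratio
    is at most [(2 / mu^2) (m x + pi sum z) <= 2 rho^2]. The extra curve of length 0 is the origin,
    to which the polar formula does not apply. *)
Lemma nodal_ratio_le (rho lambda : R) u : 0 < rho -> 0 < lambda ->
  dirichlet_eigenfunction rho lambda u -> (nodal_ratio rho lambda u <= (2 * rho ^+ 2)%:E)%E.
Proof.
move=> rho0 lambda0 hu; have [m [a [b [hm ab hU]]]] := eigenfunction_separation rho0 lambda0 hu.
have pi0 : 0 < pi :> R := pi_gt0 R.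
move: hm hU; rewrite /nodal_ratio; move: (Num.sqrt lambda) (sqrtr_gt0 lambda); rewrite lambda0 => mu mu0 hm hU.
have x0 : 0 < mu * rho by rewrite mulr_gt0.
have [n [z [z0 hz zle]]] := bj_zeros_cover x0 hm.
have [th hth] := trig_zeros ab.
pose r i := z i / mu.
have r0 i : 0 <= r i by rewrite divr_ge0 // ltW.
pose g (i : 'I_(1 + (n + (m + m)))) (s : R) : R * R := match fintype.split i with
  | inl _ => (0, 0)
  | inr j => match fintype.split j with
    | inl k => polar (r k) (s * (2 * pi))
    | inr k => polar (s * rho) (th k) end end.
pose L (i : 'I_(1 + (n + (m + m)))) : R := match fintype.split i with
  | inl _ => 0
  | inr j => match fintype.split j with
    | inl k => 2 * pi * r k
    | inr k => rho end end.
have L0 i : 0 <= L i.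
  rewrite /L; case: (fintype.split _) => // j; case: (fintype.split _) => k; last exact: ltW.
  by rewrite mulr_ge0 // ltW // mulr_gt0.
have lip i s t : 0 <= s <= 1 -> 0 <= t <= 1 -> edist (g i s) (g i t) <= L i * `|s - t|.
  move=> _ _; rewrite /g /L; case: (fintype.split _) => [_|j].
    by rewrite /edist subrr expr0n addr0 sqrtr0 mul0r.
  case: (fintype.split _) => k.
    apply: (le_trans (edist_polar_t _ _ _)) => //.
    rewrite -mulrBl normrM (gtr0_norm (_ : 0 < 2 * pi)) ?mulr_gt0 //.
    by rewrite [r k * _]mulrCA mulrC [r k * _]mulrC.
  rewrite edist_polar_r -mulrBl normrM (gtr0_norm rho0) mulrC //.
have cover x : nodal_set rho u x -> exists i t, 0 <= t <= 1 /\ x = g i t.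
  move=> [dx ux]; have [s [t [s0 s2 tt xE]]] := polarP x.
  move: s0; rewrite le_eqVlt => /predU1P[s0|s0].
    exists (lshift _ ord0), 0; rewrite lexx ler01; split => //.
    by rewrite /g (unsplitK (inl _)) xE -s0 /polar !mul0r.
  have srho : s < rho by rewrite -(ltr_pXn2r (n := 2)) ?nnegrE ?(ltW s0) ?(ltW rho0) // s2.
  have : u (polar s t) = 0 by rewrite -xE.
  rewrite hU ?s0 // => /eqP; rewrite mulf_eq0 => /orP[/eqP h|/eqP h].
    have [k tE] := hth t tt h.
    exists (rshift _ (rshift _ k)), (s / rho); split.
      by apply/andP; split; [apply: divr_ge0 => //; exact: ltW|rewrite ler_pdivrMr // mul1r ltW].
    by rewrite /g (unsplitK (inr _)) (unsplitK (inr _)) xE tE mulfVK ?gt_eqF.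
  have [|k zE] := hz (mu * s) _ h; first by rewrite mulr_gt0 //= ltr_pM2l.
  exists (rshift _ (lshift _ k)), (t / (2 * pi)).
  have pp : 0 < 2 * pi :> R by rewrite mulr_gt0.
  case/andP: tt => t0 t1; split.
    by apply/andP; split; [apply: divr_ge0 => //; exact: ltW|rewrite ler_pdivrMr // mul1r ltW].
  rewrite /g (unsplitK (inr _)) (unsplitK (inl _)) xE mulfVK ?gt_eqF //; congr polar.
  by rewrite /r -zE; field; rewrite gt_eqF.
have H := hausdorff1_le_curves L0 lip cover.
have -> : (2 * rho ^+ 2)%:E = ((2 * rho ^+ 2 * mu)%:E * (mu^-1)%:E)%E.
  by rewrite -EFinM mulfK // gt_eqF.
apply: lee_wpmul2r; first by rewrite lee_fin invr_ge0 ltW.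
apply: (le_trans H); rewrite lee_fin.
have -> : \sum_i L i = 2 * pi * (\sum_k r k) + (m + m)%:R * rho.
  rewrite big_split_ord /= big_ord1 {1}/L (unsplitK (inl _)) add0r big_split_ord /= mulr_sumr; congr (_ + _).
    by apply: eq_bigr => k _; rewrite /L (unsplitK (inr _)) (unsplitK (inl _)).
  rewrite -[in RHS](card_ord (m + m)) mulr_natl -sumr_const; apply: eq_bigr => k _.
  by rewrite /L (unsplitK (inr _)) (unsplitK (inr _)).
have -> : \sum_k r k = (\sum_k z k) / mu by rewrite mulr_suml.
rewrite -(ler_pM2r mu0); apply: (@le_trans _ _ (2 * (m%:R * (mu * rho) + pi * \sum_i z i))).
  rewrite le_eqVlt; apply/orP; left; apply/eqP; rewrite natrD; field; rewrite gt_eqF //.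
apply: (le_trans (_ : _ <= 2 * (mu * rho) ^+ 2)); first by rewrite ler_pM2l.
by rewrite le_eqVlt; apply/orP; left; apply/eqP; ring.
Qed.

End UpperBound.

(** * Eigenfunctions with straight nodal lines *)

Section Eigenfunctions.
Variable R : realType.

(* Expressions closed under partial derivatives; [EF j] stands for
   [bes j (c (x^2 + y^2))]. *)
Inductive expr := EX | EY | EC of R | EF of nat | EA of expr & expr | EM of expr & expr.

Variable c : R.

Fixpoint eval (e : expr) (z : R * R) : R :=
  match e with
  | EX => z.1
  | EY => z.2
  | EC a => a
  | EF j => bes j (c * (z.1 ^+ 2 + z.2 ^+ 2))
  | EA e1 e2 => eval e1 z + eval e2 z
  | EM e1 e2 => eval e1 z * eval e2 z
  end.

(** Differentiation along [(a, b)] is syntactic, so regularity of every order follows from one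
    induction on expressions. *)
Fixpoint ediff (a b : R) (e : expr) : expr :=
  match e with
  | EX => EC a
  | EY => EC b
  | EC _ => EC 0
  | EF j => EM (EC (- (2 * c))) (EM (EA (EM (EC a) EX) (EM (EC b) EY)) (EF j.+1))
  | EA e1 e2 => EA (ediff a b e1) (ediff a b e2)
  | EM e1 e2 => EA (EM (ediff a b e1) e2) (EM e1 (ediff a b e2))
  end.

Lemma continuous_eval e : continuous (eval e).
Proof.
elim: e => [||a|j|e1 h1 e2 h2|e1 h1 e2 h2] z /=; try exact: cvg_cst.
- exact: cvg_fst.
- exact: cvg_snd.
- apply: (@continuous_comp _ _ _ (fun z : R * R => c * (z.1 ^+ 2 + z.2 ^+ 2)) (bes j)); last exact: continuous_bes.
  apply: cvgM; first exact: cvg_cst.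
  by apply: cvgD; apply: continuousM; (exact: cvg_fst || exact: cvg_snd).
- by apply: cvgD; [exact: h1|exact: h2].
- by apply: cvgM; [exact: h1|exact: h2].
Qed.

Lemma is_derive_eval_x e z : is_derive z dir_x (eval e) (eval (ediff 1 0 e) z).
Proof.
apply/is_derive_slice_x; elim: e => [||a|j|e1 h1 e2 h2|e1 h1 e2 h2] /=.
- exact: is_derive_id.
- exact: is_derive_cst.
- exact: is_derive_cst.
- have i := derX 2 z.1; have i2 := is_derive_cst (z.2 ^+ 2) z.1 1.
  have h := derZ c (derD i i2).
  by apply: (is_derive_eq (derC (is_derive_bes j _) h)) => /=; ring.
- exact: derD h1 h2.
- by have := derM h1 h2; rewrite -surjective_pairing.
Qed.

Lemma is_derive_eval_y e z : is_derive z dir_y (eval e) (eval (ediff 0 1 e) z).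
Proof.
apply/is_derive_slice_y; elim: e => [||a|j|e1 h1 e2 h2|e1 h1 e2 h2] /=.
- exact: is_derive_cst.
- exact: is_derive_id.
- exact: is_derive_cst.
- have i := derX 2 z.2; have i2 := is_derive_cst (z.1 ^+ 2) z.2 1.
  have h := derZ c (derD i2 i).
  by apply: (is_derive_eq (derC (is_derive_bes j _) h)) => /=; ring.
- exact: derD h1 h2.
- by have := derM h1 h2; rewrite -surjective_pairing.
Qed.

Lemma derive_eval_x e : 'D_dir_x (eval e) = eval (ediff 1 0 e).
Proof. by apply/funext => z; have h := is_derive_eval_x e z; rewrite derive_val. Qed.

Lemma derive_eval_y e : 'D_dir_y (eval e) = eval (ediff 0 1 e).
Proof. by apply/funext => z; have h := is_derive_eval_y e z; rewrite derive_val. Qed.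

Lemma C1_on_eval A e : C1_on A (eval e).
Proof.
move=> v; rewrite !inE => /orP[] /eqP -> z _; split.
- by have h := is_derive_eval_x e z; exact: ex_derive.
- by rewrite derive_eval_x; exact: continuous_eval.
- by have h := is_derive_eval_y e z; exact: ex_derive.
- by rewrite derive_eval_y; exact: continuous_eval.
Qed.

Lemma C2_on_eval A e : C2_on A (eval e).
Proof.
have hx := @C1_on_eval A (ediff 1 0 e); have hy := @C1_on_eval A (ediff 0 1 e).
split; [exact: C1_on_eval|by rewrite -derive_eval_x in hx|by rewrite -derive_eval_y in hy].
Qed.

Lemma laplacian_eval f ex ey z : 'D_dir_x f = eval ex -> 'D_dir_y f = eval ey ->
  laplacian f z = eval (ediff 1 0 ex) z + eval (ediff 0 1 ey) z.
Proof.
move=> hx hy; rewrite -(derive_eval_x ex) -(derive_eval_y ey).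
by congr (_ + _); [exact: (congr1 (fun g : R * R -> R => 'D_dir_x g z) hx)|
  exact: (congr1 (fun g : R * R -> R => 'D_dir_y g z) hy)].
Qed.

(* Real and imaginary parts of [(x + i y)^m]. *)
Fixpoint harm (m : nat) : expr * expr :=
  if m is m'.+1 then
    (EA (EM EX (harm m').1) (EM (EC (-1)) (EM EY (harm m').2)),
     EA (EM EX (harm m').2) (EM EY (harm m').1))
  else (EC 1, EC 0).

Definition harm_re m := eval (harm m).1.
Definition harm_im m := eval (harm m).2.

Lemma harm_reS m z : harm_re m.+1 z = z.1 * harm_re m z - z.2 * harm_im m z.
Proof. by rewrite /harm_re /harm_im /=; ring. Qed.

Lemma harm_imS m z : harm_im m.+1 z = z.1 * harm_im m z + z.2 * harm_re m z.
Proof. by []. Qed.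

(** The Cauchy-Riemann equations for (x + i y)^m, whose derivative is m (x + i y)^(m-1). *)
Lemma harm_diff m z :
  [/\ eval (ediff 1 0 (harm m).1) z = m%:R * harm_re m.-1 z,
      eval (ediff 1 0 (harm m).2) z = m%:R * harm_im m.-1 z,
      eval (ediff 0 1 (harm m).1) z = - (m%:R * harm_im m.-1 z) &
      eval (ediff 0 1 (harm m).2) z = m%:R * harm_re m.-1 z].
Proof.
elim: m => [|m [h1 h2 h3 h4]] /=; first by rewrite !mul0r oppr0.
rewrite -[m.+1%:R]natr1 h1 h2 h3 h4 -!/(harm_re _ _) -!/(harm_im _ _).
case: m {h1 h2 h3 h4} => [|m]; first by rewrite /harm_re /harm_im /=; split; ring.
by rewrite /= !harm_reS !harm_imS; split; ring.
Qed.

Lemma harm_polar m (r t : R) :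
  harm_re m (polar r t) = r ^+ m * cos (m%:R * t) /\ harm_im m (polar r t) = r ^+ m * sin (m%:R * t).
Proof.
elim: m => [|m [h1 h2]].
  by rewrite mul0r cos0 sin0 expr0 mulr1 mulr0.
rewrite harm_reS harm_imS h1 h2 -[m.+1%:R]natr1 mulrDl mul1r cosD sinD exprS /polar /=.
by split; ring.
Qed.

Definition bessel_mode m : R * R -> R := eval (EM (harm m).1 (EF m)).

(** The angular factor is harmonic and homogeneous of degree [m]; what remains is the radial
    equation, settled by [bes_rec]. *)
Lemma laplacian_bessel_mode m z : (0 < m)%N -> - laplacian (bessel_mode m) z = 4 * c * bessel_mode m z.
Proof.
case: m => // m _; set H := (harm m.+1).1.
(* The first derivatives are put in closed form so that [harm_diff] applies again to the second
   ones. *)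
pose ex := EA (EM (EC m.+1%:R) (EM (harm m).1 (EF m.+1))) (EM (EC (- (2 * c))) (EM H (EM EX (EF m.+2)))).
pose ey := EA (EM (EC (- m.+1%:R)) (EM (harm m).2 (EF m.+1))) (EM (EC (- (2 * c))) (EM H (EM EY (EF m.+2)))).
have Ex : 'D_dir_x (bessel_mode m.+1) = eval ex.
  rewrite derive_eval_x; apply/funext => w; have [h _ _ _] := harm_diff m.+1 w.
  have -> : eval (ediff 1 0 (EM (harm m.+1).1 (EF m.+1))) w =
    eval (ediff 1 0 (harm m.+1).1) w * eval (EF m.+1) w + eval (harm m.+1).1 w * eval (ediff 1 0 (EF m.+1)) w by [].
  by rewrite h /ex -/H /= /harm_re; ring.
have Ey : 'D_dir_y (bessel_mode m.+1) = eval ey.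
  rewrite derive_eval_y; apply/funext => w; have [_ _ h _] := harm_diff m.+1 w.
  have -> : eval (ediff 0 1 (EM (harm m.+1).1 (EF m.+1))) w =
    eval (ediff 0 1 (harm m.+1).1) w * eval (EF m.+1) w + eval (harm m.+1).1 w * eval (ediff 0 1 (EF m.+1)) w by [].
  by rewrite h /ey -/H /= /harm_im; ring.
rewrite (laplacian_eval z Ex Ey).
have [h1 _ h2 _] := harm_diff m.+1 z; have [h3 _ _ h4] := harm_diff m z.
have -> : eval (ediff 1 0 ex) z = m.+1%:R * (eval (ediff 1 0 (harm m).1) z * eval (EF m.+1) z
   - 2 * c * z.1 * harm_re m z * eval (EF m.+2) z) - 2 * c * (eval (ediff 1 0 (harm m.+1).1) z * z.1 * eval (EF m.+2) z
   + harm_re m.+1 z * (eval (EF m.+2) z - 2 * c * z.1 ^+ 2 * eval (EF m.+3) z)).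
  by rewrite /harm_re /ex /H; cbn [eval ediff]; ring.
have -> : eval (ediff 0 1 ey) z = - m.+1%:R * (eval (ediff 0 1 (harm m).2) z * eval (EF m.+1) z
   - 2 * c * z.2 * harm_im m z * eval (EF m.+2) z) - 2 * c * (eval (ediff 0 1 (harm m.+1).1) z * z.2 * eval (EF m.+2) z
   + harm_re m.+1 z * (eval (EF m.+2) z - 2 * c * z.2 ^+ 2 * eval (EF m.+3) z)).
  by rewrite /harm_re /harm_im /ey /H; cbn [eval ediff]; ring.
rewrite h1 h2 h3 h4.
have -> : bessel_mode m.+1 z = harm_re m.+1 z * eval (EF m.+1) z by [].
have := bes_rec m.+1 (c * (z.1 ^+ 2 + z.2 ^+ 2)).
rewrite -[bes m.+1 _]/(eval (EF m.+1) z) -[bes m.+2 _]/(eval (EF m.+2) z) -[bes m.+3 _]/(eval (EF m.+3) z).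
rewrite harm_reS -![_.+1.-1]/m -[m.+2%:R]natr1.
move: (eval (EF _) z) (eval (EF _) z) (eval (EF _) z) (harm_re m z) (harm_im m z) (harm_re m.-1 z) => B C' A h g h'.
move=> e; have -> : A = (m.+1%:R + 1) * B - c * (z.1 ^+ 2 + z.2 ^+ 2) * C' by rewrite -e addrK.
ring.
Qed.

End Eigenfunctions.

Section ModeNodalSet.
Variables (R : realType) (rho j : R) (m : nat).
Hypotheses (rho0 : 0 < rho) (m0 : (0 < m)%N) (j0 : 0 < j).
Hypotheses (bjj : bj m j = 0) (bj_neq0 : forall r, 0 < r < j -> bj m r != 0).
Let c : R := (j / rho) ^+ 2 / 4.
Let u := bessel_mode c m.
Let pi0 : 0 < pi :> R := pi_gt0 R.
Let mR0 : 0 < m%:R :> R. Proof. by rewrite ltr0n. Qed.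

Let mode_polar (r t : R) : u (polar r t) = r ^+ m * cos (m%:R * t) * bes m ((j / rho * r) ^+ 2 / 4).
Proof.
rewrite /u /bessel_mode -[LHS]/(harm_re c m (polar r t) * bes m (c * ((polar r t).1 ^+ 2 + (polar r t).2 ^+ 2))).
by rewrite (harm_polar c m r t).1 polar_sqr; congr (_ * bes m _); rewrite /c; field; rewrite gt_eqF.
Qed.

Let bes_eq0 (x : R) : 0 < x -> (bes m (x ^+ 2 / 4) == 0) = (bj m x == 0).
Proof. by move=> x0; rewrite /bj mulf_eq0 expf_eq0 (gt_eqF x0) andbF. Qed.

Let jr0 : 0 < j / rho. Proof. by rewrite divr_gt0. Qed.

Let mode_eq0 (r t : R) : 0 < r < rho -> (u (polar r t) == 0) = (cos (m%:R * t) == 0).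
Proof.
move=> /andP[r0 r1]; rewrite mode_polar !mulf_eq0 expf_eq0 (gt_eqF r0) andbF /= bes_eq0; last exact: mulr_gt0.
rewrite (negbTE (bj_neq0 _)) ?orbF // mulr_gt0 //=.
by rewrite mulrAC ltr_pdivrMr // ltr_pM2l.
Qed.

Lemma mode_eigenfunction : dirichlet_eigenfunction rho ((j / rho) ^+ 2) u.
Proof.
move: (rho0) (pi0) => rp pi_gt0'.
split.
- exact: C2_on_eval.
- by apply: continuous_subspaceT; exact: continuous_eval.
- move=> z _; rewrite laplacian_bessel_mode //; congr (_ * _); rewrite /c; field; rewrite gt_eqF //.
- move=> z hz; have [r [t [r0 r2 tt zE]]] := polarP z.
  have -> : z = polar rho t.
    rewrite zE; congr (polar _ t); apply/eqP.
    by rewrite -(eqrXn2 (n := 2)) ?(ltW rho0) // r2; apply/eqP; exact: hz.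
  rewrite mode_polar divfK ?gt_eqF //; have /eqP := bjj; rewrite -bes_eq0 // => /eqP ->.
  by rewrite mulr0.
- exists (polar (rho / 2) 0).
    by apply: polar_disc => //; rewrite gtr0_norm; lra.
  by rewrite mode_eq0 ?mulr0 ?cos0 ?oner_neq0 //; apply/andP; split; lra.
Qed.

Let cos_odd n : cos ((2 * n%:R + 1) * (pi / 2)) = 0 :> R.
Proof.
elim: n => [|n IH]; first by rewrite mulr0 add0r mul1r cos_pihalf.
have -> : (2 * n.+1%:R + 1) * (pi / 2) = (2 * n%:R + 1) * (pi / 2) + pi :> R by rewrite -[n.+1%:R]natr1; field.
by rewrite cosDpi IH oppr0.
Qed.

(** Zeros of [cos (m t)]. As [th (l + m) = th l + pi], indices below [m] name the diameters and
    indices below [2 m] the rays. *)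
Let th (l : nat) : R := (2 * l%:R + 1) * (pi / 2) / m%:R.

Let cos_th l : cos (m%:R * th l) = 0.
Proof. by rewrite /th mulrC divfK ?gt_eqF //; exact: cos_odd. Qed.

Let nodal_line (s : R) l : `|s| < rho -> nodal_set rho u (polar s (th l)).
Proof.
move=> h; split; first exact: polar_disc.
by rewrite /= mode_polar cos_th mulr0 mul0r.
Qed.

(** With signed radii, a ray of index [l >= m] is the negative half of the line [l - m]. *)
Let nodal_lineP z : nodal_set rho u z -> exists (l : 'I_m) s, `|s| < rho /\ z = polar s (th l).
Proof.
move: (rho0) (pi0) => rp pi_gt0'.
move=> [dz uz]; have [r [t [r0 r2 tt zE]]] := polarP z.
move: r0; rewrite le_eqVlt => /predU1P[r0|r0].
  by exists (Ordinal m0), 0; rewrite normr0 zE -r0 /polar !mul0r.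
have rr : r < rho by rewrite -(ltr_pXn2r (n := 2)) ?nnegrE ?(ltW r0) ?(ltW rho0) // r2.
have /eqP : u (polar r t) = 0 by rewrite -zE.
rewrite mode_eq0 ?r0 // => /eqP ct; case/andP: tt => t0 t1.
have mt0 : 0 <= m%:R * t by rewrite mulr_ge0 // ltW.
have mt1 : m%:R * t < (m + m)%:R * pi.
  by rewrite (_ : _ * pi = m%:R * (2 * pi)) ?ltr_pM2l // natrD; ring.
have yge : 0 <= m%:R * t - pi / 2.
  rewrite leNgt; apply/negP => yl.
  have := @cos_gt0_pihalf R (m%:R * t); rewrite ct ltxx => h.
  have : false by apply: h; apply/andP; split; lra.
  by [].
have sy : sin (m%:R * t - pi / 2) = 0 by rewrite sinBpihalf ct oppr0.
have [|l _ lE] := @sin_eq0 R (m + m) (m%:R * t - pi / 2) _ sy.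
  by rewrite yge /=; lra.
have tE : t = (l%:R * pi + pi / 2) / m%:R by rewrite -lE subrK mulrC mulKf ?gt_eqF.
have rn : `|r| < rho by rewrite gtr0_norm.
have [lm|ml] := ltnP l m.
  exists (Ordinal lm), r; split => //; rewrite zE tE /th; congr polar; field; rewrite gt_eqF //.
have lm : (l - m < m)%N by rewrite ltn_subLR.
exists (Ordinal lm), (- r); rewrite normrN; split => //.
have -> : z = polar r (th (l - m) + pi).
  rewrite zE tE /th; congr polar; rewrite natrB //; field; rewrite gt_eqF //.
by rewrite /polar cosDpi sinDpi !mulrN !mulNr.
Qed.

Lemma mode_nodal_set_segments : finite_union_of_segments rho (nodal_set rho u).
Proof.
move: (rho0) (pi0) => rp pi_gt0'.
exists m, (fun l => straight_segment (polar rho (th l)) (polar (- rho) (th l)) `&` disc rho); split.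
  move=> l; exists (polar rho (th l)), (polar (- rho) (th l)); split => //.
  - by apply: polar_closed_disc; rewrite gtr0_norm.
  - by apply: polar_closed_disc; rewrite normrN gtr0_norm.
  - apply/eqP => e; have := polar_sqr rho (th l); have := congr1 fst e; have := congr1 snd e.
    rewrite /= !mulNr => /eqP h1 /eqP h2; move: h1 h2; rewrite -!addr_eq0 -!mulr2n !mulrn_eq0 /= => /eqP -> /eqP ->.
    by rewrite expr0n addr0 => /esym/eqP; rewrite sqrf_eq0 gt_eqF.
have segE (t s : R) : (1 - t) *: polar rho s + t *: polar (- rho) s = polar ((1 - 2 * t) * rho) s.
  rewrite /polar -[LHS]/((1 - t) *: (rho * cos s) + t *: (- rho * cos s), (1 - t) *: (rho * sin s) + t *: (- rho * sin s)).
  by rewrite /GRing.scale /=; congr pair; ring.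
apply/seteqP; split => [z hz|z [l _ [[t /= t01 <-] dz]]].
  have [l [s [hs zE]]] := nodal_lineP hz; exists l => //; split; last by case: hz.
  move: hs; rewrite ltr_norml => /andP[s0 s1].
  exists ((1 - s / rho) / 2).
    have s2 : s / rho < 1 by rewrite ltr_pdivrMr // mul1r.
    have s3 : - 1 < s / rho by rewrite ltr_pdivlMr // mulN1r.
    by apply/andP; split; lra.
  by rewrite segE zE; congr polar; field; rewrite gt_eqF.
move: dz; rewrite segE => dz; apply: nodal_line.
move: dz; rewrite /disc /= polar_sqr -[_ ^+ 2]real_normK ?num_real // ltr_pXn2r ?nnegrE //.
exact: ltW.
Qed.

(** Two of the [2 m] directions differ by an angle strictly between 0 and [2 pi], so
    [cos (2 y) = 1 - 2 sin^2 y] stays below 1, as [hausdorff1_ge_rays] requires. *)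
Lemma mode_nodal_length : (((m + m)%:R * rho)%:E <= hausdorff1 (nodal_set rho u))%E.
Proof.
move: (rho0) (pi0) => rp pi_gt0'.
apply: (@hausdorff1_ge_rays R (m + m) (fun i => polar 1 (th i)) rho) => //.
- by move=> i; rewrite polar_sqr expr1n.
- move=> i k ik; rewrite /polar /= !mul1r -cosB.
  wlog ki : i k ik / (k < i)%N.
    move=> H; case: (ltngtP k i) => [ki|ki|/ord_inj e]; first exact: H.
      by rewrite -cosN opprB; apply: H => //; rewrite eq_sym.
    by rewrite e eqxx in ik.
  have -> : th i - th k = ((i - k)%N%:R * pi / m%:R / 2) + ((i - k)%N%:R * pi / m%:R / 2).
    by rewrite /th natrB; [field; rewrite gt_eqF|exact: ltnW].
  set y := _ / 2; have y0 : 0 < y by rewrite /y !divr_gt0 // mulr_gt0 // ltr0n subn_gt0.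
  have y1 : y < pi.
    rewrite /y ltr_pdivrMr // ltr_pdivrMr // -mulrA mulrC ltr_pM2l // -natrM ltr_nat.
    by rewrite mul2n -addnn (leq_ltn_trans (leq_subr _ _)).
  rewrite cosD -!expr2 cos2sin2; have := @sin_gt0_pi R y; rewrite y0 y1 => /(_ isT) sy.
  have s2 : 0 < sin y ^+ 2 by rewrite exprn_gt0.
  by lra.
- move=> i r /andP[r0 r1]; have -> : (r * (polar 1 (th i)).1, r * (polar 1 (th i)).2) = polar r (th i).
    by rewrite /polar /= !mul1r.
  by apply: nodal_line; rewrite gtr0_norm.
Qed.

Lemma mode_ratio_ge : ((2 * rho ^+ 2 * (m%:R / j))%:E <= nodal_ratio rho ((j / rho) ^+ 2) u)%E.
Proof.
have -> : 2 * rho ^+ 2 * (m%:R / j) = (m + m)%:R * rho * (j / rho)^-1.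
  by rewrite natrD; field; rewrite !gt_eqF.
rewrite /nodal_ratio sqrtr_sqr gtr0_norm // EFinM; apply: lee_wpmul2r; last exact: mode_nodal_length.
by rewrite lee_fin invr_ge0 ltW.
Qed.

End ModeNodalSet.

Lemma fin_ratio_cvg (R : realType) (x y : nat -> \bar R) (l : R) (a : nat -> R) :
  (forall k, (a k)%:E <= x k)%E -> (forall k, x k <= y k)%E -> (forall k, y k <= l%:E)%E ->
  a k @[k --> \oo] --> l -> x k @[k --> \oo] --> l%:E /\ y k @[k --> \oo] --> l%:E.
Proof.
move=> ax xy yl al; have aE : (a k)%:E @[k --> \oo] --> l%:E by apply/cvg_EFin => //; near=> k.
have cE : (fun=> l%:E) k @[k --> \oo] --> l%:E by exact: cvg_cst.
split; apply: squeeze_cvge aE cE; near=> k.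
  by rewrite ax (le_trans (xy k) (yl k)).
by rewrite (le_trans (ax k) (xy k)) yl.
Unshelve. all: by end_near. Qed.

Theorem corollary3 (R : realType) (rho : R) (rho_gt0 : 0 < rho) :
  exists (u : nat -> R * R -> R) (lambda : nat -> R),
    [/\ forall k, dirichlet_eigenfunction rho (lambda k) (u k),
        lambda k @[k --> \oo] --> +oo,
        forall k, finite_union_of_segments rho (nodal_set rho (u k)) &
        nodal_ratio rho (lambda k) (u k) @[k --> \oo] --> H2 rho].
Proof.
(* Orders start at 1, since order 0 has no nodal diameter. *)
have [j hj] := choice (fun k => @bj_first_zero R k.+1).
have j0 k : 0 < j k by case: (hj k).
have jz k : bj k.+1 (j k) = 0 by case: (hj k).
have jn k r : 0 < r < j k -> bj k.+1 r != 0 by case: (hj k) => _ _ h; exact: h.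
have jgt k : k.+1%:R < j k by apply: (@bj_zero_gt R k.+1) => //.
pose lam k := (j k / rho) ^+ 2.
pose u k := bessel_mode (lam k / 4) k.+1.
have lam0 k : 0 < lam k by rewrite exprn_gt0 // divr_gt0.
have eig k : dirichlet_eigenfunction rho (lam k) (u k).
  exact: (mode_eigenfunction rho_gt0 (ltn0Sn k) (j0 k) (jz k) (jn k)).
have lamoo : lam k @[k --> \oo] --> +oo.
  apply/cvgryPge => A; near=> k.
  have jk : `|A| + 1 <= j k / rho.
    rewrite ler_pdivlMr //; apply: le_trans (ltW (jgt k)).
    apply: (@le_trans _ _ k%:R); last by rewrite ler_nat.
    by near: k; exact: nbhs_infty_ger.
  apply: (@le_trans _ _ ((`|A| + 1) ^+ 2)).
    have := ler_norm A; have := normr_ge0 A; nra.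
  by rewrite /lam lerXn2r ?nnegrE // ?addr_ge0 // divr_ge0 ?ltW.
pose a k := 2 * rho ^+ 2 * (k.+1%:R / j k).
have aoo : a k @[k --> \oo] --> 2 * rho ^+ 2.
  rewrite -[X in _ --> X]mulr1; apply: cvgM; first exact: cvg_cst.
  apply/cvgrPdist_le => e e0.
  have [M hM] := @bj_first_zero_le R e e0.
  near=> k; have := hM k.+1 _ _ (j0 k) (jn k) => /(_ _) jk.
  have kM : (M <= k.+1)%N by apply: leqW; near: k; exact: nbhs_infty_ge.
  have {jk} jk := hM k.+1 kM _ (j0 k) (jn k).
  have q1 : k.+1%:R / j k <= 1 by rewrite ler_pdivrMr // mul1r ltW.
  rewrite ger0_norm ?subr_ge0 // lerBlDr -lerBlDl ler_pdivlMr //.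
  have k0 : 0 < k.+1%:R :> R by rewrite ltr0n.
  have [e1|e1] := leP 1 e.
    apply: (@le_trans _ _ 0); last exact: ltW.
    by rewrite mulr_le0_ge0 ?subr_le0 // ltW.
  (* By the bound on the first zero; then [(1 - e)(1 + e) <= 1]. *)
  apply: (le_trans (_ : _ <= (1 - e) * (k.+1%:R * (1 + e)))).
    by rewrite ler_wpM2l // subr_ge0 ltW.
  by nra.
have ge_a k : ((a k)%:E <= nodal_ratio rho (lam k) (u k))%E.
  exact: (mode_ratio_ge rho_gt0 (ltn0Sn k) (j0 k)).
(* The ratio and the supremum at [Lambda = lam k] are both squeezed between [a k] and [2 rho^2]. *)
have le_sup k : (nodal_ratio rho (lam k) (u k) <= sup_nodal_ratio rho (lam k))%E.
  by apply: ereal_sup_ubound; exists (lam k, u k) => //; split => /=; [exact: lexx|exact: eig].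
have sup_le k : (sup_nodal_ratio rho (lam k) <= (2 * rho ^+ 2)%:E)%E.
  apply: ub_ereal_sup => _ [z [hz eigz] <-].
  by apply: nodal_ratio_le => //; exact: lt_le_trans hz.
have [x_cvg y_cvg] := fin_ratio_cvg ge_a le_sup sup_le aoo.
exists u, lam; split => //.
  by move=> k; exact: (mode_nodal_set_segments rho_gt0 (ltn0Sn k) (j0 k) (jn k)).
suff -> : H2 rho = (2 * rho ^+ 2)%:E by [].
(* The limit defining [H2] exists, so it may be evaluated along the eigenvalues [lam k]. *)
have h := cvg_comp _ _ lamoo (@cvg_sup_nodal_ratio R rho).
by rewrite -(cvg_lim _ h) //; apply/cvg_lim.
Unshelve. all: by end_near. Qed.
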